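(* Let $n \ge 2$. (1) For every domain $G \subsetneq \mathbb{R}^n$ and every $x \in G$, the $j$-metric ball $B_j(x,r) = \{ y \in G : j_G(x,y) < r \}$ is close-to-convex if $r \in (0, \log(1+\sqrt{3})]$. (2) For every $y \in \mathbb{R}^n \setminus \{0\}$, the quasihyperbolic ball $B_k(y,r) = \{ z \in \mathbb{R}^n \setminus \{0\} : k_{\mathbb{R}^n \setminus \{0\}}(y,z) < r \}$ is close-to-convex if $r \in (0,\lambda]$, where $\lambda$ is the solution of the equation $$\cos \sqrt{z^2-1} + \sqrt{z^2-1}\, \sin \sqrt{z^2-1} = 0$$ for $z \in (2,\pi)$; it has the numerical approximation $\lambda \approx 2.97169$. (3) Moreover, the constants $\log(1+\sqrt{3})$ in (1) and $\lambda$ in (2) are sharp in the case $n = 2$, i.e. for $n=2$ neither of them can be replaced by a larger constant.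
   Context: A domain is a nonempty open connected set. For a proper subdomain $G \subsetneq \mathbb{R}^n$, $n \ge 2$, let $d(x) = d(x,\partial G)$ denote the Euclidean distance from $x \in G$ to $\partial G$. The distance ratio metric ($j$-metric) in $G$ is $j_G(x,y) = \log\left( 1 + \frac{|x-y|}{\min\{d(x),d(y)\}} \right)$. The quasihyperbolic length of a rectifiable arc $\gamma \subset G$ is $\ell_k(\gamma) = \int_\gamma \frac{|dz|}{d(z,\partial G)}$, and the quasihyperbolic metric is $k_G(x,y) = \inf_\gamma \ell_k(\gamma)$, where the infimum is over all rectifiable curves in $G$ joining $x$ and $y$. A half-line is a set of the form $\{ ty+z : t > 0 \}$ or $\{ ty+z : t \ge 0 \}$ with $z \in \mathbb{R}^n$ and $y \in \mathbb{R}^n \setminus \{0\}$. A set $D \subsetneq \mathbb{R}^n$ is close-to-convex if $\mathbb{R}^n \setminus D$ can be covered with non-intersecting half-lines, i.e. $\mathbb{R}^n \setminus D$ is a union of pairwise disjoint half-lines. Close-to-convex sets need not be connected. The equation defining $\lambda$ has exactly one solution in $(2,\pi)$. *)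

(* Defs.v *)
From mathcomp Require Import all_boot all_order all_algebra.
From mathcomp Require Import all_classical all_reals all_analysis.

Set Implicit Arguments.
Unset Strict Implicit.
Unset Printing Implicit Defensive.

Import Order.TTheory GRing.Theory Num.Theory.
Import numFieldNormedType.Exports.

Local Open Scope classical_set_scope.
Local Open Scope ring_scope.

Section Euclidean.
Context {R : realType} {n : nat}.
Implicit Types (x y z : 'rV[R]_n) (G D H : set 'rV[R]_n).

(* The norm `|x| of the library on 'rV[R]_n is the sup norm. It induces the
   Euclidean topology, so open, closure and connected can be used as they are,
   but metric notions have to be built on the following norm. *)
Definition enorm x : R := Num.sqrt (\sum_(i < n) x 0 i ^+ 2).

Definition domain G : Prop := [/\ open G, connected G & G !=set0].

Definition boundary G : set 'rV[R]_n := closure G `\` interior G.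

(* Only meaningful when the boundary is nonempty, e.g. for a domain G != R^n. *)
Definition bdist G x : R := inf [set enorm (x - z) | z in boundary G].

Definition j_metric G x y : R :=
  ln (1 + enorm (x - y) / Num.min (bdist G x) (bdist G y)).

Definition j_ball G x (r : R) : set 'rV[R]_n :=
  [set y | G y /\ j_metric G x y < r].

Section Curves.
Implicit Types (g : R -> 'rV[R]_n) (a b : R).

(* Length of the polygon inscribed in g with parameters a = s_0 < s_1 < ... = b,
   where, as for itv_partition, the list s does not contain a. *)
Definition polygon_length a b g (s : seq R) : R :=
  let F := g \o nth b (a :: s) in
  \sum_(0 <= i < size s) enorm (F i.+1 - F i).

Definition arc_length a b g : \bar R :=
  ereal_sup [set (polygon_length a b g s)%:E | s in itv_partition a b].

Definition curve_in G a b g : Prop :=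
  [/\ a <= b, {within `[a, b], continuous g} & g @` `[a, b] `<=` G].

Definition rectifiable a b g : Prop := (arc_length a b g < +oo)%E.

(* Arc length parametrization of g: the point g t, for any t in [a, b] such that
   the restriction of g to [a, t] has length s. All these t give the same point,
   and there is one for each s between 0 and the length of g. *)
Definition arc_param a b g (s : R) : 'rV[R]_n :=
  g (xget a [set t | t \in `[a, b] /\ arc_length a t g = s%:E]).

Definition curve_integral (rho : 'rV[R]_n -> R) a b g : \bar R :=
  (\int[lebesgue_measure]_(s in `[0%R, fine (arc_length a b g)])
     (rho (arc_param a b g s))%:E)%E.

Definition qh_length G a b g : \bar R :=
  curve_integral (fun z => (bdist G z)^-1) a b g.

End Curves.

Definition qh_metric G x y : \bar R :=
  ereal_inf [set l | exists a b (g : R -> 'rV[R]_n),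
    [/\ curve_in G a b g, rectifiable a b g, g a = x, g b = y
      & l = qh_length G a b g]].

Definition qh_ball G x (r : R) : set 'rV[R]_n :=
  [set y | G y /\ (qh_metric G x y < r%:E)%E].

Definition half_line H : Prop :=
  exists y z, y != 0 /\
    (H = [set t *: y + z | t in [set t : R | 0 < t]] \/
     H = [set t *: y + z | t in [set t : R | 0 <= t]]).

Definition close_to_convex D : Prop :=
  D != setT /\
  exists F : set (set 'rV[R]_n),
    [/\ forall H, F H -> half_line H,
        trivIset F id
      & ~` D = \bigcup_(H in F) H].

End Euclidean.

Definition is_lambda {R : realType} (z : R) : Prop :=
  [/\ 2 < z, z < pi &
      cos (Num.sqrt (z ^+ 2 - 1)) +
      Num.sqrt (z ^+ 2 - 1) * sin (Num.sqrt (z ^+ 2 - 1)) = 0].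

(* Main.v *)
Require Import Defs.
From mathcomp Require Import all_boot all_order all_algebra.
From mathcomp Require Import all_classical all_reals all_analysis.
From mathcomp Require Import wochoice ring lra.

Import Order.TTheory GRing.Theory Num.Theory.
Import numFieldNormedType.Exports.

Set Implicit Arguments.
Unset Strict Implicit.
Unset Printing Implicit Defensive.

Local Open Scope classical_set_scope.
Local Open Scope ring_scope.

(** Let D be one of the balls in question. Its complement has to be partitioned
into half-lines. Whenever a direction w(y) is attached to every point y of the
complement in such a way that the ray from y stays in the complement and w is
constant along it, and no full line appears in this way, the rays of w merge
into a partition (field_close_to_convex). All positive results produce either
such a field or the half-lines themselves.

The j-metric. Put the center of the ball at 0, let d be its distance from the
boundary B of G and c = e^r - 1. The complement of the ball consists of the
points with |v| >= c d and of the Apollonian sets c |v - w| <= |v| for w in B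
(j_ballC). For c <= sqrt 3, a ray that starts in the Apollonian set of w in the
direction of w, or of another point z of B with z.w >= z.z, stays in the
complement: by the time it leaves the set of w it has entered the set of z, or
has left the ball of radius c d (apollonian_ray). In the plane, these directions
have an exchange property: when two such rays cross, one of the points may use
the direction of the other (allowed_exchange). By an extremal choice, directions
can then be selected without any crossings (exists_noncrossing), which gives a
field. In dimension at least three, the directions that are available at a point
form a set with interior (apollonian_open_directions), and a transfinite
induction over the points of the complement covers them one by one: fewer than
continuum many earlier half-lines cannot block all directions of a
two-parameter family (avoid_rays, open_directions_close_to_convex).

The quasihyperbolic metric of R^n without the origin. Since the distance to the
boundary is |z|, the metric is |dz| / |z|. In the coordinates log |z| and angle
with y this is a flat metric, and

    k(y, z)^2 = (log |z| - log |y|)^2 + angle(y, z)^2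

(qh_metric_punctured). The upper bound is the length of a logarithmic spiral. For
the lower bound one compares, along an arbitrary rectifiable curve, the
increments of a linear function of the two coordinates with those of the
quasihyperbolic length (calibration_local, qh_length_ge). On a line parallel to
y, at distance h from the axis, the derivative of k^2 has the sign of
x log |z| - h angle if |y| = 1, where x is the position along the line. For
x >= 0 this changes its sign at most once, from minus to plus.
For x < 0 it can only be nonnegative where k >= lambda, because
angle >= - lambda cos angle on [pi/2, pi], and this inequality, with equality at
sqrt (lambda^2 - 1), is what characterizes lambda (lambda_tangent,
line_dist2_ge). Hence a ball of radius at most lambda meets every line parallel
to y in an interval, and its complement is covered by half-lines parallel to y
that point away from it (directionally_convex_close_to_convex).

Sharpness. In both cases take G to be the plane without the origin. For larger
radii the complement has a bounded pocket that is wider than its mouth. A ray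
that starts at the highest point of the pocket, or at the point of its boundary
with angle sqrt (lambda^2 - 1), can leave the pocket only through the mouth and
must descend; the ray from the mirror image must ascend, so the two cross
(mirror_not_close_to_convex).

The value of lambda follows from Taylor bounds for sine and cosine at two
rational points (taylor_bounds). *)


(** * The Euclidean inner product *)

Section Dot.
Context {R : realType} {n : nat}.
Implicit Types (x y z u v : 'rV[R]_n) (a b t : R).

Definition dot x y : R := \sum_(i < n) x 0 i * y 0 i.

Lemma dotC x y : dot x y = dot y x.
Proof. by apply: eq_bigr => i _; rewrite mulrC. Qed.

Lemma dotDl x y z : dot (x + y) z = dot x z + dot y z.
Proof. by rewrite /dot -big_split; apply: eq_bigr => i _; rewrite mxE mulrDl. Qed.

Lemma dotDr x y z : dot x (y + z) = dot x y + dot x z.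
Proof. by rewrite !(dotC x) dotDl. Qed.

Lemma dotZl a x y : dot (a *: x) y = a * dot x y.
Proof. by rewrite /dot mulr_sumr; apply: eq_bigr => i _; rewrite mxE mulrA. Qed.

Lemma dotZr a x y : dot x (a *: y) = a * dot x y.
Proof. by rewrite dotC dotZl dotC. Qed.

Lemma dotNl x y : dot (- x) y = - dot x y.
Proof. by rewrite -scaleN1r dotZl mulN1r. Qed.

Lemma dotNr x y : dot x (- y) = - dot x y.
Proof. by rewrite dotC dotNl dotC. Qed.

Lemma dot0l x : dot 0 x = 0.
Proof. by rewrite -(scale0r 0) dotZl mul0r. Qed.

Lemma dot0r x : dot x 0 = 0.
Proof. by rewrite dotC dot0l. Qed.

Definition dotE := (dotDl, dotDr, dotNl, dotNr, dotZl, dotZr, dot0l, dot0r).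

Lemma dot_ge0 x : 0 <= dot x x.
Proof. by apply: sumr_ge0 => i _; rewrite -expr2 sqr_ge0. Qed.

Lemma dot_eq0 x : (dot x x == 0) = (x == 0).
Proof.
apply/idP/eqP => [|->]; last by rewrite dot0l.
rewrite psumr_eq0 => [/allP h|i _]; last by rewrite -expr2 sqr_ge0.
apply/rowP => i; rewrite mxE.
by have /(_ i (mem_index_enum _)) := h; rewrite -expr2 sqrf_eq0 => /eqP.
Qed.

Lemma dot_gt0 x : (0 < dot x x) = (x != 0).
Proof. by rewrite lt_def dot_ge0 andbT dot_eq0. Qed.

Lemma enormE x : enorm x = Num.sqrt (dot x x).
Proof. by rewrite /enorm; congr Num.sqrt; apply: eq_bigr => i _; rewrite expr2. Qed.

Lemma sqr_enorm x : enorm x ^+ 2 = dot x x.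
Proof. by rewrite enormE sqr_sqrtr ?dot_ge0. Qed.

Lemma enorm_ge0 x : 0 <= enorm x.
Proof. exact: sqrtr_ge0. Qed.

Lemma enorm_eq0 x : (enorm x == 0) = (x == 0).
Proof. by rewrite -(sqrf_eq0 (enorm x)) sqr_enorm dot_eq0. Qed.

Lemma enorm_gt0 x : (0 < enorm x) = (x != 0).
Proof. by rewrite lt_def enorm_ge0 andbT enorm_eq0. Qed.

Lemma enorm0 : enorm (0 : 'rV[R]_n) = 0.
Proof. by apply/eqP; rewrite enorm_eq0. Qed.

Lemma enormN x : enorm (- x) = enorm x.
Proof. by rewrite !enormE dotNl dotNr opprK. Qed.

Lemma enormB x y : enorm (x - y) = enorm (y - x).
Proof. by rewrite -enormN opprB. Qed.

Lemma enormZ a x : enorm (a *: x) = `|a| * enorm x.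
Proof. by rewrite !enormE dotZl dotZr mulrA -expr2 sqrtrM ?sqr_ge0 // sqrtr_sqr. Qed.

Lemma cauchy_schwarz x y : dot x y <= enorm x * enorm y.
Proof.
have [->|x0] := eqVneq x 0; first by rewrite dot0l enorm0 mul0r.
apply: le_trans (ler_norm _) _.
rewrite -(@ler_pXn2r _ 2) ?nnegrE ?mulr_ge0 ?enorm_ge0 //.
rewrite exprMn !sqr_enorm real_normK ?num_real //.
have xx : 0 < dot x x by rewrite dot_gt0.
have := dot_ge0 (y - (dot x y / dot x x) *: x).
set k := dot x y / dot x x.
have ek : dot x y = k * dot x x by rewrite divfK ?gt_eqF.
rewrite !dotE (dotC y x) !ek => h.
by have : 0 <= dot x x * (dot y y - k * (k * dot x x)); [rewrite mulr_ge0; lra|lra].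
Qed.

Lemma enormD x y : enorm (x + y) <= enorm x + enorm y.
Proof.
rewrite -(@ler_pXn2r _ 2) ?nnegrE ?addr_ge0 ?enorm_ge0 //.
rewrite sqrrD !sqr_enorm !dotE (dotC y x).
have := cauchy_schwarz x y; lra.
Qed.

Lemma enorm_triangle y x z : enorm (x - z) <= enorm (x - y) + enorm (y - z).
Proof. by have := enormD (x - y) (y - z); rewrite addrA subrK. Qed.

Lemma ler_enorm x y : (enorm x <= enorm y) = (dot x x <= dot y y).
Proof. by rewrite -(@ler_pXn2r _ 2) ?nnegrE ?enorm_ge0 // !sqr_enorm. Qed.

Lemma ltr_enorm x y : (enorm x < enorm y) = (dot x x < dot y y).
Proof. by rewrite !ltNge ler_enorm. Qed.

(** The Euclidean norm and the sup norm are equivalent, so that they have the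
same neighbourhoods. *)
Lemma coord_le_enorm x i : `|x 0 i| <= enorm x.
Proof.
rewrite -(@ler_pXn2r _ 2) ?nnegrE ?enorm_ge0 // real_normK ?num_real // sqr_enorm.
rewrite /dot (bigD1 i) //= -expr2 lerDl.
by apply: sumr_ge0 => j _; rewrite -expr2 sqr_ge0.
Qed.

Lemma norm_le_enorm x : `|x| <= enorm x.
Proof.
rewrite /Num.norm /= mx_normrE.
apply: bigmax_le => [|[i j] _ /=]; first exact: enorm_ge0.
by rewrite (ord1 i) coord_le_enorm.
Qed.

Lemma coord_le_norm x i : `|x 0 i| <= `|x|.
Proof.
rewrite [leRHS]/Num.norm /= mx_normrE.
exact: (@le_bigmax _ _ _ _ (fun ij : 'I_1 * 'I_n => `|x ij.1 ij.2|) (0, i)).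
Qed.

Lemma enorm_le_norm x : enorm x <= n%:R * `|x|.
Proof.
have h : 0 <= n%:R * `|x| by rewrite mulr_ge0 ?ler0n.
rewrite -(@ler_pXn2r _ 2) ?nnegrE ?enorm_ge0 // sqr_enorm.
have [n0|n0] := posnP n.
  rewrite /dot big1 ?sqr_ge0 // => i _.
  by have := ltn_ord i; rewrite {2}n0.
apply: (@le_trans _ _ (\sum_(i < n) `|x| ^+ 2)).
  apply: ler_sum => i _; rewrite -expr2 -real_normK ?num_real //.
  by rewrite ler_pXn2r ?nnegrE // coord_le_norm.
rewrite sumr_const card_ord exprMn -[leLHS]mulr_natl ler_wpM2r ?sqr_ge0 //.
by rewrite expr2 ler_peMr ?ler0n // ler1n.
Qed.

End Dot.


(** * Topology of the Euclidean norm and distance to the boundary *)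

Section Topology.
Context {R : realType} {n : nat}.
Implicit Types (x y z w : 'rV[R]_n) (G : set 'rV[R]_n).

Lemma nbhs_enormP x (A : set 'rV[R]_n) :
  nbhs x A <-> exists2 e, 0 < e & forall y, enorm (x - y) < e -> A y.
Proof.
split=> [/nbhs_ballP[e /= e0 h]|[e e0 h]].
  exists e => // y xy; apply: h; rewrite -ball_normE /=.
  exact: le_lt_trans (norm_le_enorm _) xy.
apply/nbhs_ballP; exists (e / n.+1%:R) => /=; first by rewrite divr_gt0.
move=> y; rewrite -ball_normE /= => xy; apply: h.
apply: le_lt_trans (enorm_le_norm _) _.
apply: (@le_lt_trans _ _ (n.+1%:R * `|x - y|)).
  by rewrite ler_wpM2r // ler_nat.
by rewrite mulrC -ltr_pdivlMr.
Qed.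

Lemma lipschitz_continuous (f : 'rV[R]_n -> R) k :
  (forall x y, `|f x - f y| <= k * enorm (x - y)) -> continuous f.
Proof.
move=> h x; apply/(@cvgrPdist_lt _ _ _ _ (nbhs_filter x)) => e e0.
have k0 : 0 < `|k| + 1 by rewrite ltr_wpDl.
apply/nbhs_enormP; exists (e / (`|k| + 1)); first by rewrite divr_gt0.
move=> y xy; apply: le_lt_trans (h _ _) _.
apply: (@le_lt_trans _ _ ((`|k| + 1) * enorm (x - y))).
  rewrite ler_wpM2r ?enorm_ge0 //; have := ler_norm k; lra.
by rewrite mulrC -ltr_pdivlMr.
Qed.

Lemma enorm_lipschitz x y : `|enorm x - enorm y| <= enorm (x - y).
Proof.
have h1 := enormD (x - y) y; have h2 := enormD (y - x) x.
rewrite !subrK in h1 h2; rewrite ler_norml.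
have h3 := enormB x y; lra.
Qed.

Lemma continuous_enormB w : continuous (fun x => enorm (x - w)).
Proof.
apply: (@lipschitz_continuous _ 1) => x y; rewrite mul1r.
by have := enorm_lipschitz (x - w) (y - w); rewrite opprB addrA subrK.
Qed.

Lemma continuous_enorm : continuous (@enorm R n).
Proof.
by apply: (@lipschitz_continuous _ 1) => x y; rewrite mul1r enorm_lipschitz.
Qed.

Lemma dot_le_norm x y : `|dot x y| <= enorm x * enorm y.
Proof.
rewrite ler_norml cauchy_schwarz andbT lerNl -dotNl -[enorm x]enormN.
exact: cauchy_schwarz.
Qed.

Lemma continuous_dot w : continuous (fun x => dot x w).
Proof.
apply: (@lipschitz_continuous _ (enorm w)) => x y.
by rewrite -dotNl -dotDl mulrC; exact: dot_le_norm.
Qed.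

Lemma continuous_sqdot : continuous (fun x => dot x x).
Proof.
have -> : (fun x => dot x x) = (fun x => enorm x * enorm x).
  by apply/funext => x; rewrite -sqr_enorm expr2.
by move=> x; apply: continuousM; exact: continuous_enorm.
Qed.

Lemma closed_sub0 (f : 'rV[R]_n -> R) : continuous f -> closed [set x | 0 <= f x].
Proof.
move=> cf; apply: (@preimage_closed _ _ f [set t | 0 <= t]); first by move=> z _; exact: cf.
exact: closed_ge.
Qed.

Lemma closed_ball_enorm x e : closed [set y | enorm (y - x) <= e].
Proof.
apply: (@preimage_closed _ _ (fun y => enorm (y - x)) [set t | t <= e]).
  by move=> z _; exact: continuous_enormB.
exact: closed_le.
Qed.

Lemma compact_ball_enorm x e : compact [set y | enorm (y - x) <= e].
Proof.
apply: bounded_closed_compact; last exact: closed_ball_enorm.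
exists (e + enorm x); split; first exact: num_real.
move=> M hM y /= hy; apply: le_trans (norm_le_enorm _) _.
apply: le_trans (ltW hM); rewrite -[in leLHS](subrK x y).
by apply: le_trans (enormD _ _) _; rewrite lerD2r.
Qed.

Lemma boundary_closed G : closed (boundary G).
Proof.
rewrite /boundary setDE; apply: closedI; first exact: closed_closure.
exact/open_closedC/open_interior.
Qed.

(** Otherwise the interiors of G and of its complement would disconnect the
segment. *)
Lemma boundary_segment G x y : G x -> ~ G y ->
  exists t : R, [/\ 0 <= t, t <= 1 & boundary G (x + t *: (y - x))].
Proof.
move=> Gx nGy; apply: contrapT => nb.
pose f := fun t : R => x + t *: (y - x).
have cf : continuous f.
  by move=> t; apply: cvgD; [exact: cvg_cst|exact: scalel_continuous].
have nbf t : 0 <= t <= 1 -> ~ boundary G (f t).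
  by move=> /andP[t0 t1] bt; apply: nb; exists t.
pose S := f @` `[0, 1].
have f0 : f 0 = x by rewrite /f scale0r addr0.
have f1 : f 1 = y by rewrite /f scale1r addrC subrK.
have Sc : connected S.
  apply: connected_continuous_connected; first exact: segment_connected.
  exact: continuous_subspaceT.
have Sx : S x by exists 0 => //=; rewrite in_itv /= lexx ler01.
have Sy : S y by exists 1 => //=; rewrite in_itv /= lexx ler01.
have eS : S `&` G° = S `&` closure G.
  apply/seteqP; split=> z [Sz Gz]; split=> //.
    by apply: subset_closure; exact: interior_subset Gz.
  case: Sz Gz => t /=; rewrite in_itv /= => ht <- cl.
  by apply: contrapT => ni; exact: (nbf t ht).
have : S `&` G° = S.
  apply: Sc.
  - by exists x; rewrite eS; split => //; exact: subset_closure.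
  - by exists G° => //; exact: open_interior.
  - by exists (closure G); [exact: closed_closure|].
by move=> e; have [_ /interior_subset] : (S `&` G°) y by rewrite e.
Qed.

Lemma boundary_neq0 G x : G x -> G != setT -> boundary G !=set0.
Proof.
move=> Gx /eqP nT; have [y nGy] : exists y, ~ G y.
  by apply: contrapT => h; apply: nT; apply/seteqP; split=> // y _; apply: contrapT => ny; apply: h; exists y.
by have [t [_ _ bt]] := boundary_segment Gx nGy; exists (x + t *: (y - x)).
Qed.

Lemma bdist_le G x w : boundary G w -> bdist G x <= enorm (x - w).
Proof.
move=> bw; apply: ge_inf; last by exists w.
by exists 0 => _ [z _ <-]; exact: enorm_ge0.
Qed.

Lemma bdist_attained G x : boundary G !=set0 ->
  exists2 w, boundary G w & bdist G x = enorm (x - w).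
Proof.
move=> [w0 bw0].
pose A := boundary G `&` [set y | enorm (y - x) <= enorm (w0 - x)].
have Ac : compact A.
  rewrite /A setIC; apply: compact_closedI; first exact: compact_ball_enorm.
  exact: boundary_closed.
have A0 : A w0 by split=> /=.
have cf : {within A, continuous (fun y => enorm (y - x))}.
  by apply: continuous_subspaceT; exact: continuous_enormB.
have [|w wA wmin] := compact_EVT_min _ Ac cf; first by exists w0.
move: wA; rewrite inE => -[bw _]; exists w => //.
apply/eqP; rewrite eq_le bdist_le //=; apply: lb_le_inf.
  by exists (enorm (x - w)); exists w.
move=> _ [z bz <-]; rewrite enormB (enormB x).
have [le|/ltW gt] := leP (enorm (z - x)) (enorm (w0 - x)).
  by apply: wmin; rewrite inE.
by apply: le_trans gt; apply: wmin; rewrite inE.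
Qed.

Lemma bdist_gt0 G x : open G -> G x -> boundary G !=set0 -> 0 < bdist G x.
Proof.
move=> oG Gx b0; have [w [_ ni] ->] := bdist_attained x b0.
rewrite enorm_gt0 subr_eq0; apply: contra_notN ni => /eqP <-.
by move: oG; rewrite openE; apply.
Qed.

End Topology.

Section JBall.
Context {R : realType} {n : nat}.
Implicit Types (x y z w : 'rV[R]_n) (G : set 'rV[R]_n).

Lemma j_metric_lt G x y r : open G -> G x -> G y -> boundary G !=set0 ->
  (j_metric G x y < r) =
  (enorm (y - x) < (expR r - 1) * bdist G x) &&
  (enorm (y - x) < (expR r - 1) * bdist G y).
Proof.
move=> oG Gx Gy b0.
have dx := bdist_gt0 oG Gx b0; have dy := bdist_gt0 oG Gy b0.
have m0 : 0 < Num.min (bdist G x) (bdist G y) by rewrite lt_min dx.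
rewrite /j_metric -[in LHS](expRK r) ltr_ln ?posrE ?expR_gt0 //; last first.
  by rewrite ltr_wpDr // divr_ge0 ?enorm_ge0 // ltW.
rewrite addrC -ltrBrDr ltr_pdivrMr // enormB.
case: (leP (bdist G x) (bdist G y)) => h; apply/idP/andP => [h'|[]//]; split=> //.
- have [c0|c0] := leP 0 (expR r - 1); first exact: (lt_le_trans h' (ler_wpM2l c0 h)).
  by have := enorm_ge0 (y - x); nra.
- have [c0|c0] := leP 0 (expR r - 1).
    by apply: (lt_le_trans h' (ler_wpM2l c0 (ltW h))).
  by have := enorm_ge0 (y - x); nra.
Qed.

(** The complement of a j-ball is the exterior of a ball around x together with
the Apollonian regions of the boundary points w, which are balls when c > 1. For
c <= 2 the points outside of G need no separate treatment: the segment from x to such a point y meets the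
boundary, and it does so at distance at least d(x) from x, hence close to y. *)
Lemma j_ballC G x r y : open G -> G x -> G != setT ->
  let c := expR r - 1 in 0 < c -> c <= 2 ->
  ~ j_ball G x r y <-> (c * bdist G x <= enorm (y - x) \/
     exists2 w, boundary G w & c * enorm (y - w) <= enorm (y - x)).
Proof.
move=> oG Gx nT c c0 c2; have b0 := boundary_neq0 Gx nT.
have [Gy|nGy] := pselect (G y); last first.
  split=> [_|_]; last by case.
  have [le|lt] := leP (c * bdist G x) (enorm (y - x)); first by left.
  right; have [t [t0 t1 bz]] := boundary_segment Gx nGy.
  exists (x + t *: (y - x)) => //.
  have := bdist_le x bz.
  have -> : y - (x + t *: (y - x)) = (1 - t) *: (y - x).
    by rewrite scalerBl scale1r opprD addrA.
  rewrite opprD addrA subrr sub0r enormN enormZ (ger0_norm t0).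
  rewrite enormZ ger0_norm ?subr_ge0 //.
  have := enorm_ge0 (y - x); move: (enorm (y - x)) lt => e lt e0 h.
  nra.
rewrite /j_ball /=; split=> [h|h [_]].
  have : ~~ (j_metric G x y < r) by apply/negP => h'; apply: h.
  rewrite j_metric_lt // negb_and -!leNgt => /orP[h'|h']; [by left|right].
  by have [w bw e] := bdist_attained y b0; exists w; rewrite // -e.
rewrite j_metric_lt // => /andP[h1 h2]; case: h => [|[w bw]].
  by rewrite leNgt h1.
rewrite leNgt => /negP; apply; apply: lt_le_trans h2 _.
by apply: ler_wpM2l; [exact: ltW|exact: bdist_le].
Qed.

End JBall.


(** * Close-to-convexity from a field of directions *)

Section Field.
Context {R : realType} {n : nat}.
Implicit Types (D : set 'rV[R]_n) (w : 'rV[R]_n -> 'rV[R]_n).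

(** The complement is cut into half-lines by a field w of directions that is
constant along its own rays: two points belong to the same half-line when they
have the same direction and lie on a common line in that direction. The last
hypothesis excludes that such a class is a whole line. *)
Lemma field_close_to_convex D w :
  D != setT ->
  (forall y, ~ D y -> w y != 0) ->
  (forall y t, ~ D y -> 0 <= t ->
     ~ D (y + t *: w y) /\ w (y + t *: w y) = w y) ->
  (forall y, ~ D y -> exists2 t, 0 < t &
     ~ (~ D (y - t *: w y) /\ w (y - t *: w y) = w y)) ->
  close_to_convex D.
Proof.
move=> DT w0 wE wlow; split=> //.
pose H y := [set p | [/\ ~ D p, w p = w y & exists t, p = y + t *: w y]].
exists [set H y | y in ~` D]; split.
- move=> _ [y Dy <-].
  pose S := [set t | ~ D (y + t *: w y) /\ w (y + t *: w y) = w y].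
  have S0 : S 0 by apply: wE.
  have Sup s t : S s -> s <= t -> S t.
    move=> [Ds ws] st; have := wE _ (t - s) Ds.
    by rewrite subr_ge0 ws -addrA -scalerDl addrCA subrr addr0 => /(_ st).
  have [t0 t0p nS] := wlow _ Dy.
  have lbS : lbound S (- t0).
    move=> s Ss; rewrite leNgt; apply/negP => st; apply: nS.
    by have := Sup _ _ Ss (ltW st); rewrite /S /= scaleNr.
  have hiS : has_inf S by split; [exists 0|exists (- t0)].
  have HS p : H y p <-> exists2 t, S t & p = y + t *: w y.
    split=> [[Dp wp [t e]]|[t [Dt wt] ->]]; last by split=> //; exists t.
    by exists t => //; rewrite /S /= -e.
  have infS t : inf S < t -> S t.
    rewrite -subr_gt0 => it; have [s Ss sit] := inf_adherent it hiS.
    by apply: Sup Ss _; rewrite addrCA subrr addr0 in sit; exact: ltW.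
  exists (w y), (y + inf S *: w y); split; first exact: w0.
  have [Si|nSi] := pselect (S (inf S)); [right|left]; apply/seteqP; split=> p.
  + move=> /HS[t St ->]; exists (t - inf S).
      by rewrite /= subr_ge0; apply: ge_inf St; case: hiS.
    by rewrite scalerBl addrCA subrK.
  + move=> [t /= t0' <-]; apply/HS; exists (t + inf S).
      by apply: Sup Si _; rewrite lerDr.
    by rewrite scalerDl addrCA.
  + move=> /HS[t St ->]; exists (t - inf S).
      rewrite /= subr_gt0 lt_neqAle; apply/andP; split.
        by apply: contra_notN nSi => /eqP ->.
      by apply: ge_inf St; case: hiS.
    by rewrite scalerBl addrCA subrK.
  + move=> [t /= t0' <-]; apply/HS; exists (t + inf S).
      by apply: infS; rewrite ltrDr.
    by rewrite scalerDl addrCA.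
- move=> _ _ [y Dy <-] [y' Dy' <-] [p [[Dp wp [t pt]] [_ wp' [t' pt']]]].
  have ww : w y = w y' by rewrite -wp -wp'.
  have e : y' = y + (t - t') *: w y.
    by rewrite scalerBl addrA -pt pt' ww addrK.
  apply/seteqP; split=> q [Dq wq [s es]]; split=> //.
  + by rewrite wq.
  + by exists (s - (t - t')); rewrite es -ww e -addrA -scalerDl addrCA subrr addr0.
  + by rewrite wq.
  + by exists (t - t' + s); rewrite es -ww e -addrA -scalerDl.
- apply/seteqP; split=> [y Dy|p [_ [y Dy <-]] []//].
  exists (H y); first by exists y.
  by split=> //; exists 0; rewrite scale0r addr0.
Qed.

End Field.

(** * Non-crossing rays in the plane *)

Section Planar.
Context {R : realType}.
Local Notation plane := 'rV[R]_2.
Implicit Types (y z u v : plane).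

Definition cross u v : R := u 0 0 * v 0 1 - u 0 1 * v 0 0.

Lemma crossDl u v z : cross (u + v) z = cross u z + cross v z.
Proof. by rewrite /cross !mxE; ring. Qed.
Lemma crossDr u v z : cross u (v + z) = cross u v + cross u z.
Proof. by rewrite /cross !mxE; ring. Qed.
Lemma crossNl u v : cross (- u) v = - cross u v.
Proof. by rewrite /cross !mxE; ring. Qed.
Lemma crossNr u v : cross u (- v) = - cross u v.
Proof. by rewrite /cross !mxE; ring. Qed.
Lemma crossZl t u v : cross (t *: u) v = t * cross u v.
Proof. by rewrite /cross !mxE; ring. Qed.
Lemma crossZr t u v : cross u (t *: v) = t * cross u v.
Proof. by rewrite /cross !mxE; ring. Qed.
Lemma crossxx u : cross u u = 0.
Proof. by rewrite /cross; ring. Qed.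
Lemma crossC u v : cross u v = - cross v u.
Proof. by rewrite /cross; ring. Qed.
Definition crossE := (crossDl, crossDr, crossNl, crossNr, crossZl, crossZr, crossxx).

Lemma dot2 u v : dot u v = u 0 0 * v 0 0 + u 0 1 * v 0 1.
Proof.
rewrite /dot !big_ord_recl big_ord0 addr0.
by congr (_ * _ + _ * _); congr (_ _ _); apply: val_inj.
Qed.

Lemma dot_cross y u v :
  dot y u * cross y v - cross y u * dot y v = dot y y * cross u v.
Proof. by rewrite !dot2 /cross; ring. Qed.

Lemma sqr_dot_cross u v : dot u v ^+ 2 + cross u v ^+ 2 = dot u u * dot v v.
Proof. by rewrite !dot2 /cross; ring. Qed.

Lemma continuous_cross z : continuous (fun u => cross z u).
Proof.
pose z' : plane := \row_i (if i == 0 then - z 0 1 else z 0 0).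
have -> : (fun u => cross z u) = (fun u => dot u z').
  by apply/funext => u; rewrite dot2 /cross !mxE /=; ring.
exact: continuous_dot.
Qed.

(** Among the unit vectors u in the half-plane dot y u >= 0, ordering by angle
and ordering by cross y u are the same. *)
Lemma cross_le0 y u v : y != 0 -> dot u u = 1 -> dot v v = 1 ->
  0 <= dot y u -> 0 <= dot y v -> cross y v <= cross y u -> cross u v <= 0.
Proof.
rewrite -dot_gt0 => y0 u1 v1.
have := sqr_dot_cross y u; have := sqr_dot_cross y v; have := dot_cross y u v.
rewrite u1 v1 !mulr1.
move: (dot y u) (dot y v) (cross y u) (cross y v) => a b A B.
move=> e eb ea a0 b0 BA.
suff : a * B - A * b <= 0 by rewrite e pmulr_rle0.
have [B0|B0] := leP B 0; have [A0|A0] := leP A 0; try nra.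
- have ba : b <= a by rewrite -(@ler_pXn2r _ 2) ?nnegrE //; nra.
  nra.
- have ab : a <= b by rewrite -(@ler_pXn2r _ 2) ?nnegrE //; nra.
  nra.
Qed.

(** The ray from y' in direction u' comes from the right of the ray from y in
direction u and crosses it, as ray_crossP shows. *)
Definition ray_cross y u y' u' :=
  [/\ 0 < cross u u', 0 < cross (y' - y) u' & 0 < cross (y' - y) u].

Lemma ray_crossP y u y' u' : ray_cross y u y' u' <->
  0 < cross u u' /\
  exists a b : R, [/\ 0 < a, 0 < b & y' - y = a *: u - b *: u'].
Proof.
split=> [[h1 h2 h3]|[h1 [a [b [a0 b0 e]]]]].
  split=> //; exists (cross (y' - y) u' / cross u u'), (cross (y' - y) u / cross u u').
  split; rewrite ?divr_gt0 //.
  have h0 : cross u u' != 0 by rewrite gt_eqF.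
  apply/rowP => i; apply: (mulfI h0); rewrite !mxE.
  have k x w : cross u u' * (x / cross u u' * w) = x * w.
    by rewrite mulrA [cross u u' * _]mulrC divfK.
  rewrite [RHS]mulrBr !k.
  rewrite /cross !mxE; case: i => -[|[|//]] i.
    by rewrite (_ : Ordinal i = 0); [ring|exact: val_inj].
  by rewrite (_ : Ordinal i = 1); [ring|exact: val_inj].
have ? := mulr_gt0 a0 h1; have ? := mulr_gt0 b0 h1.
by split=> //; rewrite e !crossE //; have := crossC u u'; nra.
Qed.

(* E is to be covered by rays, and A y is the set of unit directions that may be
   used at y. The exchange property makes it possible to resolve crossings. *)
Variables (E : set plane) (A : plane -> set plane).
Hypothesis E0 : forall y, E y -> y != 0.
Hypothesis A0 : forall y, E y -> A y !=set0.
Hypothesis Acompact : forall y, E y -> compact (A y).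
Hypothesis A1 : forall y u, E y -> A y u -> dot u u = 1.
Hypothesis Adot : forall y u, E y -> A y u -> 0 <= dot y u.
Hypothesis AE : forall y u t, E y -> A y u -> 0 <= t -> E (y + t *: u).
Hypothesis Aexchange : forall y u y' u', E y -> E y' -> A y u -> A y' u' ->
  ray_cross y u y' u' -> A y u' \/ A y' u.

Let key_le y u v : E y -> A y u -> A y v -> cross y u <= cross y v -> 0 <= cross u v.
Proof.
move=> Ey Au Av h; rewrite crossC oppr_ge0.
by apply: (@cross_le0 y); rewrite ?(A1 Ey) ?(Adot Ey) ?E0.
Qed.

Let key_lt y u v : E y -> A y u -> A y v -> 0 < cross u v -> cross y u < cross y v.
Proof.
move=> Ey Au Av; apply: contraTT; rewrite -!leNgt => h.
by apply: (@cross_le0 y); rewrite ?(A1 Ey) ?(Adot Ey) ?E0.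
Qed.

Let extremal y (B : set plane) : compact B -> B !=set0 ->
  (exists2 u, B u & forall v, B v -> cross y u <= cross y v) /\
  (exists2 u, B u & forall v, B v -> cross y v <= cross y u).
Proof.
move=> cB B0; have cc : {within B, continuous (fun u => cross y u)}.
  by apply: continuous_subspaceT; exact: continuous_cross.
split.
  have [u uB hu] := compact_EVT_min B0 cB cc.
  by exists u => [|v Bv]; [rewrite inE in uB|apply: hu; rewrite inE].
have [u uB hu] := compact_EVT_max B0 cB cc.
by exists u => [|v Bv]; [rewrite inE in uB|apply: hu; rewrite inE].
Qed.

(** A choice of directions without crossings. Let rho y be the rightmost allowed
direction at y, and call a direction at y bad when some rho-ray crosses its ray
from the right; by the exchange property the crossing direction is allowed at y
as well, so that the leftmost allowed direction is never bad. The rightmost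
direction phi y that is not bad has the required property: if the phi-ray of y2
crossed the phi-ray of y1 from the right, consider the leftmost direction u0 at
y2 between rho y2 and phi y2 that is not to the left of phi y1. By the
minimality of phi y2 it is bad, and the rho-ray that crosses it also crosses one
of the two phi-rays, so that phi y1 or phi y2 would be bad. *)
Lemma exists_noncrossing : exists phi : plane -> plane,
  (forall y, E y -> A y (phi y)) /\
  (forall y y', E y -> E y' -> ~ ray_cross y (phi y) y' (phi y')).
Proof.
have /choice[rho rhoP] : forall y, exists u, E y ->
    A y u /\ (forall v, A y v -> cross y u <= cross y v).
  move=> y; have [Ey|] := pselect (E y); last by exists 0.
  by have [[u Au hu] _] := extremal y (Acompact Ey) (A0 Ey); exists u.
have rhoA y : E y -> A y (rho y) by move=> /rhoP[].
pose bad y := [set u | exists2 y', E y' & ray_cross y u y' (rho y')].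
have bad_open y : open (bad y).
  have -> : bad y = \bigcup_(y' in E `&` [set y' | 0 < cross (y' - y) (rho y')])
     ([set u | 0 < cross (- rho y') u] `&` [set u | 0 < cross (y' - y) u]).
    apply/seteqP; split=> u.
      by move=> [y' Ey' [h1 h2 h3]]; exists y' => //; split=> //=; rewrite crossNl -crossC.
    by move=> [y' [Ey' /= h2] [/= h1 h3]]; exists y' => //; split=> //; rewrite crossC -crossNl.
  apply: bigcup_open => y' _; apply: openI.
    apply: (@open_comp _ _ (fun u => cross (- rho y') u) [set t | 0 < t]).
      by move=> ? _; exact: continuous_cross.
    exact: open_gt.
  apply: (@open_comp _ _ (fun u => cross (y' - y) u) [set t | 0 < t]).
    by move=> ? _; exact: continuous_cross.
  exact: open_gt.
have badP y u y' : E y -> A y u -> E y' -> ray_cross y u y' (rho y') -> A y (rho y').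
  move=> Ey Au Ey' rc; have [//|Au'] := Aexchange Ey Ey' Au (rhoA _ Ey') rc.
  have [h _ _] := rc.
  have := key_lt Ey' Au' (rhoA _ Ey') h.
  by rewrite ltNge (rhoP _ Ey').2.
pose good y := A y `&` ~` bad y.
have good_compact y : E y -> compact (good y).
  by move=> Ey; apply: compact_closedI; [exact: Acompact|exact: open_closedC].
have good0 y : E y -> good y !=set0.
  move=> Ey; have [_ [u Au hu]] := extremal y (Acompact Ey) (A0 Ey).
  exists u; split=> // -[y' Ey' rc].
  have Ar := badP _ _ _ Ey Au Ey' rc; have [h _ _] := rc.
  by have := key_lt Ey Au Ar h; rewrite ltNge hu.
have /choice[phi phiP] : forall y, exists u, E y ->
    good y u /\ (forall v, good y v -> cross y u <= cross y v).
  move=> y; have [Ey|] := pselect (E y); last by exists 0.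
  by have [[u Au hu] _] := extremal y (good_compact _ Ey) (good0 _ Ey); exists u.
exists phi; split=> [y /phiP[[]]//|y1 y2 E1 E2 rc].
have [[A1f nb1] _] := phiP _ E1; have [[A2f nb2] min2] := phiP _ E2.
move: rc => /ray_crossP[f12 [a [b [a0 b0 e]]]].
set f1 := phi y1 in A1f nb1 f12 e; set f2 := phi y2 in A2f nb2 min2 f12 e.
have r2f2 : 0 <= cross (rho y2) f2.
  by apply: (key_le E2) => //; [exact: rhoA|exact: (rhoP _ E2).2].
have r2f1 : 0 <= cross (rho y2) f1.
  rewrite leNgt; apply/negP => h; apply: nb1; exists y2 => //.
  have h' : 0 < cross f1 (rho y2) by rewrite crossC oppr_gt0.
  split=> //; rewrite e !crossE.
    have ? := mulr_gt0 a0 h'; have ? := mulr_ge0 (ltW b0) r2f2.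
    by rewrite (crossC f2); lra.
  by have ? := mulr_gt0 b0 f12; rewrite (crossC f2); lra.
pose S := A y2 `&` ([set u | 0 <= - cross f1 u] `&` [set u | 0 <= cross y2 f2 - cross y2 u]).
have cS : compact S.
  apply: compact_closedI; first exact: Acompact.
  apply: closedI; apply: closed_sub0 => u.
    by apply: continuousN; exact: continuous_cross.
  by apply: (@cvgB _ _ _ _ (nbhs_filter u) (fun=> _)); [exact: cvg_cst|exact: continuous_cross].
have S0 : S !=set0.
  exists (rho y2); split; first exact: rhoA.
  by split=> /=; [rewrite -crossC|rewrite subr_ge0 (rhoP _ E2).2].
have [_ [u0 [Au0 [/= u0f1 u0f2]] u0max]] := extremal y2 cS S0.
rewrite -crossC in u0f1; rewrite subr_ge0 in u0f2.
have u0f2' : 0 <= cross u0 f2 by apply: (key_le E2).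
have [nb|] := pselect (~ bad y2 u0).
  have ek : cross y2 u0 = cross y2 f2.
    by apply/eqP; rewrite eq_le u0f2 min2.
  have ed : dot y2 u0 = dot y2 f2.
    apply/eqP; rewrite -(@eqrXn2 _ 2) ?(Adot E2) //.
    have := sqr_dot_cross y2 u0; have := sqr_dot_cross y2 f2.
    by rewrite (A1 E2 Au0) (A1 E2 A2f) ek => <- /addIr ->.
  have := dot_cross y2 f1 u0; rewrite ek ed dot_cross.
  have y20 : dot y2 y2 != 0 by rewrite dot_eq0 E0.
  by move=> /(mulfI y20) e'; rewrite crossC -e' oppr_ge0 leNgt f12 in u0f1.
case/contrapT => y3 E3 rc3.
have A2r := badP _ _ _ E2 Au0 E3 rc3.
move: rc3 => /ray_crossP[u0r [a' [b' [a'0 b'0 e']]]].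
set r := rho y3 in A2r u0r e'.
have [le|lt] := leP (cross y2 r) (cross y2 f2).
  have rf2 : 0 <= cross r f2 by exact: (key_le E2).
  have f1r : 0 < cross f1 r.
    rewrite ltNge; apply/negP => h.
    have Sr : S r by split=> //; split=> /=; rewrite ?oppr_ge0 ?subr_ge0.
    by have := key_lt E2 Au0 A2r u0r; rewrite ltNge u0max.
  apply: nb1; exists y3 => //.
  have e3 : y3 - y1 = a' *: u0 - b' *: r + (a *: f1 - b *: f2).
    by rewrite -e -e' addrA subrK.
  have ? := mulr_gt0 a'0 u0r; have ? := mulr_ge0 (ltW b0) rf2.
  have ? := mulr_gt0 a0 f1r; have ? := mulr_ge0 (ltW a'0) u0f1.
  have ? := mulr_gt0 b'0 f1r; have ? := mulr_gt0 b0 f12.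
  by split=> //; rewrite e3 !crossE (crossC f2) ?(crossC r f1); lra.
apply: nb2; exists y3 => //.
have f2r0 : 0 <= cross f2 r by apply: (key_le E2) => //; exact: ltW.
have f2r : 0 < cross f2 r.
  rewrite lt_neqAle f2r0 andbT eq_sym; apply/eqP => z.
  have := sqr_dot_cross f2 r; have := dot_cross f2 y2 r; have := dot_cross f2 u0 r.
  rewrite z (A1 E2 A2f) (A1 E2 A2r) !mulr0 !mul1r expr0n addr0 !sub0r => h1 h2 /eqP.
  rewrite sqrf_eq1 => /orP[] /eqP d1; rewrite d1 ?mulrN !mulr1 ?opprK in h1 h2.
    by rewrite -h2 -crossC ltxx in lt.
  by move: u0r; rewrite -h1 crossC oppr_gt0 ltNge u0f2'.
have ? := mulr_gt0 a'0 u0r; have ? := mulr_ge0 (ltW a'0) u0f2'.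
have ? := mulr_gt0 b'0 f2r.
by split=> //; rewrite e' !crossE ?(crossC r f2); lra.
Qed.

(** Rays that do not cross may still start inside of one another, or run on top of
each other. A point in the interior of a ray therefore gets the direction of
that ray instead of its own, and the resulting field is constant along rays. *)
Lemma planar_close_to_convex : E !=set0 -> close_to_convex (~` E).
Proof.
move=> [e0 Ee0]; have [phi [phiA phiX]] := exists_noncrossing.
(* A point in the interior of a ray has to follow that ray. *)
pose on y u := exists y' t, [/\ E y', 0 < t, y = y' + t *: phi y' & u = phi y'].
have on_uniq y u v : on y u -> on y v -> u = v.
  move=> [y1 [a [E1 a0 e1 ->]]] [y2 [b [E2 b0 e2 ->]]].
  have e : y2 - y1 = a *: phi y1 - b *: phi y2.
    apply/rowP => i; have := congr1 (fun z : plane => z 0 i) e1.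
    by have := congr1 (fun z : plane => z 0 i) e2; rewrite !mxE; lra.
  have e' : y1 - y2 = b *: phi y2 - a *: phi y1 by rewrite -opprB e opprB.
  have [d1 d2] := (A1 E1 (phiA _ E1), A1 E2 (phiA _ E2)).
  have c0 : cross (phi y1) (phi y2) = 0.
    have [lt|gt|//] := ltgtP (cross (phi y1) (phi y2)) 0.
      case: (phiX _ _ E2 E1); apply/ray_crossP; rewrite crossC oppr_gt0; split=> //.
      by exists b, a.
    by case: (phiX _ _ E1 E2); apply/ray_crossP; split=> //; exists a, b.
  have := sqr_dot_cross (phi y1) (phi y2).
  rewrite c0 d1 d2 mulr1 expr0n addr0 => /eqP; rewrite sqrf_eq1 => /orP[] /eqP dd.
    apply/eqP; rewrite -subr_eq0 -dot_eq0 !dotE d1 d2 dd (dotC (phi y2)) dd.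
    by apply/eqP; ring.
  (* Two rays cannot run head-on into each other, as both lead away from 0. *)
  have h1 := Adot E1 (phiA _ E1); have h2 := Adot E2 (phiA _ E2).
  have f2 : phi y2 = - phi y1.
    apply/eqP; rewrite -subr_eq0 opprK -dot_eq0 !dotE d1 d2 (dotC (phi y2)) dd.
    by apply/eqP; ring.
  have := congr1 (fun z : plane => dot z (phi y1)) e.
  move: h2; rewrite f2 !dotE d1; clear e e' e1 e2 f2 => h2 k; exfalso; lra.
have /choice[w wP] : forall y, exists u, E y ->
    (on y u \/ (u = phi y /\ ~ exists v, on y v)).
  move=> y; have [[v ov]|no] := pselect (exists v, on y v); first by exists v => _; left.
  by exists (phi y) => _; right.
have w_on y y' t : E y' -> 0 < t -> y = y' + t *: phi y' -> w y = phi y'.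
  move=> E' t0 ey; have oy : on y (phi y') by exists y', t.
  have Ey : E y by rewrite ey; apply: AE; [|exact: phiA|exact: ltW].
  by case: (wP _ Ey) => [/on_uniq|[_ []]]; [exact|exists (phi y')].
have w_from y : E y -> exists y' t, [/\ E y', 0 <= t, y = y' + t *: phi y' & w y = phi y'].
  move=> Ey; case: (wP _ Ey) => [[y' [t [E' t0 ey wy]]]|[wy _]].
    by exists y', t; split=> //; exact: ltW.
  by exists y, 0; split=> //; rewrite scale0r addr0.
have wdot y : E y -> dot (w y) (w y) = 1 /\ 0 <= dot y (w y).
  move=> /w_from[y' [t [E' t0 -> ->]]].
  have d := A1 E' (phiA _ E'); have d' := Adot E' (phiA _ E').
  by rewrite !dotE d; split=> //; rewrite mulr1 addr_ge0.
apply: (@field_close_to_convex _ _ _ w).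
- by apply/eqP => /seteqP[_ /(_ e0 I)]; exact.
- move=> y /contrapT Ey; rewrite -dot_eq0 (wdot _ Ey).1; exact: oner_neq0.
- move=> y t /contrapT Ey; rewrite le_eqVlt => /predU1P[<-|t0].
    by rewrite scale0r addr0; split=> // /(_ Ey).
  have [y' [s [E' s0 ey wy]]] := w_from _ Ey.
  have eyt : y + t *: w y = y' + (s + t) *: phi y'.
    by rewrite wy [in LHS]ey -addrA -scalerDl.
  have st : 0 < s + t by rewrite ltr_wpDl.
  split; last by rewrite (w_on _ y' (s + t)).
  by move=> nE; apply: nE; rewrite eyt; apply: AE; [|exact: phiA|exact: ltW].
- move=> y /contrapT Ey; have [d1 d0] := wdot _ Ey.
  exists (dot y (w y) + 1); first by rewrite ltr_wpDl.
  move=> [/contrapT E' we]; have [_] := wdot _ E'.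
  by rewrite we !dotE d1; clear we; lra.
Qed.

End Planar.


(** * Unions of Apollonian balls *)

Section Translation.
Context {R : realType} {n : nat}.

Lemma close_to_convex_translate (D : set 'rV[R]_n) x :
  close_to_convex [set v | D (x + v)] -> close_to_convex D.
Proof.
move=> [DT [F [Fh Ft Fc]]]; split.
  by apply: contra_neq DT => ->; apply/seteqP.
exists [set [set x + v | v in H] | H in F]; split.
- move=> _ [H FH <-]; have [y [z [y0 hz]]] := Fh _ FH; exists y, (x + z); split=> //.
  case: hz => ->; [left|right]; rewrite image_comp; apply: eq_imagel => t _ /=.
    by rewrite addrCA.
  by rewrite addrCA.
- move=> _ _ [H FH <-] [H' FH' <-] [p [[v Hv <-] [v' Hv' /addrI e]]].
  by congr image; apply: Ft => //; exists v; split=> //; rewrite -e.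
- apply/seteqP; split=> [p Dp|_ [_ [H FH <-] [v Hv <-]]].
    have : (~` [set v | D (x + v)]) (p - x) by rewrite /= addrC subrK.
    rewrite Fc => -[H FH Hp]; exists [set x + v | v in H]; first by exists H.
    by exists (p - x) => //; rewrite addrC subrK.
  by have : (~` [set v | D (x + v)]) v by rewrite Fc; exists H.
Qed.

End Translation.

Section Apollonian.
Context {R : realType} {n : nat}.
Implicit Types (u v w z p : 'rV[R]_n).
Variables (B : set 'rV[R]_n) (c d : R).
Hypothesis c0 : 0 < c.
Hypothesis c3 : c ^+ 2 <= 3.
Hypothesis d0 : 0 < d.
Hypothesis Bd : forall w, B w -> d <= enorm w.

(** When B is the boundary of G, moved so that the center of the j-ball is 0, d is
the distance of the center from B, and c = e^r - 1, this is the complement of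
the j-ball, by j_ballC. *)
Definition apollonian_union : set 'rV[R]_n :=
  [set v | c * d <= enorm v \/ exists2 w, B w & c * enorm (v - w) <= enorm v].

Local Notation E := apollonian_union.

(** Nonpositive exactly on the Apollonian ball of [w]; the difference of two
such functions is affine. *)
Definition apol w v := c ^+ 2 * dot (v - w) (v - w) - dot v v.

Lemma apolP w v : (c * enorm (v - w) <= enorm v) = (apol w v <= 0).
Proof.
rewrite -(@ler_pXn2r _ 2) ?nnegrE ?mulr_ge0 ?enorm_ge0 ?(ltW c0) //.
by rewrite exprMn !sqr_enorm /apol subr_le0.
Qed.

Lemma apollonian_dot v w z : B z -> enorm v < c * d ->
  c * enorm (v - w) <= enorm v -> dot z z <= dot z w -> 0 < dot v z.
Proof.
move=> Bz vc vw zw.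
have dz := Bd Bz; have z0 : 0 < enorm z by exact: lt_le_trans d0 dz.
have : dot (w - v) z <= enorm (w - v) * enorm z by exact: cauchy_schwarz.
rewrite enormB !dotE (dotC w) => h.
have k : enorm (v - w) < enorm z.
  apply: lt_le_trans dz; rewrite -(ltr_pM2l c0); exact: le_lt_trans vw vc.
have := sqr_enorm z; nra.
Qed.

(** Moving away from the centre in a direction [z] that is dominated by [w]
means leaving the Apollonian ball of [w] only after having entered the one of
[z]; this is where [c <= sqrt 3] is needed. *)
Lemma apollonian_ray v w z t : B z -> B w -> enorm v < c * d ->
  c * enorm (v - w) <= enorm v -> dot z z <= dot z w -> 0 <= t ->
  E (v + t *: z).
Proof.
move=> Bz Bw vc vw zw t0.
have vz := apollonian_dot Bz vc vw zw.
have [le|lt] := leP (c * d) (enorm (v + t *: z)); [by left|right].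
have [hw|hw] := leP (apol w (v + t *: z)) 0; first by exists w; rewrite ?apolP.
exists z; rewrite // apolP leNgt; apply/negP => hz.
have {vc}lt : dot (v + t *: z) (v + t *: z) < c ^+ 2 * dot z z.
  rewrite -!sqr_enorm -exprMn ltr_pXn2r ?nnegrE ?mulr_ge0 ?enorm_ge0 ?(ltW c0) //.
  by apply: lt_le_trans lt _; rewrite ler_pM2l // Bd.
have z0 : 0 < dot z z.
  by rewrite dot_gt0 -enorm_gt0; apply: lt_le_trans d0 (Bd Bz).
move: vw hw hz lt; rewrite apolP /apol !dotE (dotC z v) (dotC w v) (dotC w z).
move: (dot v v) (dot v z) (dot v w) (dot z z) (dot z w) (dot w w) vz zw z0 c3.
have : 0 < c ^+ 2 by rewrite exprn_gt0.
move: (c ^+ 2) => k k0 a b e s f g b0 sf s0 k3 h1 h2 h3 h4.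
have m1 : 0 < t * ((k - 1) * (2 * b + t * s) - 2 * k * f) by lra.
have tp : 0 < t by rewrite lt_neqAle t0 andbT; apply/eqP => t00; rewrite -t00 mul0r ltxx in m1.
have {}m1 : 0 < (k - 1) * (2 * b + t * s) - 2 * k * f by rewrite pmulr_rgt0 in m1.
have ts : 0 < t * s by rewrite mulr_gt0.
have kf : k * s <= k * f by rewrite ler_pM2l.
have ks : 0 < k * s by rewrite mulr_gt0.
have k1 : 0 < k - 1.
  rewrite ltNge; apply/negP => k1.
  have : (k - 1) * (2 * b + t * s) <= 0 by rewrite mulr_le0_ge0 //; lra.
  lra.
have m2 : 0 < (k - 1) * (t * s) by rewrite mulr_gt0.
have m3 : k * s < (k - 1) * (b + t * s) by lra.
have m4 : 0 <= (k - 1) * (k * s - (a + t * b + (t * b + t * (t * s)))).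
  by apply: mulr_ge0; [exact: ltW|lra].
have m5 : 0 < k * (k * s - 2 * (b + t * s)) by lra.
have m6 : 0 < k * s - 2 * (b + t * s) by rewrite pmulr_rgt0 in m5.
have m7 : 0 < (k - 1) * (k * s - 2 * (b + t * s)) by rewrite mulr_gt0.
have m8 : 0 <= (3 - k) * (k * s) by apply: mulr_ge0; [lra|exact: ltW].
lra.
Qed.

(** The directions offered to a point v. Where |v| >= c d these are all directions
that do not lead closer to the center. Where |v| < c d these are the directions
of the points z of B that are dominated by a w in B whose Apollonian ball
contains v; admitting other z than w makes allowed_exchange possible. *)
Definition inner_dir v u := exists z w,
  [/\ B z, B w, c * enorm (v - w) <= enorm v, dot z z <= dot z w
    & z = enorm z *: u].

Definition allowed v u := dot u u = 1 /\
  ((c * d <= enorm v /\ 0 <= dot v u) \/ (enorm v < c * d /\ inner_dir v u)).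

Lemma apollonian_neq0 v : E v -> v != 0.
Proof.
move=> Ev; apply/eqP => v0; move: Ev; rewrite v0 => -[|[w Bw]].
  by rewrite enorm0 leNgt mulr_gt0.
rewrite enorm0 sub0r enormN leNgt mulr_gt0 //.
exact: lt_le_trans d0 (Bd Bw).
Qed.

Lemma normalize z : z != 0 ->
  dot ((enorm z)^-1 *: z) ((enorm z)^-1 *: z) = 1 /\
  z = enorm z *: ((enorm z)^-1 *: z).
Proof.
rewrite -enorm_gt0 => z0; split; last by rewrite scalerA divff ?scale1r ?gt_eqF.
by rewrite !dotE -sqr_enorm; field; rewrite gt_eqF.
Qed.

Lemma B_neq0 w : B w -> w != 0.
Proof. by move=> Bw; rewrite -enorm_gt0; exact: lt_le_trans d0 (Bd Bw). Qed.

Lemma allowed_neq0 v : E v -> allowed v !=set0.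
Proof.
move=> Ev; have [le|lt] := leP (c * d) (enorm v).
  have [u1 ev] := normalize (apollonian_neq0 Ev).
  exists ((enorm v)^-1 *: v); split=> //; left; split=> //.
  by rewrite dotE mulr_ge0 ?invr_ge0 ?enorm_ge0 ?dot_ge0.
case: Ev => [|[w Bw vw]]; first by rewrite leNgt lt.
have [u1 ew] := normalize (B_neq0 Bw).
by exists ((enorm w)^-1 *: w); split=> //; right; split=> //; exists w, w.
Qed.

Lemma allowed_dot v u : E v -> allowed v u -> 0 <= dot v u.
Proof.
move=> _ [u1 [[]//|[vc [z [w [Bz Bw vw zw ez]]]]]].
have := apollonian_dot Bz vc vw zw; rewrite {1}ez dotE pmulr_rgt0 => [/ltW//|].
exact: lt_le_trans d0 (Bd Bz).
Qed.

Lemma allowed_ray v u t : E v -> allowed v u -> 0 <= t -> E (v + t *: u).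
Proof.
move=> _ [u1 [[vc vu]|[vc [z [w [Bz Bw vw zw ez]]]]]] t0.
  left; apply: le_trans vc _; rewrite ler_enorm !dotE u1 (dotC u).
  by have := mulr_ge0 t0 vu; have := mulr_ge0 t0 t0; lra.
have z0 : 0 < enorm z by exact: lt_le_trans d0 (Bd Bz).
have := apollonian_ray (t := t / enorm z) Bz Bw vc vw zw.
rewrite divr_ge0 ?(ltW z0) // => /(_ isT).
by rewrite [X in _ *: X]ez scalerA divfK ?gt_eqF.
Qed.

(** If two rays meet, one of the points may use the direction of the other. For
points v and v' in the Apollonian balls of w and w' this holds because otherwise
the affine function apol w - apol w' would be negative at v and decrease along
the ray from v, but be positive at v' and increase along the ray from v'. *)
Lemma allowed_exchange v u v' u' a b : E v -> E v' -> allowed v u -> allowed v' u' ->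
  0 < a -> 0 < b -> v' - v = a *: u - b *: u' -> allowed v u' \/ allowed v' u.
Proof.
move=> Ev Ev' [u1 hu] [u'1 hu'] a0 b0 e.
have eqd p : dot v' p - dot v p = a * dot u p - b * dot u' p.
  by have := congr1 (fun q => dot q p) e; rewrite !dotE.
have ev := eqd v; have ev' := eqd v'; clear e.
rewrite (dotC v' v) (dotC u v) (dotC u' v) in ev.
rewrite (dotC u v') (dotC u' v') in ev'.
have outer p q : c * d <= enorm p -> enorm q < c * d -> dot p q < dot p p.
  move=> pc qc; apply: le_lt_trans (cauchy_schwarz _ _) _.
  rewrite -sqr_enorm expr2 ltr_pM2l; first exact: lt_le_trans qc pc.
  by apply: lt_le_trans pc; rewrite mulr_gt0.
case: hu => [[vc vu]|[vc [z [w [Bz Bw vw zw ez]]]]];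
  case: hu' => [[vc' vu']|[vc' [z' [w' [Bz' Bw' vw' zw' ez']]]]].
- have [le|lt] := leP 0 (dot v u'); first by left; split=> //; left.
  have [le'|lt'] := leP 0 (dot v' u); first by right; split=> //; left.
  exfalso.
  have ? : 0 <= a * dot v u by apply: mulr_ge0 => //; exact: ltW.
  have ? : 0 <= b * dot v' u' by apply: mulr_ge0 => //; exact: ltW.
  have ? : a * dot v' u < 0 by rewrite pmulr_rlt0.
  have ? : b * dot v u' < 0 by rewrite pmulr_rlt0.
  have := dot_ge0 (v - v'); rewrite !dotE (dotC v' v); lra.
- left; split=> //; left; split=> //.
  have := outer _ _ vc vc'; have ? : 0 <= a * dot v u by apply: mulr_ge0 => //; exact: ltW.
  by move=> ?; rewrite -(pmulr_rge0 _ b0); lra.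
- right; split=> //; left; split=> //.
  have := outer _ _ vc' vc; have ? : 0 <= b * dot v' u' by apply: mulr_ge0 => //; exact: ltW.
  by rewrite (dotC v') => ?; rewrite -(pmulr_rge0 _ a0); lra.
- have z0 : 0 < enorm z by exact: lt_le_trans d0 (Bd Bz).
  have z'0 : 0 < enorm z' by exact: lt_le_trans d0 (Bd Bz').
  have [l1|l1] := leP (dot z' z') (dot z' w).
    by left; split=> //; right; split=> //; exists z', w.
  have [l2|l2] := leP (dot z z) (dot z w').
    by right; split=> //; right; split=> //; exists z, w'.
  have [l3|l3] := leP (c * enorm (v - w')) (enorm v).
    by left; split=> //; right; split=> //; exists z', w'.
  have [l4|l4] := leP (c * enorm (v' - w)) (enorm v').
    by right; split=> //; right; split=> //; exists z, w.
  exfalso.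
  move: vw vw' l3 l4; rewrite !ltNge !apolP -!ltNge /apol !dotE.
  have uw : dot u w' < dot u w.
    by rewrite -(ltr_pM2l z0) -!dotZl -ez; exact: lt_le_trans zw.
  have uw' : dot u' w < dot u' w'.
    by rewrite -(ltr_pM2l z'0) -!dotZl -ez'; exact: lt_le_trans zw'.
  have := eqd w; have := eqd w'.
  rewrite (dotC w v) (dotC w v') (dotC w' v) (dotC w' v').
  have k0 : 0 < c ^+ 2 by rewrite exprn_gt0.
  move: (c ^+ 2) k0 => k k0 ew' ew h1 h2 h3 h4.
  have m1 : k * (2 * (dot v w - dot v w') - (dot w w - dot w' w')) > 0 by lra.
  have m2 : k * (2 * (dot v' w' - dot v' w) - (dot w' w' - dot w w)) > 0 by lra.
  rewrite pmulr_rgt0 // in m1; rewrite pmulr_rgt0 // in m2.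
  have ? : 0 < a * (dot u w - dot u w') by rewrite mulr_gt0 ?subr_gt0.
  have ? : 0 < b * (dot u' w' - dot u' w) by rewrite mulr_gt0 ?subr_gt0.
  lra.
Qed.

End Apollonian.


Section AllowedCompact.
Context {R : realType} {n : nat}.
Implicit Types (u v w z : 'rV[R]_n).
Variables (B : set 'rV[R]_n) (c d : R).
Hypothesis c0 : 0 < c.
Hypothesis d0 : 0 < d.
Hypothesis Bclosed : closed B.
Hypothesis Bd : forall w, B w -> d <= enorm w.

Lemma compact_unit_sphere : compact [set u : 'rV[R]_n | dot u u = 1].
Proof.
apply: (@subclosed_compact _ _ [set y | enorm (y - 0) <= 1]).
- apply: (@preimage_closed _ _ (fun u => dot u u) [set t | t = 1]).
    by move=> ? _; exact: continuous_sqdot.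
  exact: closed_eq.
- exact: compact_ball_enorm.
- by move=> u /= u1; rewrite subr0 enormE u1 sqrtr1.
Qed.

(** Away from the outer region, the allowed directions are the image of the compact
set of the pairs (z, w) that define them. *)
Lemma allowed_compact v : compact (allowed B c d v).
Proof.
have [le|lt] := leP (c * d) (enorm v).
  have -> : allowed B c d v = [set u | dot u u = 1] `&` [set u | 0 <= dot u v].
    apply/seteqP; split=> u.
      by move=> [u1 [[_ vu]|[]]]; [split=> //=; rewrite dotC|rewrite ltNge le].
    by move=> [u1 vu]; split=> //; left; split=> //; rewrite dotC.
  apply: compact_closedI; first exact: compact_unit_sphere.
  apply: closed_sub0; exact: continuous_dot.
pose V := ('rV[R]_n * 'rV[R]_n)%type.
have f1 : continuous (fst : V -> 'rV[R]_n) by move=> p; exact: cvg_fst.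
have f2 : continuous (snd : V -> 'rV[R]_n) by move=> p; exact: cvg_snd.
have clo (T : topologicalType) (f : V -> T) (C : set T) :
    continuous f -> closed C -> closed (f @^-1` C).
  by move=> cf; apply: preimage_closed => p _; exact: cf.
have cdot (f g : V -> 'rV[R]_n) : continuous f -> continuous g ->
    continuous (fun p => dot (f p) (g p)).
  have pol z w : dot z w = (dot (z + w) (z + w) - dot z z - dot w w) / 2.
    by rewrite !dotE (dotC w z); field.
  move=> cf cg.
  have sq (h : V -> 'rV[R]_n) : continuous h -> continuous (fun q => dot (h q) (h q)).
    move=> ch p; apply: (@continuous_comp _ _ _ h (fun x => dot x x)); first exact: ch.
    exact: continuous_sqdot.
  have cfg : continuous (f \+ g) by move=> q; exact: (continuousD (cf q) (cg q)).
  have -> : (fun p => dot (f p) (g p)) = (fun p => 2^-1) \* ((fun q => dot ((f \+ g) q) ((f \+ g) q))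
      \- (fun q => dot (f q) (f q)) \- (fun q => dot (g q) (g q))).
    by apply/funext => q; rewrite pol /= mulrC.
  move=> p; apply: continuousM; first exact: cvg_cst.
  exact: (continuousB (continuousB (sq _ cfg p) (sq _ cf p)) (sq _ cg p)).
pose M := enorm v + enorm v / c.
pose K := [set p : V | (B p.1 /\ B p.2) /\
  (enorm (p.2 - v) <= enorm v / c /\ 0 <= dot p.1 p.2 - dot p.1 p.1)].
have Kc : compact K.
  apply: (@subclosed_compact _ _ ([set y | enorm (y - 0) <= M] `*` [set y | enorm (y - 0) <= M])).
  - apply: closedI.
      by apply: closedI; [exact: (clo _ fst)|exact: (clo _ snd)].
    apply: closedI.
      apply: (clo _ snd [set y | enorm (y - v) <= enorm v / c]) => //.
      exact: closed_ball_enorm.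
    apply: (clo _ (fun p => dot p.1 p.2 - dot p.1 p.1) [set t | 0 <= t]).
      by move=> p; apply: (continuousB (cdot _ _ f1 f2 p)); exact: cdot.
    exact: closed_ge.
  - by apply: compact_setX; exact: compact_ball_enorm.
  - move=> [z w] /= [[Bz Bw] [vw zw]]; rewrite !subr0.
    have wM : enorm w <= M.
      by rewrite -[w](subrK v) addrC; apply: le_trans (enormD _ _) _; rewrite lerD2l.
    split=> //; apply: le_trans wM.
    have z0 := lt_le_trans d0 (Bd Bz); rewrite -(ler_pM2l z0) -expr2 sqr_enorm.
    by apply: le_trans (cauchy_schwarz _ _); rewrite -subr_ge0.
have -> : allowed B c d v = (fun p : V => (enorm p.1)^-1 *: p.1) @` K.
  apply/seteqP; split=> u.
    move=> [u1 [[]|[_ [z [w [Bz Bw vw zw ez]]]]]]; first by rewrite leNgt lt.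
    exists (z, w); first split=> //=.
      by rewrite enormB ler_pdivlMr // mulrC subr_ge0.
    rewrite /= {2}ez scalerA mulVf ?scale1r // gt_eqF //.
    exact: lt_le_trans d0 (Bd Bz).
  move=> [[z w] /= [[Bz Bw] [vw zw]] <-].
  have [u1 ez] := normalize (B_neq0 d0 Bd Bz).
  split=> //; right; split=> //; exists z, w; split=> //.
    by rewrite enormB mulrC -ler_pdivlMr.
  by rewrite -subr_ge0.
apply: continuous_compact => //; apply: continuous_in_subspaceT => -[z w].
rewrite inE => -[[/= Bz _] _].
have z0 : enorm z != 0 by rewrite enorm_eq0; exact: (B_neq0 d0 Bd).
apply: cvgZ; last exact: f1.
apply: cvgV => //.
apply: (@continuous_comp _ _ _ fst (@enorm R n)); first exact: f1.
exact: continuous_enorm.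
Qed.

End AllowedCompact.

(** * Balls of the j-metric in the plane *)

Section JBallApollonian.
Context {R : realType} {n : nat}.
Variables (G : set 'rV[R]_n) (x : 'rV[R]_n) (r : R).
Hypotheses (oG : open G) (GT : G != setT) (Gx : G x).
Hypotheses (r0 : 0 < r) (r3 : r <= ln (1 + Num.sqrt 3)).

Local Notation B := [set w | boundary G (x + w)].
Local Notation c := (expR r - 1).
Local Notation d := (bdist G x).

Lemma c_gt0 : 0 < c.
Proof. by rewrite subr_gt0 expR_gt1. Qed.

Lemma c_sqr : c ^+ 2 <= 3.
Proof.
rewrite -[leRHS](@sqr_sqrtr _ 3) // ler_pXn2r ?nnegrE ?sqrtr_ge0 ?(ltW c_gt0) //.
rewrite lerBlDl -(@lnK _ (1 + Num.sqrt 3)) ?ler_expR //.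
by rewrite posrE ltr_wpDr ?sqrtr_ge0.
Qed.

Lemma d_gt0 : 0 < d.
Proof. by apply: bdist_gt0 => //; exact: boundary_neq0 Gx GT. Qed.

Lemma B_closed : closed B.
Proof.
apply: (@preimage_closed _ _ (fun w => x + w) (boundary G)); last exact: boundary_closed.
by move=> w _; apply: (@continuousD _ _ _ (fun=> x) id); [exact: cst_continuous|by move=> ?].
Qed.

Lemma B_dist w : B w -> d <= enorm w.
Proof. by move=> /(bdist_le x); rewrite opprD addNKr enormN. Qed.

Lemma j_ball_apollonian :
  ~` [set v | j_ball G x r (x + v)] = apollonian_union B c d.
Proof.
have c2 : c <= 2.
  by have := c_sqr; have := c_gt0; move: c => k k0 k3; nra.
have P := j_ballC (r := r) _ oG Gx GT c_gt0 c2.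
have e v : x + v - x = v by rewrite addrC addKr.
apply/seteqP; split=> v.
  move=> /= /P[|[w bw]]; rewrite e; first by left.
  move=> h; right; exists (w - x); first by rewrite /= addrC subrK.
  by rewrite opprB addrCA addrA.
move=> h /=; apply/P; rewrite e; case: h => [|[w bw h]]; first by left.
by right; exists (x + w) => //; rewrite opprD addrACA subrr add0r.
Qed.

End JBallApollonian.

Theorem j_ball_close_to_convex2 (R : realType) (G : set 'rV[R]_2) x r :
  open G -> G != setT -> G x -> 0 < r -> r <= ln (1 + Num.sqrt 3) ->
  close_to_convex (j_ball G x r).
Proof.
move=> oG GT Gx r0 r3; apply: (@close_to_convex_translate _ _ _ x).
set D := [set v | _]; rewrite -[D]setCK j_ball_apollonian //.
have c0 := c_gt0 r0; have c3 := c_sqr r0 r3; have d0 := d_gt0 oG GT Gx.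
have Bc := @B_closed _ _ G x; have Bd := @B_dist _ _ G x.
set c := expR r - 1 in c0 c3 *; set d := bdist G x in d0 Bd *.
set B := [set w | _] in Bc Bd *.
apply: (@planar_close_to_convex _ _ (allowed B c d)).
- exact: (apollonian_neq0 c0 d0).
- exact: (allowed_neq0 c0 d0).
- by move=> y _; exact: allowed_compact.
- by move=> y u _ [].
- exact: (allowed_dot c0 d0).
- exact: (allowed_ray c0 c3 d0).
- move=> y u y' u' Ey Ey' Au Au' /ray_crossP[_ [a [b [a0 b0 e]]]].
  exact: (allowed_exchange c0 d0 Bd Ey Ey' Au Au' a0 b0 e).
- have [w bw] := boundary_neq0 Gx GT.
  exists (w - x); right; exists (w - x); first by rewrite /B /= addrC subrK.
  by rewrite subrr enorm0 mulr0 enorm_ge0.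
Qed.


(** * Transfinite selection *)

Section WellOrder.
Variable T : choiceType.

Definition surjects (A : set T) := exists g : T -> T, forall t, exists2 s, A s & g s = t.

(** The transfinite induction over a set of the size of the continuum has to see
fewer than continuum many predecessors at each step. Taking the least initial
segment of a well-order that can be mapped onto T provides this without
cardinals. *)
Lemma small_well_order : exists (W : set T) (lt : T -> T -> Prop),
  [/\ well_founded lt, (forall s t, W s -> W t -> s != t -> lt s t \/ lt t s),
      surjects W & forall t, W t -> ~ surjects [set s | W s /\ lt s t]].
Proof.
have [R0 wo] := well_ordering_principle T.
pose lt s t := R0 s t /\ s != t.
have minP (A : set T) : A !=set0 -> exists2 z, A z & forall x, A x -> R0 z x.
  move=> [a Aa]; have [|z [[zA zl] _]] := wo (mem A); first by exists a; rewrite inE.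
  by exists z; [rewrite inE in zA|move=> x Ax; apply: zl; rewrite inE].
have tot s t : R0 s t \/ R0 t s.
  have [|z [->|->] h] := minP [set x | x = s \/ x = t]; first by exists s; left.
    by left; apply: h; right.
  by right; apply: h; left.
have anti s t : R0 s t -> R0 t s -> s = t.
  move=> st ts; have [|z [_ zu]] := wo (mem [set x | x = s \/ x = t]).
    by exists s; rewrite inE; left.
  have rr x : R0 x x by case: (tot x x).
  have zs : z = s.
    by apply: zu; split; [rewrite inE; left|move=> x; rewrite inE => -[->|->]].
  rewrite -zs; apply: zu; split; first by rewrite inE; right.
  by move=> x; rewrite inE => -[->|->].
have trans s t u : lt s t -> lt t u -> lt s u.
  move=> [st nst] [tu ntu].
  have [|z zz h] := minP [set x | [\/ x = s, x = t | x = u]]; first by exists s; constructor 1.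
  have zs := h _ (Or31 _ _ erefl); have zt := h _ (Or32 _ _ erefl).
  have zu := h _ (Or33 _ _ erefl).
  have {zz} zs' : z = s.
    case: zz => // e; rewrite e in zs zt zu.
      by rewrite e; exact: anti zs st.
    by have := anti _ _ tu zt; move/eqP: ntu.
  rewrite zs' in zu; split=> //; apply/eqP => su.
  by rewrite -su in tu; have := anti _ _ st tu; move/eqP: nst.
have wf : well_founded lt.
  move=> a; apply: contrapT => na.
  have [|z nz h] := minP [set x | ~ Acc lt x]; first by exists a.
  apply: nz; constructor => y [yz nyz]; apply: contrapT => ny.
  by move/eqP: nyz; apply; exact: anti (h _ ny).
have tri (W : set T) s t : W s -> W t -> s != t -> lt s t \/ lt t s.
  by move=> _ _ st; case: (tot s t) => h; [left|right; rewrite /lt eq_sym].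
have [[t0 ht0]|no] := pselect (exists t, surjects [set s | lt s t]); last first.
  exists setT, lt; split=> //; first exact: tri.
    by exists id => t; exists t.
  move=> t _ [g hg]; apply: no; exists t; exists g => u.
  by have [s [_ st] <-] := hg u; exists s.
have [|z hz h] := minP [set t | surjects [set s | lt s t]]; first by exists t0.
exists [set s | lt s z], lt; split=> //; first exact: tri.
move=> t /= tz [g hg]; have [tz' ntz] := tz.
have : R0 z t.
  by apply: h; exists g => u; have [s [_ st] <-] := hg u; exists s.
by move=> zt; move/eqP: ntz; apply; exact: anti.
Qed.

End WellOrder.

(** Dependent choice along a well-founded relation: the admissible values at t
depend on the values already chosen below t. *)
Lemma wf_choice (T U : Type) (u0 : U) (lt : T -> T -> Prop) (P : T -> (T -> U) -> U -> Prop) :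
  well_founded lt ->
  (forall t f g u, (forall s, lt s t -> f s = g s) -> P t f u -> P t g u) ->
  (forall t f, exists u, P t f u) ->
  exists f, forall t, P t f (f t).
Proof.
move=> wf Pext Pex.
have /choice[c cP] : forall tf : T * (T -> U), exists u, P tf.1 tf.2 u by move=> [].
pose ext t (rec : forall s, lt s t -> U) s :=
  if pselect (lt s t) is left h then rec s h else u0.
pose f := Fix wf (fun=> U) (fun t rec => c (t, ext t rec)).
have fE t : f t = c (t, ext t (fun s _ => f s)).
  rewrite /f Fix_eq // => x r r' rr'; congr (c (_, _)); apply/funext => s.
  by rewrite /ext; case: pselect.
exists f => t; rewrite fE; apply: Pext (cP (t, _)) => s st /=.
by rewrite /ext; case: pselect.
Qed.

(** * The continuum *)

Section Ternary.
Variable R : realType.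
Implicit Types a b : nat -> bool.

(* Binary sequences are coded by base 3 expansions with digits 0 and 1, for which
   no carry can identify two different sequences. *)
Definition ternary_sum a N : R := \sum_(k < N) (a k)%:R * 3 ^- k.

Lemma ternary_sumS a N : ternary_sum a N.+1 = ternary_sum a N + (a N)%:R * 3 ^- N.
Proof. by rewrite /ternary_sum big_ord_recr. Qed.

Let p3 N : 0 < 3 ^- N :> R.
Proof. by rewrite invr_gt0 exprn_gt0. Qed.

Let p3S N : 3 ^- N = 3 * 3 ^- N.+1 :> R.
Proof. by rewrite exprS invfM mulrA divff ?mul1r. Qed.

Lemma ternary_tail a m N : (m <= N)%N ->
  ternary_sum a N <= ternary_sum a m + 3 / 2 * (3 ^- m - 3 ^- N).
Proof.
elim: N => [|N IH]; first by rewrite leqn0 => /eqP ->; rewrite subrr mulr0 addr0.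
rewrite leq_eqVlt => /predU1P[->|]; first by rewrite subrr mulr0 addr0.
rewrite ltnS => /IH; rewrite ternary_sumS (p3S N).
have := p3 N.+1; case: (a N) => /=; rewrite ?mul1r ?mul0r; lra.
Qed.

Lemma ternary_sum_le a m N : (m <= N)%N -> ternary_sum a m <= ternary_sum a N.
Proof.
move=> /subnK <-; elim: (N - m)%N => // k IH.
rewrite addSn ternary_sumS; apply: le_trans IH _.
by rewrite lerDl mulr_ge0 ?ler0n ?(ltW (p3 _)).
Qed.

Definition ternary a : R := sup (range (ternary_sum a)).

Lemma ternary_has_sup a : has_sup (range (ternary_sum a)).
Proof.
split; first by exists (ternary_sum a 0); exists 0%N.
exists (3 / 2) => _ [N _ <-]; apply: le_trans (ternary_tail a (leq0n N)) _.
by rewrite /ternary_sum big_ord0 expr0 invr1; have := p3 N; lra.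
Qed.

Lemma ternary_ge a N : ternary_sum a N <= ternary a.
Proof. by apply: sup_ubound; [case: (ternary_has_sup a)|exists N]. Qed.

Lemma ternary_le a m : ternary a <= ternary_sum a m + 3 / 2 * 3 ^- m.
Proof.
apply: sup_le_ub; first by case: (ternary_has_sup a).
move=> _ [N _ <-]; have [mN|/ltnW Nm] := leqP m N.
  by apply: le_trans (ternary_tail a mN) _; have := p3 N; lra.
by apply: le_trans (ternary_sum_le a Nm) _; have := p3 m; lra.
Qed.

Lemma ternary_lt a b m : (forall k, (k < m)%N -> a k = b k) -> a m -> ~~ b m ->
  ternary b < ternary a.
Proof.
move=> ab am bm; have := ternary_le b m.+1; have := ternary_ge a m.+1.
rewrite !ternary_sumS am (negbTE bm) mul1r mul0r addr0.
have -> : ternary_sum a m = ternary_sum b m.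
  by apply: eq_bigr => k _; rewrite ab.
by rewrite (p3S m); have := p3 m.+1; lra.
Qed.

Lemma ternary_inj : injective ternary.
Proof.
move=> a b e; apply/funext => k; elim/ltn_ind: k => k IH.
case ak: (a k); case bk: (b k) => //.
  by have := ternary_lt IH; rewrite ak bk e ltxx => /(_ isT isT).
have := @ternary_lt b a k; rewrite ak bk e ltxx => h.
by have := h (fun j jk => esym (IH j jk)) isT isT.
Qed.

Lemma ternary_ge0 a : 0 <= ternary a.
Proof. by have := ternary_ge a 0; rewrite /ternary_sum big_ord0. Qed.

Lemma ternary_le2 a : ternary a <= 2.
Proof. by have := ternary_le a 0; rewrite /ternary_sum big_ord0 expr0 invr1; lra. Qed.

End Ternary.

(** A vector is determined by the rationals below its coordinates, hence by a
binary sequence. *)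
Lemma row_injects_unit_interval (R : realType) n :
  exists2 h : 'rV[R]_n -> R, injective h & forall x, 0 <= h x <= 1.
Proof.
pose cut (x : 'rV[R]_n) (k : nat) : bool :=
  if @unpickle ('I_n * rat)%type k is Some (i, q) then ratr q < x 0 i else false.
exists (fun x => ternary R (cut x) / 2); last first.
  by move=> x; rewrite divr_ge0 ?ternary_ge0 //= ler_pdivrMr // mul1r ternary_le2.
move=> x y /(divIf _) e; have {}e : cut x = cut y.
  by apply: (@ternary_inj R); apply: e; rewrite pnatr_eq0.
apply/rowP => i; apply/eqP; rewrite eq_le; apply/andP; split; rewrite leNgt; apply/negP => lt.
- have [q] := rat_in_itvoo lt; rewrite in_itv /= => /andP[h1 h2].
  have := congr1 (fun c => c (pickle (i, q))) e; rewrite /cut pickleK h2.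
  by rewrite ltNge (ltW h1).
- have [q] := rat_in_itvoo lt; rewrite in_itv /= => /andP[h1 h2].
  have := congr1 (fun c => c (pickle (i, q))) e; rewrite /cut pickleK h2.
  by rewrite ltNge (ltW h1).
Qed.


(** * Open sets of directions in dimension at least three *)

Section OpenDirections.
Context {R : realType} {n : nat}.
Local Notation T := 'rV[R]_n.
Implicit Types (p q u v : T).

Definition ray p u : set T := [set t *: u + p | t in [set t : R | 0 <= t]].

(** Three directions in the pencil e + a f + b g that lead from p to points of one
line lie in a plane, so their determinant vanishes. Hence a line that is met
twice in one column a of the pencil is met in no other column. *)
Lemma pencil_unique (e0 e1 e2 s : R) (d0 d1 d2 v0 v1 v2 : R) (a a' b b' b3 : R)
  (t1 t2 t3 x1 x2 x3 : R) :
  e2 != 0 -> s != 0 -> 0 < t1 -> 0 < t2 -> 0 < t3 -> b != b' ->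
  t1 * (e0 + a * s) = d0 + x1 * v0 -> t1 * (e1 + b * s) = d1 + x1 * v1 ->
  t1 * e2 = d2 + x1 * v2 ->
  t2 * (e0 + a * s) = d0 + x2 * v0 -> t2 * (e1 + b' * s) = d1 + x2 * v1 ->
  t2 * e2 = d2 + x2 * v2 ->
  t3 * (e0 + a' * s) = d0 + x3 * v0 -> t3 * (e1 + b3 * s) = d1 + x3 * v1 ->
  t3 * e2 = d2 + x3 * v2 -> a = a'.
Proof.
move=> e20 s0 t1p t2p t3p bb h10 h11 h12 h20 h21 h22 h30 h31 h32.
pose det (y10 y11 y12 y20 y21 y22 y30 y31 y32 : R) :=
  y10 * (y21 * y32 - y22 * y31) - y11 * (y20 * y32 - y22 * y30)
  + y12 * (y20 * y31 - y21 * y30).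
have D0 : det (t1 * (e0 + a * s)) (t1 * (e1 + b * s)) (t1 * e2)
              (t2 * (e0 + a * s)) (t2 * (e1 + b' * s)) (t2 * e2)
              (t3 * (e0 + a' * s)) (t3 * (e1 + b3 * s)) (t3 * e2) = 0.
  by rewrite h10 h11 h12 h20 h21 h22 h30 h31 h32 /det; ring.
have {}D0 : (t1 * t2 * t3 * s * s * e2 * (b - b')) * (a - a') = 0.
  by rewrite -[RHS]oppr0 -D0 /det; ring.
have bb0 : (b - b' == 0) = false by rewrite subr_eq0 (negbTE bb).
apply/eqP; rewrite -subr_eq0.
move/eqP: D0; rewrite mulf_eq0 => /orP[|//].
by rewrite !mulf_eq0 !(gt_eqF t1p, gt_eqF t2p, gt_eqF t3p) (negbTE e20) (negbTE s0) bb0.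
Qed.

(** In dimension at least three a pencil of directions at p contains one whose ray
avoids fewer than continuum many given rays: each of these spoils at most one
column completely, and any other column in at most one point. *)
Lemma avoid_rays (J : set T) (q v : T -> T) (p e : T) (eps : R) (i j k : 'I_n) :
  ~ surjects J -> i != j -> i != k -> j != k -> e 0 k != 0 -> eps != 0 ->
  (forall t, J t -> ~ ray (q t) (v t) p) ->
  exists a b, [/\ 0 <= a <= 1, 0 <= b <= 1 & forall t, J t ->
    ray (q t) (v t) `&` ray p (e + (a * eps) *: delta_mx 0 i + (b * eps) *: delta_mx 0 j) = set0].
Proof.
move=> nJ ij ik jk ek eps0 pJ; have [h hinj h01] := row_injects_unit_interval R n.
pose u a b := e + (a * eps) *: delta_mx 0 i + (b * eps) *: delta_mx 0 j.
pose hit t a b := exists s x, [/\ 0 < s, 0 <= x & s *: u a b + p = x *: v t + q t].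
have hitP t a b : J t -> ray (q t) (v t) `&` ray p (u a b) != set0 -> hit t a b.
  move=> Jt /set0P[_ [[x /= x0 <-] [s /= s0 es]]]; exists s, x; split=> //.
  rewrite lt_neqAle s0 andbT; apply/eqP => s00; apply: (pJ _ Jt).
  by exists x => //; rewrite -es -s00 scale0r add0r.
have hitc t a b : hit t a b -> exists s x, [/\ 0 < s,
    s * (e 0 i + a * eps) = (q t 0 i - p 0 i) + x * v t 0 i,
    s * (e 0 j + b * eps) = (q t 0 j - p 0 j) + x * v t 0 j &
    s * e 0 k = (q t 0 k - p 0 k) + x * v t 0 k].
  move=> [s [x [s0 _ E]]]; exists s, x; split=> //.
  - have := congr1 (fun y : T => y 0 i) E; rewrite !mxE !eqxx (negbTE ij) /= => E'.
    by clear E; lra.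
  - have := congr1 (fun y : T => y 0 j) E; rewrite !mxE !eqxx eq_sym (negbTE ij) /= => E'.
    by clear E; lra.
  - have := congr1 (fun y : T => y 0 k) E.
    rewrite !mxE !eqxx (eq_sym k) (negbTE ik) (eq_sym k) (negbTE jk) /= => E'.
    by clear E; lra.
have uniq t a a' b b' b3 : b != b' -> hit t a b -> hit t a b' -> hit t a' b3 -> a = a'.
  move=> bb /hitc[s1 [x1 [s10 A1 A2 A3]]] /hitc[s2 [x2 [s20 B1 B2 B3]]] /hitc[s3 [x3 [s30 C1 C2 C3]]].
  exact: (pencil_unique ek eps0 s10 s20 s30 bb A1 A2 A3 B1 B2 B3 C1 C2 C3).
(* A column of the pencil that no earlier ray meets twice. *)
have [t0 ht0] : exists t0, forall t, J t ->
    ~ exists b b', [/\ b != b', hit t (h t0) b & hit t (h t0) b'].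
  apply: contrapT => no; apply: nJ.
  pose W t := [set t0 | exists b b', [/\ b != b', hit t (h t0) b & hit t (h t0) b']].
  exists (fun t => xget 0 (W t)) => t0.
  have : exists2 t, J t & W t t0.
    apply: contrapT => no'; apply: no; exists t0 => t Jt Wt; apply: no'.
    by exists t.
  move=> [t Jt Wt]; exists t => //; have := xgetPex 0 (ex_intro _ _ Wt : W t !=set0).
  move: (xget 0 (W t)) => t1 [b1 [b1' [bb1 h1 h1']]]; apply: hinj.
  have [b2 [_ [_ h2 _]]] := Wt.
  exact: uniq bb1 h1 h1' h2.
(* A point of that column that no earlier ray meets. *)
have [t1 ht1] : exists t1, forall t, J t -> ~ hit t (h t0) (h t1).
  apply: contrapT => no; apply: nJ.
  pose W t := [set t1 | hit t (h t0) (h t1)].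
  exists (fun t => xget 0 (W t)) => t1.
  have : exists2 t, J t & W t t1.
    apply: contrapT => no'; apply: no; exists t1 => t Jt Wt; apply: no'.
    by exists t.
  move=> [t Jt Wt]; exists t => //; have := xgetPex 0 (ex_intro _ _ Wt : W t !=set0).
  move: (xget 0 (W t)) => t2 h2; apply: contrapT => /eqP n12.
  apply: (ht0 _ Jt); exists (h t2), (h t1); split=> //.
  by apply: contra_neq n12; exact: hinj.
exists (h t0), (h t1); split=> // t Jt; apply/eqP; apply: contrapT => /negP.
by move=> /(hitP _ _ _ Jt) /(ht1 _ Jt).
Qed.

Hypothesis n3 : (3 <= n)%N.

(** The points of E are treated in the order given by small_well_order. A point
that is not yet covered gets a ray that avoids all earlier ones; such a ray
exists because an open set of directions contains a pencil. *)
Theorem open_directions_close_to_convex (E : set T) : E !=set0 ->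
  (forall p, E p -> exists e eps, [/\ e != 0, 0 < eps &
     forall u t, enorm (u - e) < eps -> 0 <= t -> E (p + t *: u)]) ->
  close_to_convex (~` E).
Proof.
move=> [p0 Ep0] HE.
have [W [lt [wf tri [pt ptP] small]]] := small_well_order T.
pose earlier f s t := [/\ W s, lt s t & exists v, f s = Some v].
pose covered (f : T -> option T) t p := exists s v, [/\ W s, lt s t, f s = Some v & ray (pt s) v p].
pose P t (f : T -> option T) o :=
  (o = None /\ (W t -> E (pt t) -> covered f t (pt t))) \/
  (exists u, [/\ o = Some u, W t, u != 0, ray (pt t) u `<=` E &
     forall s v, W s -> lt s t -> f s = Some v -> ray (pt s) v `&` ray (pt t) u = set0]).
have [f fP] : exists f, forall t, P t f (f t).
  apply: (wf_choice None wf) => [t f g o fg [[-> h]|[u [-> Wt u0 uE uf]]]|t f].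
  - left; split=> // Wt Et; have [s [v [Ws st fs sp]]] := h Wt Et.
    by exists s, v; rewrite -fg.
  - right; exists u; split=> // s v Ws st; rewrite -fg //; exact: uf.
  have [Wt|] := pselect (W t); last by exists None; left; split.
  have [Et|] := pselect (E (pt t)); last by exists None; left; split.
  have [c|nc] := pselect (covered f t (pt t)); first by exists None; left; split.
  have [e [eps [e0 eps0 eE]]] := HE _ Et.
  have [k ek] : exists k, e 0 k != 0.
    apply: contrapT => no; move/eqP: e0; apply; apply/rowP => k; rewrite mxE.
    by apply: contrapT => /eqP ek; apply: no; exists k.
  have /card_gt1P[i [j [ik jk ij]]] : (1 < #|predC1 k|)%N.
    by rewrite cardC1 card_ord ltn_predRL.
  rewrite !inE in ik jk.
  pose J := [set s | [/\ W s, lt s t & exists v, f s = Some v]].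
  have nJ : ~ surjects J.
    move=> [g hg]; apply: (small _ Wt); exists g => x.
    by have [s [Ws st _] <-] := hg x; exists s.
  pose v s := odflt 0 (f s).
  have [||a [b [/andP[a0 a1] /andP[b0 b1] hab]]] := @avoid_rays J pt v (pt t) e (eps / 4) i j k nJ ij ik jk ek.
    by rewrite mulf_neq0 ?gt_eqF.
    by move=> s [Ws st [w fs]]; rewrite /v fs /= => sp; apply: nc; exists s, w.
  set u := e + _ + _ in hab.
  have ue : enorm (u - e) < eps.
    have -> : u - e = (a * (eps / 4)) *: delta_mx 0 i + (b * (eps / 4)) *: delta_mx 0 j.
      by rewrite addrC /u -addrA addKr.
    have dl (l : 'I_n) : enorm (delta_mx 0 l : T) = 1.
      rewrite enormE /dot (bigD1 l) //= !mxE !eqxx mulr1 big1 ?addr0 ?sqrtr1 //.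
      by move=> m ml; rewrite !mxE (negbTE ml) andbF mul0r.
    apply: le_lt_trans (enormD _ _) _; rewrite !enormZ !dl !mulr1.
    by rewrite !ger0_norm ?mulr_ge0 ?divr_ge0 ?(ltW eps0) //; nra.
  exists (Some u); right; exists u; split=> //.
  - apply/eqP => u0; move/eqP: ek; apply.
    have := congr1 (fun y : T => y 0 k) u0; rewrite !mxE eqxx (eq_sym k) (negbTE ik).
    by rewrite (eq_sym k) (negbTE jk) !mulr0 !addr0.
  - by move=> _ [x /= x0 <-]; rewrite addrC; exact: eE.
  - move=> s w Ws st fs; have := hab s; rewrite /v fs; apply.
    by split=> //; exists w.
split.
  by apply/eqP => /seteqP[_ /(_ p0 I)]; exact.
exists [set H | exists t u, f t = Some u /\ H = ray (pt t) u]; split.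
- move=> _ [t [u [ft ->]]]; exists u, (pt t).
  case: (fP t) => [[]|[u' [e _ u0 _ _]]]; first by rewrite ft.
  by split; [move: e u0; rewrite ft => -[->]|right].
- move=> _ _ [t [u [ft ->]]] [t' [u' [ft' ->]]] [p [hp hp']].
  have [tt|tt] := eqVneq t t'; first by move: ft'; rewrite -tt ft => -[->].
  case: (fP t) => [[]|[w [e Wt _ _ ht]]]; first by rewrite ft.
  case: (fP t') => [[]|[w' [e' Wt' _ _ ht']]]; first by rewrite ft'.
  move: e e'; rewrite ft ft' => -[?] [?]; subst w w'.
  have [lt12|lt21] := tri _ _ Wt Wt' tt.
    by have := ht' _ _ Wt lt12 ft => /seteqP[/(_ p)[]].
  by have := ht _ _ Wt' lt21 ft' => /seteqP[/(_ p)[]].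
- rewrite setCK; apply/seteqP; split=> [p Ep|p [_ [t [u [ft ->]]] hp]].
    have [t Wt pe] := ptP p; rewrite -pe in Ep *.
    case: (fP t) => [[_ /(_ Wt Ep)[s [v [Ws st fs sp]]]]|[u [ft _ _ _ _]]].
      by exists (ray (pt s) v) => //; exists s, v.
    by exists (ray (pt t) u); [exists t, u|exists 0; rewrite /= ?scale0r ?add0r].
  case: (fP t) => [[]|[u' [e _ _ uE _]]]; first by rewrite ft.
  by move: e; rewrite ft => -[?]; subst u'; exact: uE.
Qed.

End OpenDirections.


Section ApollonianOpen.
Context {R : realType} {n : nat}.
Implicit Types (u v w z p : 'rV[R]_n).
Variables (B : set 'rV[R]_n) (c d : R).
Hypothesis c0 : 0 < c.
Hypothesis c3 : c ^+ 2 <= 3.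
Hypothesis d0 : 0 < d.
Hypothesis Bd : forall w, B w -> d <= enorm w.

Local Notation E := (apollonian_union B c d).

Let dot_near z u e : enorm (u - e) * enorm z < dot z e -> 0 < dot z u.
Proof.
move=> h; have := dot_le_norm (u - e) z; rewrite ler_norml !dotE (dotC u) (dotC e).
by move=> /andP[k _]; lra.
Qed.

(** At a point v of the Apollonian ball of w with |v| < c d there are two cases. If
c <= 1, this set is unbounded and contains a cone of directions around w. If
c > 1, it is a ball that reaches beyond the ball of radius c d, and the segment
from v to a point p near its far end stays in it, while the ray beyond p stays
outside of the ball of radius c d. *)
Lemma apollonian_open_directions v : E v ->
  exists e eps, [/\ e != 0, 0 < eps &
    forall u t, enorm (u - e) < eps -> 0 <= t -> E (v + t *: u)].
Proof.
move=> Ev; have v0 := apollonian_neq0 c0 d0 Bd Ev.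
have nv : 0 < enorm v by rewrite enorm_gt0.
have [vc|vc] := leP (c * d) (enorm v).
  exists v, (enorm v); split=> // u t uv t0; left.
  have vu : 0 < dot v u.
    by apply: (@dot_near v u v); rewrite -sqr_enorm expr2 ltr_pM2r.
  apply: le_trans vc _; rewrite ler_enorm !dotE (dotC u v).
  have := mulr_ge0 t0 (ltW vu); have := mulr_ge0 t0 (mulr_ge0 t0 (dot_ge0 u)); lra.
case: (Ev) => [|[w Bw vw]]; first by rewrite leNgt vc.
have w0 := B_neq0 d0 Bd Bw; have nw : 0 < enorm w by rewrite enorm_gt0.
have [c1|c1] := leP c 1.
  have h := apollonian_dot c0 d0 Bd Bw vc vw (lexx _).
  exists w, (Num.min (dot v w / enorm v) (enorm w)); split=> //.
    by rewrite lt_min divr_gt0.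
  move=> u t; rewrite lt_min => /andP[u1 u2] t0; right; exists w; rewrite // apolP //.
  have vu : 0 < dot v u by apply: (@dot_near v u w); rewrite -ltr_pdivlMr.
  have wu : 0 < dot w u.
    by apply: (@dot_near w u w); rewrite -sqr_enorm expr2 ltr_pM2r.
  move: vw; rewrite apolP // /apol !dotE (dotC w v) (dotC u v) (dotC u w).
  have k0 : 0 < c ^+ 2 by rewrite exprn_gt0.
  have k1 : c ^+ 2 <= 1 by rewrite expr_le1 // ltW.
  move: (c ^+ 2) k0 k1 => k k0 k1 h1.
  have h2 : 0 <= (1 - k) * (t * dot v u).
    by apply: mulr_ge0; [lra|apply: mulr_ge0 => //; exact: ltW].
  have h3 : 0 <= (1 - k) * (t * (t * dot u u)).
    by apply: mulr_ge0; [lra|rewrite !mulr_ge0 ?dot_ge0].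
  have h4 : 0 <= k * (t * dot w u).
    by apply: mulr_ge0; [exact: ltW|apply: mulr_ge0 => //; exact: ltW].
  lra.
have dw := Bd Bw.
have vwd : enorm (v - w) < d by rewrite -(ltr_pM2l c0); exact: le_lt_trans vw vc.
have wcd : enorm w < c * d + d.
  have := enormD v (w - v); rewrite addrC subrK enormB => h.
  by apply: le_lt_trans h _; rewrite ltrD.
have c2 : c < 2.
  rewrite ltNge; apply/negP => c2.
  have : 0 <= (c - 2) * (c + 2) by apply: mulr_ge0; lra.
  by have := c3; lra.
have cdw : c * d < enorm w + d.
  have : 0 < (2 - c) * d by rewrite mulr_gt0 // subr_gt0.
  lra.
pose M := (c * d + (enorm w + d)) / 2.
have M1 : c * d < M by rewrite /M; lra.
have M2 : M < enorm w + d by rewrite /M; lra.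
pose p0 := (M / enorm w) *: w.
have np0 : enorm p0 = M.
  rewrite enormZ ger0_norm ?divfK ?gt_eqF // divr_ge0 ?enorm_ge0 //.
  by have := mulr_gt0 c0 d0; lra.
have p0w : enorm (p0 - w) = `|M - enorm w|.
  have -> : p0 - w = ((M - enorm w) / enorm w) *: w.
    by rewrite mulrBl divff ?gt_eqF // scalerBl scale1r.
  by rewrite enormZ normrM normfV (ger0_norm (ltW nw)) divfK ?gt_eqF.
have p0wd : enorm (p0 - w) < d by rewrite p0w ltr_norml; lra.
exists (p0 - v), (Num.min (M - c * d) (d - enorm (p0 - w))); split.
- apply/eqP => /eqP; rewrite subr_eq0 => /eqP e.
  by move: M1; rewrite -np0 e => /lt_trans /(_ vc); rewrite ltxx.
- by rewrite lt_min !subr_gt0 M1.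
move=> u t; rewrite lt_min => /andP[u1 u2] t0.
pose p := v + u.
have pp0 : u - (p0 - v) = p - p0 by rewrite opprB /p addrA (addrC u).
rewrite pp0 in u1 u2.
have pc : c * d < enorm p.
  have := enormD p (p0 - p); rewrite [p + _]addrC subrK np0 enormB.
  by clear pp0; lra.
have pw : c * enorm (p - w) <= enorm p.
  apply: ltW; apply: le_lt_trans pc; rewrite ler_pM2l //.
  by apply: le_trans (enorm_triangle p0 _ _) _; clear pp0; lra.
have vp : dot v v < dot p p by rewrite -ltr_enorm; exact: lt_trans vc pc.
have k1 : 1 < c ^+ 2 by rewrite exprn_egt1.
have [t1|t1] := leP t 1.
  right; exists w; rewrite // apolP //.
  move: vw pw; rewrite !apolP // /apol /p !dotE.
  rewrite (dotC w v) (dotC u v) (dotC u w).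
  move: (c ^+ 2) k1 => k k1 h1 h2.
  have h3 : 0 <= (k - 1) * (t * ((1 - t) * dot u u)).
    apply: mulr_ge0; first lra.
    by apply: mulr_ge0 => //; apply: mulr_ge0; [lra|exact: dot_ge0].
  have h4 := mulr_ge0_le0 t0 h2.
  have h5 : (1 - t) * (k * (dot v v + - dot v w + (- dot v w + - - dot w w)) + - dot v v) <= 0.
    by apply: mulr_ge0_le0; [lra|lra].
  lra.
left; apply: ltW; apply: lt_le_trans pc _; rewrite ler_enorm.
move: vp; rewrite /p !dotE (dotC u v) => vp.
have h1 : 0 < (t - 1) * (2 * dot v u + dot u u) by apply: mulr_gt0; lra.
have h2 : 0 <= (t - 1) * (t * dot u u).
  by apply: mulr_ge0; [lra|apply: mulr_ge0 => //; exact: dot_ge0].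
lra.
Qed.

End ApollonianOpen.

Theorem j_ball_close_to_convex3 (R : realType) n (G : set 'rV[R]_n) x r :
  (3 <= n)%N -> open G -> G != setT -> G x -> 0 < r -> r <= ln (1 + Num.sqrt 3) ->
  close_to_convex (j_ball G x r).
Proof.
move=> n3 oG GT Gx r0 r3; apply: (@close_to_convex_translate _ _ _ x).
set D := [set v | _]; rewrite -[D]setCK j_ball_apollonian //.
have c0 := c_gt0 r0; have c3 := c_sqr r0 r3; have d0 := d_gt0 oG GT Gx.
have Bd := @B_dist _ _ G x.
apply: open_directions_close_to_convex => //.
  have [w bw] := boundary_neq0 Gx GT.
  exists (w - x); right; exists (w - x); first by rewrite /= addrC subrK.
  by rewrite subrr enorm0 mulr0 enorm_ge0.
by move=> v; exact: apollonian_open_directions.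
Qed.

Theorem j_ball_close_to_convex (R : realType) n (G : set 'rV[R]_n) x r :
  (2 <= n)%N -> open G -> G != setT -> G x -> 0 < r -> r <= ln (1 + Num.sqrt 3) ->
  close_to_convex (j_ball G x r).
Proof.
rewrite leq_eqVlt => /predU1P[n2|]; last exact: j_ball_close_to_convex3.
by subst n; exact: j_ball_close_to_convex2.
Qed.


(** * The punctured space *)

Section Punctured.
Context {R : realType} {n : nat}.
Local Notation T := 'rV[R]_n.

Lemma open_punctured : open (~` [set (0 : T)]).
Proof.
apply: closed_openC.
rewrite (_ : [set 0] = [set y : T | enorm (y - 0) <= 0]); first exact: closed_ball_enorm.
apply/seteqP; split=> y /=; rewrite subr0; first by move=> ->; rewrite enorm0.
by move=> h; apply/eqP; rewrite -enorm_eq0 eq_le h enorm_ge0.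
Qed.

Lemma exists_unit : (0 < n)%N -> exists e : T, enorm e = 1.
Proof.
move=> n0; exists (delta_mx 0 (Ordinal n0)).
rewrite enormE /dot (bigD1 (Ordinal n0)) //= !mxE !eqxx mulr1 big1 ?addr0 ?sqrtr1 //.
by move=> m ml; rewrite !mxE (negbTE ml) andbF mul0r.
Qed.

Lemma boundary_punctured : (0 < n)%N -> boundary (~` [set (0 : T)]) = [set 0].
Proof.
move=> n0; have /interior_id oi := open_punctured; rewrite /boundary oi.
apply/seteqP; split=> [x [_ /contrapT]//|_ ->]; split; last by move=> /=; apply.
move=> A /nbhs_enormP[eps eps0 hA]; have [e e1] := exists_unit n0.
have h : enorm ((eps / 2) *: e) = eps / 2.
  by rewrite enormZ e1 mulr1 ger0_norm // divr_ge0 // ltW.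
exists ((eps / 2) *: e); split.
  by apply/eqP; rewrite -enorm_eq0 h gt_eqF // divr_gt0.
by apply: hA; rewrite sub0r enormN h; lra.
Qed.

Lemma bdist_punctured x : (0 < n)%N -> bdist (~` [set (0 : T)]) x = enorm x.
Proof.
move=> n0; rewrite /bdist boundary_punctured //.
rewrite (_ : [set _ | _ in _] = [set enorm x]) ?inf1 //.
by rewrite image_set1 subr0.
Qed.

Lemma punctured_neqT : ~` [set (0 : T)] != setT.
Proof. by apply/eqP => /seteqP[_ /(_ 0 I)]; apply. Qed.

Lemma halfspace_connected (e : T) : e != 0 -> connected [set y | 0 < dot y e].
Proof.
move=> e0; have ee : 0 < dot e e by rewrite dot_gt0.
pose f y := fun t : R => e + t *: (y - e).
have -> : [set y | 0 < dot y e] = \bigcup_(y in [set y | 0 < dot y e]) (f y @` `[0, 1]).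
  apply/seteqP; split=> [y /= ye|y [z /= ze [t]]].
    exists y => //; exists 1; first by rewrite /= in_itv /= ler01 lexx.
    by rewrite /f scale1r addrC subrK.
  rewrite /= in_itv /= => /andP[t0 t1] <-; rewrite /f !dotE.
  have -> : dot e e + t * (dot z e - dot e e) = t * dot z e + (1 - t) * dot e e by ring.
  have [tt|tt] := ltP 0 t; first by rewrite ltr_pwDl ?mulr_gt0 ?mulr_ge0 ?subr_ge0 ?(ltW ee).
  have -> : t = 0 by apply/eqP; rewrite eq_le tt t0.
  by rewrite mul0r add0r subr0 mul1r.
apply: bigcup_connected.
  exists e => y _; exists 0; first by rewrite /= in_itv /= lexx ler01.
  by rewrite /f scale0r addr0.
move=> y _; apply: connected_continuous_connected; first exact: segment_connected.
apply: continuous_subspaceT => t.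
by apply: cvgD; [exact: cvg_cst|exact: scalel_continuous].
Qed.

End Punctured.

Lemma eq_row2 (R : realType) (x y : 'rV[R]_2) : x 0 0 = y 0 0 -> x 0 1 = y 0 1 -> x = y.
Proof.
move=> h0 h1; apply/rowP => -[[|[|//]] i].
  by rewrite (_ : Ordinal i = 0) //; exact: val_inj.
by rewrite (_ : Ordinal i = 1) //; exact: val_inj.
Qed.

Definition vec2 {R : realType} (a b : R) : 'rV[R]_2 := \row_i (if i == 0 then a else b).

Lemma vec2_0 (R : realType) (a b : R) : vec2 a b 0 0 = a. Proof. by rewrite mxE. Qed.
Lemma vec2_1 (R : realType) (a b : R) : vec2 a b 0 1 = b. Proof. by rewrite mxE. Qed.
Definition vec2E := (vec2_0, vec2_1).

Lemma domain_punctured (R : realType) : domain (~` [set (0 : 'rV[R]_2)]).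
Proof.
split; first exact: open_punctured; last first.
  by exists (vec2 1 0); move=> /(congr1 (fun x : 'rV[R]_2 => x 0 0)); rewrite vec2E mxE; apply/eqP/oner_neq0.
pose H (e : 'rV[R]_2) := [set y | 0 < dot y e].
have Hc e : e != 0 -> connected (H e) by exact: halfspace_connected.
have nz (a b : R) : (a != 0) || (b != 0) -> vec2 a b != 0.
  by apply: contraTneq => /[dup] /(congr1 (fun x : 'rV[R]_2 => x 0 0)) h0
    /(congr1 (fun x : 'rV[R]_2 => x 0 1)) h1; move: h0 h1; rewrite !vec2E !mxE => -> ->; rewrite eqxx.
have -> : ~` [set (0 : 'rV[R]_2)] = ((H (vec2 1 0) `|` H (vec2 0 1)) `|` H (vec2 (-1) 0)) `|` H (vec2 0 (-1)).
  apply/seteqP; split=> [y /= y0|y].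
    rewrite /H /= !dot2 !vec2E !mulr0 !mulr1 !addr0 !add0r !mulrN1.
    have [a|a|a] := ltgtP (y 0 0) 0.
    - by left; right; rewrite oppr_gt0.
    - by left; left; left.
    - have [b|b|b] := ltgtP (y 0 1) 0.
      + by right; rewrite oppr_gt0.
      + by left; left; right.
      + by case: y0; apply: eq_row2; rewrite mxE.
  by move=> h /= y0; move: h; rewrite y0 /H /= !dot0l ltxx => -[[[]|]|].
apply: connectedU.
- exists (vec2 1 (-1)); split; last by rewrite /H /= dot2 !vec2E; lra.
  by left; left; rewrite /H /= dot2 !vec2E; lra.
- apply: connectedU.
  + exists (vec2 (-1) 1); split; last by rewrite /H /= dot2 !vec2E; lra.
    by right; rewrite /H /= dot2 !vec2E; lra.
  + apply: connectedU.
    * by exists (vec2 1 1); split; rewrite /H /= dot2 !vec2E; lra.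
    * by apply/Hc/nz; rewrite oner_eq0.
    * by apply/Hc/nz; rewrite oner_eq0 orbT.
  + by apply/Hc/nz; rewrite oppr_eq0 oner_eq0.
- by apply/Hc/nz; rewrite oppr_eq0 oner_eq0 orbT.
Qed.

(** The obstruction that gives sharpness. If every ray in the complement from a
point has to leave to one side and downwards, and every ray from a point
vertically below it to the same side and upwards, then the half-lines through
these points cross, so that they would have to be equal, which they cannot be
as both start on one vertical line. *)
Lemma mirror_not_close_to_convex (R : realType) (D : set 'rV[R]_2) (p h h' s : R) :
  h' < h -> ~ D (vec2 p h) -> ~ D (vec2 p h') ->
  (forall u : 'rV[R]_2, u != 0 -> (forall t, 0 <= t -> ~ D (vec2 p h + t *: u)) ->
     0 < s * u 0 0 /\ u 0 1 < 0) ->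
  (forall u : 'rV[R]_2, u != 0 -> (forall t, 0 <= t -> ~ D (vec2 p h' + t *: u)) ->
     0 < s * u 0 0 /\ 0 < u 0 1) ->
  ~ close_to_convex D.
Proof.
move=> hh DP DP' hP hP' [_ [F [Fh Ft Fc]]].
have key q : ~ D q -> exists H y, [/\ F H, y != 0, forall t, 0 <= t -> H (q + t *: y)
    & forall x, H x -> exists t, x = q + t *: y].
  move=> Dq; have : (\bigcup_(H in F) H) q by rewrite -Fc.
  move=> [H FH Hq]; have [y [z [y0 e]]] := Fh _ FH; exists H, y; split=> //.
    move=> t t0; case: e Hq => -> [a /= a0 <-]; exists (a + t) => /=.
    - exact: ltr_wpDr.
    - by rewrite scalerDl addrAC.
    - exact: addr_ge0.
    - by rewrite scalerDl addrAC.
  move=> x Hx; case: e Hq Hx => -> [a /= a0 <-] [b /= b0 <-]; exists (b - a);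
    by rewrite addrAC -scalerDl addrCA subrr addr0.
have [H [y [FH y0 Hy Hl]]] := key _ DP; have [H' [y' [FH' y'0 Hy' _]]] := key _ DP'.
have nD K q : F K -> K q -> ~ D q.
  by move=> FK Kq; have : (~` D) q by rewrite Fc; exists K.
have [yx yy] := hP _ y0 (fun t t0 => nD _ _ FH (Hy _ t0)).
have [y'x y'y] := hP' _ y'0 (fun t t0 => nD _ _ FH' (Hy' _ t0)).
have HH : H = H'.
  pose k := y' 0 1 / (s * y' 0 0) - y 0 1 / (s * y 0 0).
  have k0 : 0 < k by rewrite subr_gt0 (@lt_trans _ _ 0) ?divr_gt0 // pmulr_llt0 ?invr_gt0.
  pose l := (h - h') / k.
  have l0 : 0 < l by rewrite divr_gt0 // subr_gt0.
  have a0 : 0 < l / (s * y 0 0) by rewrite divr_gt0.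
  have b0 : 0 < l / (s * y' 0 0) by rewrite divr_gt0.
  apply: Ft => //; exists (vec2 p h + (l / (s * y 0 0)) *: y); split; first exact: Hy (ltW a0).
  have -> : vec2 p h + (l / (s * y 0 0)) *: y = vec2 p h' + (l / (s * y' 0 0)) *: y'.
    have s0 : s != 0 by apply: contraTneq yx => ->; rewrite mul0r ltxx.
    have n0 : y 0 0 != 0 by apply: contraTneq yx => ->; rewrite mulr0 ltxx.
    have n0' : y' 0 0 != 0 by apply: contraTneq y'x => ->; rewrite mulr0 ltxx.
    have lk : l * k = h - h' by rewrite divfK // gt_eqF.
    apply: eq_row2; rewrite !mxE /=; first by field; rewrite s0 n0 n0'.
    have : l / (s * y' 0 0) * y' 0 1 - l / (s * y 0 0) * y 0 1 = h - h'.
      by rewrite -lk /k; field; rewrite s0 n0 n0'.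
    by lra.
  exact: Hy' (ltW b0).
have := Hy' 0 (lexx 0); rewrite scale0r addr0 -HH => /Hl[t e].
have := congr1 (fun x : 'rV[R]_2 => x 0 0) e; have := congr1 (fun x : 'rV[R]_2 => x 0 1) e.
rewrite !mxE /= => e1 e2; have /eqP : t * y 0 0 = 0 by clear e; lra.
rewrite mulf_eq0 => /orP[/eqP t0|/eqP n0].
  by move: e1 hh; rewrite t0 mul0r addr0 => ->; rewrite ltxx.
by rewrite n0 mulr0 ltxx in yx.
Qed.


(** * Sharpness for the j-metric *)

Lemma quadratic_step (R : realType) (q b k L : R) : q < L ->
  exists2 e, 0 < e & q + b * e + k * e ^+ 2 < L.
Proof.
move=> qL; pose m := `|b| + `|k| + 1.
have m0 : 0 < m by rewrite ltr_wpDl ?addr_ge0.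
have h0 : 0 < (L - q) / m by rewrite divr_gt0 // subr_gt0.
pose e := Num.min 1 ((L - q) / m / 2).
have e0 : 0 < e by rewrite lt_min ltr01 divr_gt0.
have e1 : e <= 1 by rewrite ge_min lexx.
have e2 : e <= (L - q) / m / 2 by rewrite ge_min lexx orbT.
exists e => //.
have be : b * e <= `|b| * e by rewrite ler_wpM2r ?ler_norm ?ltW.
have ke : k * e ^+ 2 <= `|k| * e.
  apply: (@le_trans _ _ (`|k| * e ^+ 2)); first by rewrite ler_wpM2r ?sqr_ge0 ?ler_norm.
  by rewrite ler_wpM2l // expr2 ler_piMr // ltW.
have me : m * e <= (L - q) / 2.
  by apply: (le_trans (ler_wpM2l (ltW m0) e2)); rewrite le_eqVlt; apply/orP; left; apply/eqP; field; rewrite gt_eqF.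
have : m * e = `|b| * e + `|k| * e + e by rewrite /m; ring.
lra.
Qed.

Section JSharp.
Context {R : realType}.
Variables (r : R).
Hypothesis r3 : ln (1 + Num.sqrt 3) < r.
Local Notation C := (expR r - 1).

Lemma sharp_C : 1 < C /\ 3 < C ^+ 2.
Proof.
have s0 : 0 <= Num.sqrt 3 :> R by exact: sqrtr_ge0.
have h : Num.sqrt 3 < C.
  rewrite ltrBrDl -[ltLHS](@lnK _ (1 + Num.sqrt 3)) ?ltr_expR //.
  by rewrite posrE ltr_wpDr.
have h3 : 3 < C ^+ 2.
  by rewrite -[ltLHS](@sqr_sqrtr _ 3) // ltr_pXn2r ?nnegrE // ltW // (le_lt_trans s0).
split=> //; rewrite ltNge; apply/negP => C1.
have C0 : 0 <= C by apply: ltW; exact: le_lt_trans s0 h.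
have : C ^+ 2 <= 1 by rewrite expr_le1.
lra.
Qed.

(** With the ball centered at -e1, the Apollonian ball removed from it has its
topmost point P at height C / (C^2 - 1), and for C > sqrt 3 the points to the
right of P belong to the j-ball: the mouth of the pocket is narrower than the
pocket, so that rays from P have to descend, and those from its mirror image
have to ascend. *)
Lemma j_ball_not_close_to_convex :
  ~ close_to_convex (j_ball (~` [set 0]) (vec2 (-1) 0 : 'rV[R]_2) r).
Proof.
have [C1 C3] := sharp_C.
set D := j_ball _ _ _.
have m2 : 2 < C ^+ 2 - 1 by lra.
have nx : enorm (vec2 (-1) 0 : 'rV[R]_2) = 1.
  by rewrite enormE dot2 !vec2E mulr0 addr0 mulrNN mulr1 sqrtr1.
have x0 : vec2 (-1) 0 != 0 :> 'rV[R]_2 by rewrite -enorm_eq0 nx oner_eq0.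
have C0 : 0 < C by lra.
have b0 : boundary (~` [set (0 : 'rV[R]_2)]) !=set0 by rewrite boundary_punctured //; exists 0.
have JL (y : 'rV[R]_2) : y != 0 -> _ = _ :=
  fun y0 => j_metric_lt r (@open_punctured R 2) (elimN eqP x0) (elimN eqP y0) b0.
have DP y : D y <-> y != 0 /\
    ((y 0 0 + 1) ^+ 2 + y 0 1 ^+ 2 < C ^+ 2 /\
     (y 0 0 + 1) ^+ 2 + y 0 1 ^+ 2 < C ^+ 2 * (y 0 0 ^+ 2 + y 0 1 ^+ 2)).
  have e1 : dot (y - vec2 (-1) 0) (y - vec2 (-1) 0) = (y 0 0 + 1) ^+ 2 + y 0 1 ^+ 2.
    by rewrite dot2 !mxE /=; ring.
  have e2 : dot y y = y 0 0 ^+ 2 + y 0 1 ^+ 2 by rewrite dot2; ring.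
  rewrite -e1 -e2 /D /j_ball /=; split=> [[/eqP y0]|[y0 [h1 h2]]].
    rewrite JL // !bdist_punctured // nx mulr1 => /andP[h1 h2]; split=> //.
    rewrite -!sqr_enorm -exprMn !ltr_pXn2r ?nnegrE ?mulr_ge0 ?enorm_ge0 ?(ltW C0) //.
  split; first exact/eqP.
  rewrite JL // !bdist_punctured // nx mulr1.
  rewrite -!sqr_enorm -exprMn !ltr_pXn2r ?nnegrE ?mulr_ge0 ?enorm_ge0 ?(ltW C0) // in h1 h2.
  by rewrite h1 h2.
pose m := C ^+ 2 - 1; have m0 : 0 < m by rewrite /m; lra.
pose p := m^-1; pose h := C / m.
have h0 : 0 < h by rewrite divr_gt0.
have pm : p * m = 1 by rewrite mulVf // gt_eqF.
have hm : h * m = C by rewrite divfK // gt_eqF.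
have p0 : 0 < p by rewrite invr_gt0.
(* The equation of the circle, and the bound that places its left half inside
   the ball around the centre. *)
have circ : m * (p ^+ 2 + h ^+ 2) = 2 * p + 1.
  have -> : m * (p ^+ 2 + h ^+ 2) = (p * m) * p + (h * m) * h by ring.
  rewrite pm hm mul1r.
  have : C * h * m = (p + 1) * m by rewrite -mulrA hm [RHS]mulrDl pm /m; ring.
  by move/(mulIf (lt0r_neq0 m0)) => ->; ring.
have p2 : (2 * p + 1) < m.
  have : 0 < (m - 2) * (m + 1) by rewrite mulr_gt0 // /m; lra.
  move=> q; have : 0 < ((m - 2) * (m + 1)) * p by rewrite mulr_gt0.
  have -> : (m - 2) * (m + 1) * p = (p * m) * m - (p * m) - 2 * p by ring.
  by rewrite pm; lra.
have step (u y : 'rV[R]_2) : u != 0 ->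
    m * (y 0 0 ^+ 2 + y 0 1 ^+ 2) = 2 * y 0 0 + 1 -> y 0 0 <= p ->
    0 <= (m * y 0 0 - 1) * u 0 0 + m * y 0 1 * u 0 1 ->
    exists2 t, 0 < t & D (y + t *: u).
  move=> u0 cy yp slope.
  have K0 : 0 < u 0 0 ^+ 2 + u 0 1 ^+ 2.
    by rewrite !expr2 -dot2 dot_gt0.
  have ny : (y 0 0 + 1) ^+ 2 + y 0 1 ^+ 2 < C ^+ 2.
    have -> : (y 0 0 + 1) ^+ 2 + y 0 1 ^+ 2 = (y 0 0 ^+ 2 + y 0 1 ^+ 2) * (m + 1).
      have -> : (y 0 0 ^+ 2 + y 0 1 ^+ 2) * (m + 1) = m * (y 0 0 ^+ 2 + y 0 1 ^+ 2) + (y 0 0 ^+ 2 + y 0 1 ^+ 2) by ring.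
      by rewrite cy; ring.
    have -> : C ^+ 2 = m + 1 by rewrite /m; ring.
    rewrite gtr_pMl; last by lra.
    by rewrite -(ltr_pM2l m0) cy mulr1; lra.
  have [t t0 ht] := quadratic_step (2 * ((y 0 0 + 1) * u 0 0 + y 0 1 * u 0 1)) (u 0 0 ^+ 2 + u 0 1 ^+ 2) ny.
  exists t => //; apply/DP.
  have g : 0 < m * ((y 0 0 + t * u 0 0) ^+ 2 + (y 0 1 + t * u 0 1) ^+ 2) - 2 * (y 0 0 + t * u 0 0) - 1.
    have -> : m * ((y 0 0 + t * u 0 0) ^+ 2 + (y 0 1 + t * u 0 1) ^+ 2) - 2 * (y 0 0 + t * u 0 0) - 1 =
      (m * (y 0 0 ^+ 2 + y 0 1 ^+ 2) - (2 * y 0 0 + 1)) + 2 * (t * ((m * y 0 0 - 1) * u 0 0 + m * y 0 1 * u 0 1))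
       + m * (t ^+ 2 * (u 0 0 ^+ 2 + u 0 1 ^+ 2)) by ring.
    rewrite cy subrr add0r ltr_wpDl // ?mulr_gt0 ?exprn_gt0 // mulr_ge0 // mulr_ge0 //.
    exact: ltW.
  split.
    apply/eqP => e; have e0 := congr1 (fun x : 'rV[R]_2 => x 0 0) e.
    have e1 := congr1 (fun x : 'rV[R]_2 => x 0 1) e; rewrite !mxE in e0 e1.
    by move: g; rewrite e0 e1; clear e; lra.
  rewrite !mxE; split.
    by apply: le_lt_trans ht; rewrite le_eqVlt; apply/orP; left; apply/eqP; ring.
  by rewrite -subr_gt0; apply: lt_le_trans g _; rewrite /m le_eqVlt; apply/orP; left; apply/eqP; ring.
have nDP s : s ^+ 2 = 1 -> ~ D (vec2 p (s * h)).
  move=> s1 /DP[_ []]; rewrite !vec2E exprMn s1 mul1r => _.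
  have -> : C ^+ 2 = m + 1 by rewrite /m; ring.
  rewrite mulrDl circ; lra.
have main s : s ^+ 2 = 1 -> forall u : 'rV[R]_2, u != 0 ->
    (forall t, 0 <= t -> ~ D (vec2 p (s * h) + t *: u)) -> 0 < u 0 0 /\ s * u 0 1 < 0.
  move=> s1 u u0 hu.
  have sh : (s * h) ^+ 2 = h ^+ 2 by rewrite exprMn s1 mul1r.
  have u1 : s * u 0 1 < 0.
    rewrite ltNge; apply/negP => su.
    have [|||t t0] := @step u (vec2 p (s * h)) u0; rewrite ?vec2E //.
    - by rewrite sh.
    - rewrite (mulrC m p) pm subrr mul0r add0r -mulrA mulr_ge0 ?(ltW m0) //.
      by rewrite mulrAC mulr_ge0 // ltW.
    - by apply: hu; exact: ltW.
  split=> //; rewrite ltNge; apply/negP => ux.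
  have K0 : 0 < u 0 0 ^+ 2 + u 0 1 ^+ 2 by rewrite !expr2 -dot2 dot_gt0.
  (* The ray leaves the circle at the parameter t. *)
  pose K := u 0 0 ^+ 2 + u 0 1 ^+ 2; pose t := - 2 * (s * u 0 1) * h / K.
  have t0 : 0 < t by rewrite /t divr_gt0 // mulr_gt0 // mulNr oppr_gt0 pmulr_rlt0.
  have tK : t * K = - 2 * (s * u 0 1) * h by rewrite divfK // gt_eqF.
  have [|||t' t'0] := @step u (vec2 p (s * h) + t *: u) u0.
  - rewrite !mxE /=.
    have -> : m * ((p + t * u 0 0) ^+ 2 + (s * h + t * u 0 1) ^+ 2) =
      m * (p ^+ 2 + (s * h) ^+ 2) + 2 * t * (p * m) * u 0 0 + t * m * (2 * (s * u 0 1) * h + t * K).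
      by rewrite /K; ring.
    by rewrite sh circ pm tK; ring.
  - by rewrite !mxE /= gerDl pmulr_rle0.
  - rewrite !mxE /=.
    have -> : (m * (p + t * u 0 0) - 1) * u 0 0 + m * (s * h + t * u 0 1) * u 0 1 =
       (p * m - 1) * u 0 0 + m * (t * K + (s * u 0 1) * h) by rewrite /K; ring.
    rewrite pm subrr mul0r add0r tK.
    have -> : m * (- 2 * (s * u 0 1) * h + s * u 0 1 * h) = m * (h * - (s * u 0 1)) by ring.
    apply: mulr_ge0; first exact: ltW.
    by apply: mulr_ge0; rewrite ?oppr_ge0; exact: ltW.
  - by rewrite -addrA -scalerDl; apply: hu; rewrite addr_ge0 ?ltW.
have s1 : 1 ^+ 2 = 1 :> R by rewrite expr1n.
have sN1 : (-1) ^+ 2 = 1 :> R by rewrite sqrrN expr1n.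
apply: (@mirror_not_close_to_convex _ _ p (1 * h) (-1 * h) 1).
- by rewrite mulN1r mul1r; lra.
- exact: nDP.
- exact: nDP.
- by move=> u u0 hu; have := main 1 s1 u u0 hu; rewrite !mul1r.
- move=> u u0 hu; have := main (-1) sN1 u u0 hu.
  by rewrite mul1r mulN1r oppr_lt0.
Qed.

End JSharp.


(** * Taylor bounds and the constant lambda *)

Section Monotone.
Context {R : realType}.
Implicit Types (f df : R -> R) (a b : R).

Lemma is_derive_within f df a b : (forall x, a <= x <= b -> is_derive x 1 f (df x)) ->
  {within `[a, b], continuous f}.
Proof.
move=> h; apply: derivable_within_continuous => x.
by rewrite in_itv /= => /h hx; exact: ex_derive.
Qed.

Lemma derivative_ge0_le f df a b : a <= b ->
  (forall x, a <= x <= b -> is_derive x 1 f (df x)) ->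
  (forall x, a <= x <= b -> 0 <= df x) -> f a <= f b.
Proof.
move=> ab h h0; have [c||c cab e] := @MVT_segment R f df a b ab.
- by rewrite in_itv /= => /andP[ac cb]; apply: h; rewrite !ltW.
- exact: is_derive_within h.
- by rewrite -subr_ge0 e mulr_ge0 ?subr_ge0 // h0 // -(itvP cab).
Qed.

Lemma derivative_gt0_lt f df a b : a < b ->
  (forall x, a <= x <= b -> is_derive x 1 f (df x)) ->
  (forall x, a < x < b -> 0 < df x) -> f a < f b.
Proof.
move=> ab h h0; have [c||c cab e] := @MVT R f df a b ab.
- by rewrite in_itv /= => /andP[ac cb]; apply: h; rewrite !ltW.
- exact: is_derive_within h.
- rewrite -subr_gt0 e; apply: mulr_gt0; last by rewrite subr_gt0.
  by apply: h0; move: cab; rewrite in_itv.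
Qed.

End Monotone.

Section Taylor.
Context {R : realType}.
Implicit Types (x q : R).

(* The coefficients are given by their recursion, which keeps the numbers in the
   evaluations at rational points small. *)
Fixpoint taylor_coeff (k : nat) : R :=
  if k is k'.+1 then - taylor_coeff k' / ((k'.*2.+1)%:R * (k'.*2.+2)%:R) else 1.

Fixpoint cos_poly n x : R :=
  if n is n'.+1 then cos_poly n' x + taylor_coeff n' * x ^+ n'.*2 else 0.

Fixpoint sin_poly n x : R :=
  if n is n'.+1 then sin_poly n' x + taylor_coeff n' / (n'.*2.+1)%:R * x ^+ n'.*2.+1 else 0.

Lemma is_derive_add_monomial (f : R -> R) df c k x : is_derive x 1 f df ->
  is_derive x 1 (fun y => f y + c * y ^+ k.+1) (df + c * (k.+1%:R * x ^+ k)).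
Proof.
move=> hf.
have -> : (fun y => f y + c * y ^+ k.+1) = f + c \*: (id ^+ k.+1).
  by apply/funext => y /=; rewrite !fctE.
apply: is_derive_eq.
by rewrite /GRing.scale /= mulr1.
Qed.

Lemma is_derive_sin_poly n x : is_derive x 1 (sin_poly n) (cos_poly n x).
Proof.
elim: n => [|n IH] /=; first exact: is_derive_cst.
apply: (is_derive_eq (is_derive_add_monomial _ _ IH)).
congr (_ + _); have : (n.*2.+1)%:R != 0 :> R by rewrite pnatr_eq0.
by move: (n.*2.+1)%:R => a a0; rewrite mulrA divfK.
Qed.

Lemma is_derive_cos_poly n x : is_derive x 1 (cos_poly n.+1) (- sin_poly n x).
Proof.
elim: n => [|n IH].
  rewrite /= oppr0.
  have -> : (fun x0 : R => 0 + 1 * x0 ^+ 0) = cst 1 by apply/funext => y; rewrite expr0 add0r mulr1.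
  exact: is_derive_cst.
apply: (is_derive_eq (is_derive_add_monomial (taylor_coeff n.+1) n.*2.+1 IH)).
rewrite [in RHS]/= opprD; congr (_ + _).
have : (n.*2.+1)%:R != 0 :> R by rewrite pnatr_eq0.
have : (n.*2.+2)%:R != 0 :> R by rewrite pnatr_eq0.
rewrite [taylor_coeff n.+1]/=; move: (n.*2.+1)%:R (n.*2.+2)%:R => a b b0 a0.
by field; rewrite b0 a0.
Qed.

Lemma sin_poly0 n : sin_poly n 0 = 0.
Proof. by elim: n => //= n ->; rewrite exprS mul0r mulr0 addr0. Qed.

Lemma cos_poly0 n : cos_poly n.+1 0 = 1.
Proof.
elim: n => [|n IH]; first by rewrite /= expr0 add0r mulr1.
by rewrite -[LHS]/(cos_poly n.+1 0 + _ * _) IH exprS mul0r mulr0 addr0.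
Qed.

(** The Taylor polynomials of cosine and sine bound them alternately from above
and below: each inequality is the derivative of the next one. *)
Lemma taylor_bounds n x : 0 <= x ->
  (0 <= (-1) ^+ n.+1 * (cos x - cos_poly n.+1 x)) /\
  (0 <= (-1) ^+ n.+1 * (sin x - sin_poly n.+1 x)).
Proof.
have sin_of_cos m : (forall x, 0 <= x -> 0 <= (-1) ^+ m * (cos x - cos_poly m x)) ->
    forall x, 0 <= x -> 0 <= (-1) ^+ m * (sin x - sin_poly m x).
  move=> h {}x x0.
  have := @derivative_ge0_le R (fun y => (-1) ^+ m * (sin y - sin_poly m y))
    (fun y => (-1) ^+ m * (cos y - cos_poly m y)) 0 x x0.
  rewrite sin0 sin_poly0 subrr mulr0; apply=> y /andP[y0 _]; last exact: h.
  have := is_derive_sin_poly m y => hm.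
  have -> : (fun y => (-1) ^+ m * (sin y - sin_poly m y)) = (-1) ^+ m \*: (sin - sin_poly m).
    by apply/funext => z.
  exact: is_derive_eq.
elim: n x => [|n IH] x x0.
  have c1 y : 0 <= y -> 0 <= (-1) ^+ 1 * (cos y - cos_poly 1 y).
    by move=> _; rewrite /= expr1 expr0 add0r mulr1 mulN1r oppr_ge0 subr_le0 cos_le1.
  by split; [exact: c1|exact: sin_of_cos c1 _ x0].
have c1 y : 0 <= y -> 0 <= (-1) ^+ n.+2 * (cos y - cos_poly n.+2 y).
  move=> y0.
  have := @derivative_ge0_le R (fun y => (-1) ^+ n.+2 * (cos y - cos_poly n.+2 y))
    (fun y => (-1) ^+ n.+1 * (sin y - sin_poly n.+1 y)) 0 y y0.
  rewrite cos0 cos_poly0 subrr mulr0; apply=> z /andP[z0 _]; last exact: (IH z z0).2.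
  have := is_derive_cos_poly n.+1 z => hm.
  have -> : (fun y => (-1) ^+ n.+2 * (cos y - cos_poly n.+2 y)) = (-1) ^+ n.+2 \*: (cos - cos_poly n.+2).
    by apply/funext => t.
  apply: is_derive_eq; rewrite /GRing.scale /= (exprS _ n.+1) mulN1r mulNr.
  by rewrite -mulrN opprB opprK addrC.
by split; [exact: c1|exact: sin_of_cos c1 _ x0].
Qed.

End Taylor.


Section Lambda.
Context {R : realType}.
Implicit Types (x q l : R).

(** The defining equation of lambda in the variable q = sqrt (lambda^2 - 1). It
decreases on [pi/2, pi], and sqrt 3 > pi/2 places all relevant q there. *)
Definition lambda_fun q : R := cos q + q * sin q.

(* From cos (149/100) > 0. *)
Lemma pi_gt_298 : 298 / 100 < pi :> R.
Proof.
rewrite ltNge; apply/negP => h.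
have p2 := pi_ge2 R.
have : cos (149 / 100) <= cos (pi / 2) :> R.
  rewrite leNgt; apply/negP; rewrite ltr_cos ?in_itv /=; [by move=> ?; lra| |]; apply/andP; split; lra.
rewrite cos_pihalf.
have [|h1 _] := @taylor_bounds R 3 (149 / 100); first by lra.
by move: h1; rewrite /cos_poly /taylor_coeff /double /= !expr0; lra.
Qed.

Lemma pihalf_lt_sqrt3 : pi / 2 < Num.sqrt 3 :> R.
Proof.
rewrite ltNge; apply/negP => h.
have s0 : 0 <= Num.sqrt 3 :> R by rewrite sqrtr_ge0.
have c0 : 0 <= cos (Num.sqrt 3 : R).
  by apply: cos_ge0_pihalf; rewrite h andbT; have := pi_ge0 R; lra.
have s2 : Num.sqrt 3 ^+ 2 = 3 :> R by rewrite sqr_sqrtr.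
have [h1 _] := @taylor_bounds R 2 _ s0.
move: h1 c0; rewrite /cos_poly /taylor_coeff /double /= !expr0.
have -> : Num.sqrt 3 ^+ 4 = 9 :> R by rewrite (exprM _ 2 2) s2; lra.
by rewrite s2; lra.
Qed.

(* The zero of lambda_fun is close to 2.798386. Since lambda is sqrt (q^2 + 1),
   locating the zero between these two points gives lambda to the required
   precision. *)
Lemma lambda_fun_pos : 0 < lambda_fun (2 + 798 / 10 ^+ 3 + 384 / 10 ^+ 6).
Proof.
have [|h1 h2] := @taylor_bounds R 7 (2 + 798 / 10 ^+ 3 + 384 / 10 ^+ 6); first by lra.
rewrite /lambda_fun.
by move: h1 h2; rewrite /cos_poly /sin_poly /taylor_coeff /double /= !expr0; lra.
Qed.

Lemma lambda_fun_neg : lambda_fun (2 + 798 / 10 ^+ 3 + 387 / 10 ^+ 6) < 0.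
Proof.
have [|h1 h2] := @taylor_bounds R 8 (2 + 798 / 10 ^+ 3 + 387 / 10 ^+ 6); first by lra.
rewrite /lambda_fun.
by move: h1 h2; rewrite /cos_poly /sin_poly /taylor_coeff /double /= !expr0; lra.
Qed.

Lemma is_derive_lambda_fun q : is_derive q 1 lambda_fun (q * cos q).
Proof.
have -> : lambda_fun = cos + id * sin by apply/funext => t; rewrite /lambda_fun !fctE.
apply: (is_derive_eq (is_deriveD (is_derive_cos q) (is_deriveM (is_derive_id q 1) (is_derive_sin q)))).
by rewrite /GRing.scale /= mulr1; ring.
Qed.

Lemma cos_lt0_pihalf x : pi / 2 < x -> x <= pi -> cos x < 0.
Proof.
move=> h1 h2; rewrite -(@cos_pihalf R) ltr_cos // in_itv /=; have := pi_ge0 R => p0.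
  by apply/andP; split; lra.
by apply/andP; split; lra.
Qed.

Lemma lambda_fun_decr a b : pi / 2 <= a -> a < b -> b <= pi -> lambda_fun b < lambda_fun a.
Proof.
move=> ha ab hb.
have := @derivative_gt0_lt R (\- lambda_fun) (fun q => - (q * cos q)) a b ab.
rewrite ltrN2; apply=> [x _|x /andP[ax xb]].
  by have := is_derive_lambda_fun x => h; exact: is_derive_eq.
have x0 : 0 < x by have := pi_gt0 R; lra.
by rewrite -mulrN mulr_gt0 // oppr_gt0; apply: cos_lt0_pihalf; lra.
Qed.

Lemma is_lambdaP l : is_lambda l <->
  0 <= l /\ exists q, [/\ pi / 2 < q, q < pi, l ^+ 2 = q ^+ 2 + 1, l < pi & lambda_fun q = 0].
Proof.
have p3 := pi_gt_298; split=> [[l2 lp f0]|[l0 [q [q1 q2 lq lp f0]]]].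
  have s : 0 <= l ^+ 2 - 1 by nra.
  split; first by lra.
  exists (Num.sqrt (l ^+ 2 - 1)); split => //.
  - apply: lt_trans pihalf_lt_sqrt3 _; rewrite ltr_sqrt; nra.
  - rewrite -(@ger0_norm _ pi) ?pi_ge0 // -sqrtr_sqr ltr_sqrt; nra.
  - by rewrite sqr_sqrtr // subrK.
have q0 : 0 <= q by lra.
have e : Num.sqrt (l ^+ 2 - 1) = q by rewrite lq addrK sqrtr_sqr ger0_norm.
split=> //; last by rewrite e.
rewrite ltNge; apply/negP => l2.
have q3 : q ^+ 2 <= 3 by nra.
have : lambda_fun (Num.sqrt 3) <= lambda_fun q.
  have : q <= Num.sqrt 3 by rewrite -(ger0_norm q0) -sqrtr_sqr ler_sqrt.
  rewrite le_eqVlt => /orP[/eqP -> //|h]; apply/ltW/lambda_fun_decr => //; first exact: ltW.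
  have s0 : 0 <= Num.sqrt 3 :> R by rewrite sqrtr_ge0.
  have s2 : Num.sqrt 3 ^+ 2 = 3 :> R by rewrite sqr_sqrtr.
  by nra.
have s3 : Num.sqrt 3 < 2 + 798 / 10 ^+ 3 + 384 / 10 ^+ 6 :> R.
  have s0 : 0 <= Num.sqrt 3 :> R by rewrite sqrtr_ge0.
  have s2 : Num.sqrt 3 ^+ 2 = 3 :> R by rewrite sqr_sqrtr.
  by nra.
have := lambda_fun_decr (ltW pihalf_lt_sqrt3) s3.
have := lambda_fun_pos.
by rewrite f0 => h1 h2 h3; have : (2 + 798 / 10 ^+ 3 + 384 / 10 ^+ 6 : R) <= pi; [lra|move=> /h2; lra].
Qed.

Lemma lambda_bounds l : is_lambda l ->
  `|l - (297 / 10 ^+ 2 + 169 / 10 ^+ 5)| <= 5 / 10 ^+ 6.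
Proof.
move=> /is_lambdaP[l0 [q [q1 q2 lq lp f0]]]; have p3 := pi_gt_298.
have q0 : 0 <= q by have := pi_ge0 R; lra.
have p1 := pihalf_lt_sqrt3.
have h1 : 2 + 798 / 10 ^+ 3 + 384 / 10 ^+ 6 < q.
  rewrite ltNge; apply/negP; rewrite le_eqVlt => /orP[/eqP e|h].
    by have := lambda_fun_pos; rewrite -e f0 ltxx.
  have := lambda_fun_decr (ltW q1) h; rewrite f0; have := lambda_fun_pos; lra.
have h2 : q < 2 + 798 / 10 ^+ 3 + 387 / 10 ^+ 6.
  rewrite ltNge; apply/negP; rewrite le_eqVlt => /orP[/eqP e|h].
    by have := lambda_fun_neg; rewrite e f0 ltxx.
  have := @lambda_fun_decr (2 + 798 / 10 ^+ 3 + 387 / 10 ^+ 6) q _ h (ltW q2).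
  rewrite f0; have := lambda_fun_neg; have : pi <= 4 :> R by have := @pihalf_lt2 R; lra. lra.
rewrite ler_norml; apply/andP; split; nra.
Qed.

Lemma lambda_exists_unique : exists! l : R, is_lambda l.
Proof.
have p3 := pi_gt_298; have p4 : pi <= 4 :> R by have := @pihalf_lt2 R; lra.
have [|||q] := @IVT R lambda_fun (2 + 798 / 10 ^+ 3 + 384 / 10 ^+ 6) (2 + 798 / 10 ^+ 3 + 387 / 10 ^+ 6) 0.
- by lra.
- exact: is_derive_within (fun q _ => is_derive_lambda_fun q).
- by have := lambda_fun_neg; have := lambda_fun_pos; rewrite minEle maxEle; case: ifP; lra.
rewrite in_itv /= => /andP[q1 q2] f0.
have hl : is_lambda (Num.sqrt (q ^+ 2 + 1)).
  apply/is_lambdaP; split; first exact: sqrtr_ge0.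
  have s : 0 <= q ^+ 2 + 1 by nra.
  exists q; split; [lra|lra|by rewrite sqr_sqrtr| |by []].
  rewrite -(@ger0_norm _ pi) ?pi_ge0 // -sqrtr_sqr ltr_sqrt; nra.
exists (Num.sqrt (q ^+ 2 + 1)); split=> // l /is_lambdaP[l0 [q' [q1' q2' lq' _ f0']]].
have -> : q = q'.
  apply/eqP; rewrite eq_le !leNgt; apply/andP; split; apply/negP => h.
    have := lambda_fun_decr (ltW q1') h; rewrite f0 f0' ltxx => hh.
    by suff /hh : q <= pi by []; lra.
  have := @lambda_fun_decr q q' _ h (ltW q2').
  by rewrite f0 f0' ltxx => hh; suff /hh : pi / 2 <= q by []; lra.
by rewrite -lq' sqrtr_sqr ger0_norm.
Qed.

End Lambda.


(** * Arc length *)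

Section ArcLength.
Context {R : realType} {n : nat}.
Implicit Types (g : R -> 'rV[R]_n) (a b t u v w : R) (s : seq R).

Fixpoint chain_length g a s : R :=
  if s is x :: s' then enorm (g x - g a) + chain_length g x s' else 0.

Lemma polygon_length_chain g a b s : polygon_length a b g s = chain_length g a s.
Proof.
rewrite /polygon_length; elim: s a => [|x s IH] a /=; first by rewrite big_nil.
rewrite big_nat_recl //= -(IH x); congr (_ + _).
Qed.


Lemma chain_length_cat g a s s' :
  chain_length g a (s ++ s') = chain_length g a s + chain_length g (last a s) s'.
Proof. by elim: s a => [|x s IH] a /=; rewrite ?add0r // IH addrA. Qed.

(** Repetitions of points add nothing to the length of a polygon, which spares
the distinction between strict and weak chains in all that follows. *)
Lemma chain_length_le_arc g a b s : path <=%R a s -> last a s = b ->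
  ((chain_length g a s)%:E <= arc_length a b g)%E.
Proof.
move=> ps ls.
suff [s' [p' l' ->]] : exists s', [/\ path <%R a s', last a s' = b &
    chain_length g a s = chain_length g a s'].
  apply: ereal_sup_ubound; exists s'; last by rewrite polygon_length_chain.
  by split=> //; apply/eqP.
elim: s a ps ls => [|x s IH] a /=; first by exists [::].
move=> /andP[ax ps] ls; have [s' [p' l' e']] := IH x ps ls.
move: ax; rewrite le_eqVlt => /orP[/eqP ax|ax].
  by exists s'; rewrite ax subrr enorm0 add0r.
by exists (x :: s'); rewrite /= ax e'.
Qed.

(** A polygon whose vertices avoid the interior of [t, t'] gets no shorter when
t and t' are inserted as vertices. *)
Lemma chain_length_split g a b t t' s : path <=%R a s -> last a s = b ->
  a <= t -> t <= t' -> t' <= b -> (forall x, x \in s -> x <= t \/ t' <= x) ->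
  exists s1 s2, [/\ path <=%R a s1, last a s1 = t, path <=%R t' s2, last t' s2 = b &
    chain_length g a s <= chain_length g a s1 + enorm (g t' - g t) + chain_length g t' s2].
Proof.
elim: s a => [|x s IH] a /=.
  move=> _ <- h1 h2 h3 _; exists [::], [::].
  have e1 : a = t by apply/eqP; rewrite eq_le h1 (le_trans h2).
  have e2 : t' = a by apply/eqP; rewrite eq_le h3 (le_trans h1).
  by split=> //=; rewrite add0r addr0 enorm_ge0.
move=> /andP[ax ps] ls h1 h2 h3 hs.
have [xt|xt] := hs x (mem_head _ _).
  have [|s1 [s2 [p1 l1 p2 l2 e]]] := IH x ps ls xt h2 h3.
    by move=> y ys; apply: hs; rewrite inE ys orbT.
  by exists (x :: s1), s2; split => //=; rewrite ?ax // -!addrA lerD2l addrA.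
exists [:: t], (x :: s); split => //=; rewrite ?h1 ?xt //.
rewrite addr0 !addrA lerD2r.
have -> : g x - g a = (g t - g a) + (g t' - g t) + (g x - g t').
  by rewrite [(g t - g a) + _]addrC subrKA [RHS]addrC subrKA.
by apply: le_trans (enormD _ _) _; rewrite lerD2r enormD.
Qed.

Lemma arc_length_ge0 a b g : a <= b -> (0 <= arc_length a b g)%E.
Proof.
move=> ab; apply: le_trans (@chain_length_le_arc g a b [:: b] _ _) => //=; last by rewrite ab.
by rewrite lee_fin addr0 enorm_ge0.
Qed.

Lemma arc_length_leP a b g (l : R) :
  (forall s, path <=%R a s -> last a s = b -> chain_length g a s <= l) ->
  (arc_length a b g <= l%:E)%E.
Proof.
move=> h; apply: ge_ereal_sup => _ [s [ps /eqP ls] <-].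
rewrite lee_fin polygon_length_chain; apply: h => //.
by apply: sub_path ps => x y /ltW.
Qed.

Lemma path_le_last a s : path <=%R a s -> a <= last a s.
Proof. by elim: s a => //= x s IH a /andP[ax /IH]; exact: le_trans. Qed.

Lemma arc_length_lipschitz a b g (c : R) : a <= b ->
  (forall t t', a <= t -> t <= t' -> t' <= b -> enorm (g t' - g t) <= c * (t' - t)) ->
  (arc_length a b g <= (c * (b - a))%:E)%E.
Proof.
move=> ab h; apply: arc_length_leP => s.
suff H : forall s x, a <= x -> path <=%R x s -> last x s <= b ->
    chain_length g x s <= c * (last x s - x).
  by move=> ps ls; rewrite -ls; apply: H; rewrite ?lexx // ls.
move=> {}s; elim: s => [|y s IH] x /= ax; first by rewrite subrr mulr0.
move=> /andP[xy ps] lb.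
have ay := le_trans ax xy.
have yb : y <= b.
  exact: le_trans (path_le_last ps) lb.
have := IH y ay ps lb; have := h x y ax xy yb; lra.
Qed.

End ArcLength.


Section Rectifiable.
Context {R : realType} {n : nat}.
Variables (g : R -> 'rV[R]_n) (a b : R).
Hypothesis rect : rectifiable a b g.
Implicit Types (t u v w : R).

Definition arc_len u v : R := fine (arc_length u v g).

Lemma path_cat_le u v s s' : path <=%R u s -> last u s = v -> path <=%R v s' ->
  path <=%R u (s ++ s').
Proof. by move=> h1 h2 h3; rewrite cat_path h1 h2. Qed.

Lemma arc_length_fin u v : a <= u -> u <= v -> v <= b -> arc_length u v g = (arc_len u v)%:E.
Proof.
move=> au uv vb; rewrite /arc_len fineK // ge0_fin_numE; last exact: arc_length_ge0.
have ab : a <= b by lra.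
have : arc_length a b g \is a fin_num.
  by rewrite ge0_fin_numE //; exact: arc_length_ge0.
move=> /fineK e; apply: le_lt_trans (ltry (fine (arc_length a b g))).
apply: arc_length_leP => s ps ls.
have : ((chain_length g a (u :: s ++ [:: b]))%:E <= arc_length a b g)%E.
  apply: chain_length_le_arc; last by rewrite /= last_cat.
  by rewrite /= au cat_path ps ls /= vb.
rewrite -e lee_fin /= chain_length_cat /=.
have := enorm_ge0 (g u - g a); have := enorm_ge0 (g b - g (last u s)); lra.
Qed.

Lemma chain_le_arc_len u v s : a <= u -> v <= b -> path <=%R u s -> last u s = v ->
  chain_length g u s <= arc_len u v.
Proof.
move=> au vb ps ls; rewrite -lee_fin -arc_length_fin //; first exact: chain_length_le_arc.
by rewrite -ls; exact: path_le_last.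
Qed.

Lemma arc_len_leP u v l : a <= u -> u <= v -> v <= b ->
  (forall s, path <=%R u s -> last u s = v -> chain_length g u s <= l) -> arc_len u v <= l.
Proof. by move=> au uv vb h; rewrite -lee_fin -arc_length_fin //; exact: arc_length_leP. Qed.

Lemma arc_len_ge0 u v : a <= u -> u <= v -> v <= b -> 0 <= arc_len u v.
Proof. by move=> au uv vb; rewrite -lee_fin -arc_length_fin //; exact: arc_length_ge0. Qed.

Lemma chord_le_arc_len u v : a <= u -> u <= v -> v <= b -> enorm (g v - g u) <= arc_len u v.
Proof.
by move=> au uv vb; have := @chain_le_arc_len u v [:: v] au vb; rewrite /= addr0 uv; apply.
Qed.

Lemma arc_lenD u v w : a <= u -> u <= v -> v <= w -> w <= b ->
  arc_len u w = arc_len u v + arc_len v w.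
Proof.
move=> au uv vw wb.
have uw := le_trans uv vw; have vb := le_trans vw wb; have av := le_trans au uv.
apply/eqP; rewrite eq_le; apply/andP; split.
  apply: arc_len_leP => // s ps ls.
  have [|s1 [s2 [p1 l1 p2 l2]]] := chain_length_split g ps ls uv (lexx v) vw.
    by move=> x _; case: (leP x v) => h; [left|right; exact: ltW].
  rewrite subrr enorm0 addr0 => /le_trans; apply; apply: lerD; exact: chain_le_arc_len.
rewrite addrC -lerBrDr; apply: arc_len_leP => // s2 p2 l2.
rewrite lerBrDr addrC -lerBrDr; apply: arc_len_leP => // s1 p1 l1.
rewrite lerBrDr -[X in _ + chain_length _ X _]l1 -chain_length_cat.
apply: chain_le_arc_len => //; first exact: path_cat_le p2.
by rewrite last_cat l1.
Qed.


Lemma isolated_point (s : seq R) t : exists2 d, 0 < d & forall x, x \in s -> x != t -> d <= `|x - t|.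
Proof.
elim: s => [|x s [d d0 h]]; first by exists 1.
have [->|xt] := eqVneq x t.
  by exists d => // y; rewrite inE => /orP[/eqP ->|/h//]; rewrite eqxx.
exists (Num.min d `|x - t|); first by rewrite lt_min d0 normr_gt0 subr_eq0.
move=> y; rewrite inE => /orP[/eqP ->|/h hy] yt; rewrite ge_min ?lexx ?orbT //.
by rewrite hy.
Qed.

Hypothesis ab : a <= b.
Hypothesis cg : {within `[a, b], continuous g}.

(** Continuity of arc length: inside a cell of a polygon that is almost as long
as the curve, an arc is hardly longer than its chord. *)
Lemma arc_len_continuous t e : a <= t -> t <= b -> 0 < e ->
  exists2 d, 0 < d & forall t', a <= t' -> t' <= b -> `|t' - t| < d ->
    `|arc_len a t' - arc_len a t| < e.
Proof.
move=> at_ tb e0.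
have [s [ps ls hs]] : exists s, [/\ path <=%R a s, last a s = b & arc_len a b - e / 2 < chain_length g a s].
  apply/not_existsP => h.
  have : arc_len a b <= arc_len a b - e / 2.
    apply: arc_len_leP => // s ps ls; rewrite leNgt; apply/negP => hl; exact: h (And3 ps ls hl).
  by lra.
have [d1 d10 hd1] := isolated_point s t.
have [d2 d20 hd2] : exists2 d, 0 < d & forall t', a <= t' -> t' <= b -> `|t' - t| < d ->
    enorm (g t' - g t) < e / 2.
  have cgt : g @ within [set` `[a, b]] (nbhs t) --> g t.
    by move/subspace_continuousP : cg; apply; rewrite /= in_itv /= at_ tb. have : nbhs (g t) [set z | enorm (g t - z) < e / 2].
    by apply/nbhs_enormP; exists (e / 2); [lra|].
  move=> /cgt; rewrite /within /= => -[d /= d0 hd].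
  exists d => // t' h1 h2 h3; rewrite -enormN opprB.
  by apply: hd => //=; [rewrite distrC|rewrite in_itv /= h1 h2].
have cell u v : a <= u -> u <= v -> v <= b -> (u = t \/ v = t) -> `|v - u| < Num.min d1 d2 ->
    arc_len u v < e.
  move=> au uv vb tuv; rewrite ger0_norm ?subr_ge0 // lt_min => /andP[h1 h2].
  have [|s1 [s2 [p1 l1 p2 l2 hl]]] := chain_length_split g ps ls au uv vb.
    move=> x xs; have [->|xt] := eqVneq x t.
      by case: tuv => ->; [left|right].
    have hx := hd1 x xs xt; case: tuv => e1; rewrite e1 in uv h1 *.
      case: (leP x t) => xt'; [by left|right].
      by move: hx; rewrite ger0_norm; lra.
    case: (leP t x) => xt'; [by right|left].
    by move: hx; rewrite ler0_norm; lra.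
  have h3 : enorm (g v - g u) < e / 2.
    case: tuv => e1; rewrite e1 in au uv vb h1 h2 *.
      by apply: hd2 => //; [lra|rewrite ger0_norm; lra].
    by rewrite -enormN opprB; apply: hd2 => //; [lra|rewrite ler0_norm; lra].
  have h4 := chain_le_arc_len (lexx a) (le_trans uv vb) p1 l1.
  have h5 := chain_le_arc_len (le_trans au uv) (lexx b) p2 l2.
  have h6 := arc_lenD (lexx a) au uv vb.
  have h7 := arc_lenD (lexx a) (le_trans au uv) vb (lexx b).
  lra.
exists (Num.min d1 d2); first by rewrite lt_min d10.
move=> t' at' t'b.
have [tt'|t't] := leP t t' => h.
  rewrite (arc_lenD (lexx a) at_ tt' t'b) addrAC subrr add0r ger0_norm.
    by apply: cell => //; left.
  exact: arc_len_ge0.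
rewrite (arc_lenD (lexx a) at' (ltW t't) tb) opprD addrA subrr add0r normrN ger0_norm.
  by apply: cell => //; [exact: ltW|right|rewrite distrC].
by apply: arc_len_ge0 => //; exact: ltW.
Qed.

End Rectifiable.


(** * Comparison of increments *)

Section Increments.
Context {R : realType}.
Local Notation mu := (@lebesgue_measure R).
Implicit Types (k f : R -> R) (a b s t u v m M : R).

Definition eps_continuous a b k : Prop :=
  forall t e, a <= t -> t <= b -> 0 < e ->
  exists2 d, 0 < d & forall t', a <= t' -> t' <= b -> `|t' - t| < d -> `|k t' - k t| < e.

(** A continuous function that at every point can be continued to the right
without exceeding its value there never exceeds its initial value. *)
Lemma local_descent k a b : a <= b -> eps_continuous a b k ->
  (forall t, a <= t -> t < b -> exists t', [/\ t < t', t' <= b & k t' <= k t]) ->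
  k b <= k a.
Proof.
move=> ab ck h.
pose S := [set t | [/\ a <= t, t <= b & k t <= k a]].
have Sa : S a by split.
have hS : has_sup S by split; [exists a | exists b => t []].
have as_ : a <= sup S by apply: sup_ubound Sa; exact: hS.2.
have sb : sup S <= b by apply: sup_le_ub; [exists a|move=> t []].
have Ss : S (sup S).
  split => //; rewrite leNgt; apply/negP => ks.
  have [|d d0 hd] := ck (sup S) (k (sup S) - k a) as_ sb; first by lra.
  have [t [at_ tb kt] ht] := sup_adherent d0 hS.
  have ts : t <= sup S by apply: sup_ubound; [exact: hS.2|split].
  have := hd t at_ tb; rewrite ler0_norm ?subr_le0 // ltr_norml => /(_ _) /andP[]; lra.
move: sb; rewrite le_eqVlt => /orP[/eqP <-|sb]; first by case: Ss.
have [t' [st tb kt]] := h _ as_ sb.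
have : t' <= sup S.
  apply: sup_ubound; first exact: hS.2.
  by split=> //; [exact: le_trans as_ (ltW st)|apply: le_trans kt _; case: Ss].
by rewrite leNgt st.
Qed.

Lemma eps_continuousB a b k f : eps_continuous a b k -> eps_continuous a b f ->
  eps_continuous a b (fun t => k t - f t).
Proof.
move=> ck cf t e at_ tb e0; have e2 : 0 < e / 2 by lra.
have [d1 d10 h1] := ck t (e / 2) at_ tb e2; have [d2 d20 h2] := cf t (e / 2) at_ tb e2.
exists (Num.min d1 d2); first by rewrite lt_min d10.
move=> t' at' tb'; rewrite lt_min => /andP[/(h1 t' at' tb') q1 /(h2 t' at' tb') q2].
have -> : k t' - f t' - (k t - f t) = (k t' - k t) - (f t' - f t) by ring.
by apply: le_lt_trans (ler_normB _ _) _; lra.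
Qed.

Lemma eps_continuousZ a b k c : eps_continuous a b k -> eps_continuous a b (fun t => c * k t).
Proof.
move=> ck t e at_ tb e0; have c0 : 0 < `|c| + 1 by have := normr_ge0 c; lra.
have [|d d0 h] := ck t (e / (`|c| + 1)) at_ tb; first exact: divr_gt0.
exists d => // t' at' tb' /(h t' at' tb') q; rewrite -mulrBr normrM.
apply: le_lt_trans (_ : (`|c| + 1) * `|k t' - k t| < e).
  by rewrite ler_wpM2r //; lra.
by rewrite mulrC -ltr_pdivlMr.
Qed.

Lemma eps_continuous_within a b k : eps_continuous a b k -> {within `[a, b], continuous k}.
Proof.
move=> ck; apply/subspace_continuousP => t /=; rewrite in_itv /= => /andP[at_ tb].
apply/(@cvgrPdist_lt _ _ _ _ (within_filter _ (nbhs_filter t))) => e e0.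
have [d d0 h] := ck t e at_ tb e0.
rewrite /within /=; exists d => //= t' tt'; rewrite in_itv /= => /andP[at' tb'].
by rewrite distrC; apply: h => //; rewrite distrC.
Qed.

Definition primitive f (v : R) : R := \int[mu]_(s in `[0, v]) f s.

Lemma continuous_integrable f u v : continuous f -> mu.-integrable `[u, v] (EFin \o f).
Proof.
move=> cf; apply: continuous_compact_integrable; first exact: segment_compact.
exact: continuous_subspaceT.
Qed.

Lemma primitive_increment f u v m M : continuous f -> 0 <= u -> u <= v ->
  (forall s, u <= s -> s <= v -> m <= f s <= M) ->
  m * (v - u) <= primitive f v - primitive f u <= M * (v - u).
Proof.
move=> cf u0 uv h; rewrite /primitive.
rewrite (@Rintegral_itvB _ f (BLeft 0) (BRight v) u) ?bnd_simp //; last exact: continuous_integrable.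
have iuv : mu.-integrable `]u, v] (EFin \o f).
  apply: integrableS (continuous_integrable u v cf) => //.
  by move=> s /=; rewrite !in_itv /= => /andP[/ltW -> ->].
have icst c : mu.-integrable `]u, v] (EFin \o (fun=> c)).
  have ic : mu.-integrable `[u, v] (EFin \o (fun=> c)).
    by apply: continuous_integrable => s; exact: cvg_cst.
  apply: integrableS ic => //.
  by move=> s /=; rewrite !in_itv /= => /andP[/ltW -> ->].
have e c : \int[mu]_(s in `]u, v]) c = c * (v - u).
  rewrite Rintegral_cst; last exact: measurable_itv.
  congr (_ * _); rewrite /= lebesgue_measure_itv /= lte_fin.
  by case: ltP => // vu; rewrite /=; lra.
rewrite -!e; apply/andP; split; apply: le_Rintegral => // s /=; rewrite in_itv /= => /andP[us sv];
  by have /andP[] := h s (ltW us) sv.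
Qed.

End Increments.


(** * Quasihyperbolic length of curves that avoid the origin *)

Section PuncturedCurve.
Context {R : realType} {n : nat}.
Variables (g : R -> 'rV[R]_n) (a b : R).
Hypothesis n_gt0 : (0 < n)%N.
Hypothesis ab : a <= b.
Hypothesis rect : rectifiable a b g.
Hypothesis cg : {within `[a, b], continuous g}.
Hypothesis g_neq0 : forall t, a <= t -> t <= b -> g t != 0.
Implicit Types (s t u v : R).

Let len t := arc_len g a t.

Let lenD t t' : a <= t -> t <= t' -> t' <= b -> len t' - len t = arc_len g t t'.
Proof. by move=> h1 h2 h3; rewrite /len (arc_lenD rect (lexx a) h1 h2 h3) addrC addKr. Qed.

Let len_le t t' : a <= t -> t <= t' -> t' <= b -> len t <= len t'.
Proof. by move=> h1 h2 h3; rewrite -subr_ge0 lenD // (arc_len_ge0 rect). Qed.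

Let chord_le t t' : a <= t -> t <= t' -> t' <= b -> enorm (g t' - g t) <= len t' - len t.
Proof. by move=> h1 h2 h3; rewrite lenD //; exact: (chord_le_arc_len rect h1 h2 h3). Qed.

Let len_a : len a = 0.
Proof. by have := lenD (lexx a) (lexx a) ab; rewrite subrr. Qed.

Let len_cont : eps_continuous a b len.
Proof. by move=> t e at_ tb e0; exact: (arc_len_continuous rect ab cg at_ tb e0). Qed.

Let chord_abs t t' : a <= t -> t <= b -> a <= t' -> t' <= b ->
  enorm (g t' - g t) <= `|len t' - len t|.
Proof.
move=> h1 h2 h3 h4; have [h|/ltW h] := leP t t'.
  by apply: le_trans (ler_norm _); exact: chord_le.
by rewrite -enormN opprB distrC; apply: le_trans (ler_norm _); exact: chord_le.
Qed.

(** All parameters at which the arc from g a has the same length give the same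
point, since a chord is no longer than its arc. *)
Lemma arc_param_len t : a <= t -> t <= b -> arc_param a b g (len t) = g t.
Proof.
move=> at_ tb; rewrite /arc_param; case: xgetP => [t' _ [/= tt' e]|/(_ t) []].
  move: tt'; rewrite in_itv /= => /andP[at' tb'].
  have := chord_abs at_ tb at' tb'.
  have -> : len t' = len t by rewrite {1}/len /arc_len e.
  rewrite subrr normr0 => h; have : enorm (g t' - g t) == 0.
    by rewrite eq_le h enorm_ge0.
  by rewrite enorm_eq0 subr_eq0 => /eqP.
by split; [rewrite in_itv /= at_ tb|exact: (arc_length_fin rect (lexx a) at_ tb)].
Qed.

Lemma arc_len_surj s : 0 <= s -> s <= len b -> exists t, [/\ a <= t, t <= b & len t = s].
Proof.
move=> s0 sL; have [|t] := @IVT R len a b s ab (eps_continuous_within len_cont).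
  have L0 : 0 <= len b by exact: le_trans s0 sL.
  by rewrite len_a min_l // max_r // s0 sL.
by rewrite in_itv /= => /andP[h1 h2] h3; exists t.
Qed.

Let clamp s := Num.max 0 (Num.min s (len b)).

Let len_b0 : 0 <= len b. Proof. by rewrite -len_a; apply: len_le. Qed.

Let clampP s : 0 <= clamp s /\ clamp s <= len b.
Proof. by rewrite /clamp le_max lexx ge_max len_b0 ge_min lexx orbT. Qed.

Let clamp_id s : 0 <= s -> s <= len b -> clamp s = s.
Proof. by move=> h1 h2; rewrite /clamp min_l // max_r. Qed.

Let clamp_lip s s' : `|clamp s - clamp s'| <= `|s - s'|.
Proof.
have h := len_b0; rewrite /clamp.
have h1 := ler_norm (s - s'); have h2 := ler_norm (s' - s); rewrite distrC in h2.
case: (leP s (len b)) => ?; case: (leP s' (len b)) => ?; rewrite ?(max_r h);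
  case: (leP 0 s) => ?; case: (leP 0 s') => ?; rewrite ler_norml; apply/andP; split; lra.
Qed.

(** The distance from the origin in the arc length parametrization, continued by
constants to the whole line. *)
Definition speed_radius s := enorm (arc_param a b g (clamp s)).

Lemma speed_radius_len t : a <= t -> t <= b -> speed_radius (len t) = enorm (g t).
Proof.
move=> at_ tb; rewrite /speed_radius clamp_id ?arc_param_len //; last exact: len_le.
by rewrite -len_a; exact: len_le.
Qed.

Lemma speed_radius_gt0 s : 0 < speed_radius s.
Proof.
have [h1 h2] := clampP s; have [t [at_ tb e]] := arc_len_surj h1 h2.
by rewrite /speed_radius -e arc_param_len // enorm_gt0 g_neq0.
Qed.

Lemma continuous_speed_radius : continuous speed_radius.
Proof.
have lip s s' : `|speed_radius s - speed_radius s'| <= `|s - s'|.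
  apply: le_trans (clamp_lip _ _).
  have [h1 h2] := clampP s; have [t [at_ tb e]] := arc_len_surj h1 h2.
  have [h1' h2'] := clampP s'; have [t' [at' tb' e']] := arc_len_surj h1' h2'.
  rewrite /speed_radius -e -e' !arc_param_len //.
  by apply: le_trans (enorm_lipschitz _ _) _; exact: chord_abs.
move=> s; apply/(@cvgrPdist_lt _ _ _ _ (nbhs_filter s)) => e e0.
by exists e => //= s' h; exact: le_lt_trans (lip _ _) h.
Qed.

Let density s := (speed_radius s)^-1.

Let continuous_density : continuous density.
Proof. by move=> s; apply: cvgV; [rewrite gt_eqF ?speed_radius_gt0|exact: continuous_speed_radius]. Qed.

(** The quasihyperbolic length of the arc from g a to g t, by qh_length_qh_len. *)
Definition qh_len t : R := primitive density (len t).

Lemma qh_length_qh_len : qh_length (~` [set 0]) a b g = (qh_len b)%:E.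
Proof.
rewrite /qh_length /curve_integral /qh_len /primitive /Rintegral fineK; last first.
  apply: integrable_fin_num => //; exact: continuous_integrable.
apply: eq_integral => s; rewrite inE /= in_itv /= => /andP[s0 sL].
by rewrite bdist_punctured // /density /speed_radius clamp_id.
Qed.

Lemma qh_len_a : qh_len a = 0.
Proof.
rewrite /qh_len len_a /primitive.
by have -> : `[0, 0]%classic = [set 0 : R]; [exact: set_itv1|rewrite Rintegral_set1].
Qed.

(** On an arc along which the distance from the origin lies between m and M, the
quasihyperbolic length is between 1/M and 1/m times the Euclidean length. *)
Lemma qh_len_increment t t' m M : a <= t -> t <= t' -> t' <= b -> 0 < m ->
  (forall v, t <= v -> v <= t' -> m <= enorm (g v) <= M) ->
  M^-1 * arc_len g t t' <= qh_len t' - qh_len t <= m^-1 * arc_len g t t'.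
Proof.
move=> h1 h2 h3 m0 h; rewrite -lenD //; apply: primitive_increment => //.
- by rewrite -len_a; apply: len_le => //; exact: le_trans h3.
- exact: len_le.
move=> s us sv; have [|v [av vb e]] := @arc_len_surj s _ (le_trans sv (len_le (le_trans h1 h2) h3 (lexx b))).
  by apply: le_trans us; rewrite -len_a; apply: len_le => //; exact: le_trans h3.
have [w [tw wt' ew]] : exists w, [/\ t <= w, w <= t' & len w = s].
  have [tv|vt] := leP t v; last first.
    exists t; split=> //; apply/eqP; rewrite eq_le us -e len_le ?(ltW vt) //; exact: le_trans h3.
  have [vt'|tv'] := leP v t'; first by exists v.
  exists t'; split=> //; apply/eqP; rewrite eq_le sv -e len_le ?(ltW tv') //; exact: le_trans h2.
have /andP[q1 q2] := h w tw wt'.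
have N0 : 0 < enorm (g w) by exact: lt_le_trans q1.
rewrite /density -ew speed_radius_len ?(le_trans h1 tw) ?(le_trans wt') //.
by rewrite !lef_pV2 ?posrE ?q1 ?q2 // (lt_le_trans N0 q2).
Qed.

Lemma qh_len_continuous : eps_continuous a b qh_len.
Proof.
have [c _ hc] := @EVT_max R density 0 (len b) len_b0 (continuous_subspaceT continuous_density).
have c0 : 0 < density c by rewrite invr_gt0 speed_radius_gt0.
have inc t t' : a <= t -> t <= t' -> t' <= b -> `|qh_len t' - qh_len t| <= density c * (len t' - len t).
  move=> h1 h2 h3; have l1 : 0 <= len t by rewrite -len_a; apply: len_le => //; exact: le_trans h3.
  have l3 : len t' <= len b by apply: len_le => //; exact: le_trans h2.
  have := @primitive_increment R density (len t) (len t') 0 (density c) continuous_density l1 (len_le h1 h2 h3).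
  rewrite mul0r -/(qh_len t) -/(qh_len t') => /(_ _)/andP[s us sv|q1 q2]; last by rewrite ger0_norm.
  rewrite invr_ge0 ltW ?speed_radius_gt0 //=; apply: hc.
  by rewrite in_itv /= (le_trans l1 us) (le_trans sv).
move=> t e at_ tb e0.
have [|d d0 hd] := len_cont at_ tb (_ : 0 < e / density c); first exact: divr_gt0.
exists d => // t' at' tb' /(hd t' at' tb') q.
apply: (@le_lt_trans _ _ (density c * `|len t' - len t|)); last by rewrite mulrC -ltr_pdivlMr.
have [h|/ltW h] := leP t t'; first by rewrite [X in _ <= _ * X]ger0_norm ?subr_ge0 ?len_le // inc.
by rewrite distrC [X in _ <= _ * X]distrC [X in _ <= _ * X]ger0_norm ?subr_ge0 ?len_le // inc.
Qed.

End PuncturedCurve.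


Lemma le_of_le_square_factor {R : realType} (x y : R) :
  (forall e, 0 < e -> x <= (1 + e) ^+ 2 * y) -> x <= y.
Proof.
move=> h; rewrite leNgt; apply/negP => yx.
have [y0|y0] := leP y 0; first by have := h 1 ltr01; lra.
pose e := Num.min 1 ((x - y) / (6 * y)).
have e0 : 0 < e by rewrite lt_min ltr01 divr_gt0 //; lra.
have e1 : e <= 1 by rewrite ge_min lexx.
have : e <= (x - y) / (6 * y) by rewrite ge_min lexx orbT.
rewrite ler_pdivlMr; last by lra.
have := h e e0.
have : e * e * y <= e * y by rewrite ler_pM2r // ler_piMr // ltW.
lra.
Qed.

Lemma increment_ge_arith {R : realType} (H N A E Q e : R) : 0 < N -> 0 < e ->
  H * N <= (1 + e) * E -> E <= A -> ((1 + e) * N)^-1 * A <= Q -> H <= (1 + e) ^+ 2 * Q.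
Proof.
move=> N0 e0 h1 h2; have e1 : 0 < 1 + e by lra.
rewrite ler_pdivrMl ?mulr_gt0 // => h3.
rewrite -(ler_pM2r N0); apply: le_trans h1 _.
have -> : (1 + e) ^+ 2 * Q * N = (1 + e) * ((1 + e) * N * Q) by ring.
by rewrite ler_pM2l // (le_trans h2).
Qed.

Lemma increment_le_arith {R : realType} (k N A Q T e : R) : 0 < N -> 0 < e ->
  Q <= (N / (1 + e))^-1 * A -> A <= (1 + e) * k * N * T -> Q <= (1 + e) ^+ 2 * k * T.
Proof.
move=> N0 e0 h1 h2; have e1 : 0 < 1 + e by lra.
apply: le_trans h1 _; rewrite invf_div mulrAC ler_pdivrMr //.
have -> : (1 + e) ^+ 2 * k * T * N = (1 + e) * ((1 + e) * k * N * T) by ring.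
by rewrite ler_pM2l.
Qed.

Section QhLength.
Context {R : realType} {n : nat}.
Variables (g : R -> 'rV[R]_n) (a b : R).
Hypothesis ab : a <= b.
Hypothesis rect : rectifiable a b g.
Hypothesis cg : {within `[a, b], continuous g}.
Hypothesis g_neq0 : forall t, a <= t -> t <= b -> g t != 0.
Implicit Types (s t u v e : R).

Let ratio_near t e : a <= t -> t <= b -> 0 < e ->
  exists2 d, 0 < d & forall t', a <= t' -> t' <= b -> `|t' - t| < d ->
    enorm (g t) / (1 + e) <= enorm (g t') <= (1 + e) * enorm (g t).
Proof.
move=> at_ tb e0.
have N0 : 0 < enorm (g t) by rewrite enorm_gt0 g_neq0.
have cgt : g @ within [set` `[a, b]] (nbhs t) --> g t.
  by move/subspace_continuousP : cg; apply; rewrite /= in_itv /= at_ tb.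
pose m := enorm (g t) / (1 + e).
have e1 : 0 < 1 + e by lra.
have m0 : 0 < m by exact: divr_gt0.
have mE : m * (1 + e) = enorm (g t) by rewrite divfK ?gt_eqF.
have : nbhs (g t) [set z | enorm (g t - z) < e * m].
  by apply/nbhs_enormP; exists (e * m); [exact: mulr_gt0|].
move=> /cgt; rewrite /within /= => -[d /= d0 hd].
exists d => // t' h1 h2 h3; rewrite -/m.
have : enorm (g t - g t') < e * m.
  by apply: hd => //=; [rewrite distrC|rewrite in_itv /= h1 h2].
have := enorm_lipschitz (g t) (g t'); rewrite ler_norml => /andP[q1 q2] q3.
have q4 : 0 < e * m * e by exact: (mulr_gt0 (mulr_gt0 e0 m0) e0).
have q5 : e * (m * (1 + e)) = e * enorm (g t) by rewrite mE.
move: q1 q2 q3 q4 q5 mE; clear.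
by move: m (enorm (g t')) (enorm (g t - _)) (enorm (g t)) => m N' r N; move=> *; apply/andP; split; lra.
Qed.

(* All that matters about the quasihyperbolic length of the arc from g a to g t is
   that it starts at 0, is continuous and has increments comparable to those of
   the Euclidean length. *)
Variable qh : R -> R.
Hypothesis qh_a : qh a = 0.
Hypothesis qh_cont : eps_continuous a b qh.
Hypothesis qh_inc : forall t t' m M, a <= t -> t <= t' -> t' <= b -> 0 < m ->
  (forall v, t <= v -> v <= t' -> m <= enorm (g v) <= M) ->
  M^-1 * arc_len g t t' <= qh t' - qh t <= m^-1 * arc_len g t t'.

(** A function bounds the quasihyperbolic length from below as soon as its
increments do so infinitesimally: over a short arc from g t the quasihyperbolic
length is almost the Euclidean length divided by |g t|, and local_descent turns
the local comparison into a global one. *)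
Lemma qh_ge_of_increments (h : R -> R) : eps_continuous a b h ->
  (forall t e, a <= t -> t < b -> 0 < e -> exists2 d, 0 < d &
    forall t', t < t' -> t' <= b -> t' - t < d ->
      (h t' - h t) * enorm (g t) <= (1 + e) * enorm (g t' - g t)) ->
  h b - h a <= qh b.
Proof.
move=> ch hh.
have main e : 0 < e -> h b - h a <= (1 + e) ^+ 2 * qh b.
  move=> e0.
  suff : h b - (1 + e) ^+ 2 * qh b <= h a - (1 + e) ^+ 2 * qh a.
    by rewrite qh_a mulr0; lra.
  apply: (@local_descent _ (fun t => h t - (1 + e) ^+ 2 * qh t) a b ab).
    by apply: eps_continuousB => //; apply: eps_continuousZ; exact: qh_cont.
  move=> t at_ tb; have [d1 d10 h1] := ratio_near at_ (ltW tb) e0.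
  have [d2 d20 h2] := hh t e at_ tb e0.
have [t' [tt' t'b td1 td2]] : exists t', [/\ t < t', t' <= b, t' - t < d1 & t' - t < d2].
    have : 0 < Num.min (Num.min d1 d2) (b - t) by rewrite !lt_min d10 d20 subr_gt0 tb.
    move=> d0; exists (t + Num.min (Num.min d1 d2) (b - t) / 2).
    have : [/\ Num.min (Num.min d1 d2) (b - t) <= d1, Num.min (Num.min d1 d2) (b - t) <= d2 &
        Num.min (Num.min d1 d2) (b - t) <= b - t].
      by rewrite !ge_min !lexx !orbT.
    by move: (Num.min _ _) d0 => d d0 [? ? ?]; split; lra.
  have N0 : 0 < enorm (g t) by rewrite enorm_gt0 (g_neq0 at_ (ltW tb)).
  have hN v : t <= v -> v <= t' -> enorm (g t) / (1 + e) <= enorm (g v) <= (1 + e) * enorm (g t).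
    move=> tv vt; apply: h1; [exact: le_trans tv|exact: le_trans vt t'b|].
    rewrite ger0_norm ?subr_ge0 //; apply: le_lt_trans td1; lra.
  have e1 : 0 < 1 + e by lra.
  have /andP[q1 q2] := qh_inc at_ (ltW tt') t'b (divr_gt0 N0 e1) hN.
  have q3 := chord_le_arc_len rect at_ (ltW tt') t'b.
  have := increment_ge_arith N0 e0 (h2 t' tt' t'b td2) q3 q1.
  by exists t'; split=> //; lra.
exact: le_of_le_square_factor.
Qed.

Lemma qh_le_of_increments (k : R) : 0 <= k ->
  (forall t e, a <= t -> t < b -> 0 < e -> exists2 d, 0 < d &
    forall t', t < t' -> t' <= b -> t' - t < d ->
      arc_len g t t' <= (1 + e) * k * enorm (g t) * (t' - t)) ->
  qh b <= k * (b - a).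
Proof.
move=> k0 hh.
have main e : 0 < e -> qh b <= (1 + e) ^+ 2 * (k * (b - a)).
  move=> e0.
  suff : qh b - (1 + e) ^+ 2 * k * b <= qh a - (1 + e) ^+ 2 * k * a.
    by rewrite qh_a; lra.
  apply: (@local_descent _ (fun t => qh t - (1 + e) ^+ 2 * k * t) a b ab).
    apply: eps_continuousB; first exact: qh_cont.
    by apply: eps_continuousZ => t d _ _ d0; exists d.
  move=> t at_ tb; have [d1 d10 h1] := ratio_near at_ (ltW tb) e0.
  have [d2 d20 h2] := hh t e at_ tb e0.
  have [t' [tt' t'b td1 td2]] : exists t', [/\ t < t', t' <= b, t' - t < d1 & t' - t < d2].
    have : 0 < Num.min (Num.min d1 d2) (b - t) by rewrite !lt_min d10 d20 subr_gt0 tb.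
    move=> d0; exists (t + Num.min (Num.min d1 d2) (b - t) / 2).
    have : [/\ Num.min (Num.min d1 d2) (b - t) <= d1, Num.min (Num.min d1 d2) (b - t) <= d2 &
        Num.min (Num.min d1 d2) (b - t) <= b - t].
      by rewrite !ge_min !lexx !orbT.
    by move: (Num.min _ _) d0 => d d0 [? ? ?]; split; lra.
  have N0 : 0 < enorm (g t) by rewrite enorm_gt0 (g_neq0 at_ (ltW tb)).
  have hN v : t <= v -> v <= t' -> enorm (g t) / (1 + e) <= enorm (g v) <= (1 + e) * enorm (g t).
    move=> tv vt; apply: h1; [exact: le_trans tv|exact: le_trans vt t'b|].
    rewrite ger0_norm ?subr_ge0 //; apply: le_lt_trans td1; lra.
  have e1 : 0 < 1 + e by lra.
  have /andP[q1 q2] := qh_inc at_ (ltW tt') t'b (divr_gt0 N0 e1) hN.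
  have := increment_le_arith N0 e0 q2 (h2 t' tt' t'b td2).
  by exists t'; split=> //; lra.
exact: le_of_le_square_factor.
Qed.

End QhLength.


Section QhBounds.
Context {R : realType} {n : nat}.
Variables (g : R -> 'rV[R]_n) (a b : R).
Hypothesis n_gt0 : (0 < n)%N.
Hypothesis ab : a <= b.
Hypothesis rect : rectifiable a b g.
Hypothesis cg : {within `[a, b], continuous g}.
Hypothesis g_neq0 : forall t, a <= t -> t <= b -> g t != 0.

Lemma qh_length_ge (h : R -> R) : eps_continuous a b h ->
  (forall t e, a <= t -> t < b -> 0 < e -> exists2 d, 0 < d &
    forall t', t < t' -> t' <= b -> t' - t < d ->
      (h t' - h t) * enorm (g t) <= (1 + e) * enorm (g t' - g t)) ->
  ((h b - h a)%:E <= qh_length (~` [set 0%R]) a b g)%E.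
Proof.
move=> ch hh; rewrite (qh_length_qh_len n_gt0 ab rect cg g_neq0) lee_fin.
apply: (qh_ge_of_increments ab rect cg g_neq0 _ _ _ ch hh).
- exact: qh_len_a ab rect.
- exact: (qh_len_continuous ab rect cg g_neq0).
- exact: (qh_len_increment ab rect cg g_neq0).
Qed.

Lemma qh_length_le (k : R) : 0 <= k ->
  (forall t e, a <= t -> t < b -> 0 < e -> exists2 d, 0 < d &
    forall t', t < t' -> t' <= b -> t' - t < d ->
      arc_len g t t' <= (1 + e) * k * enorm (g t) * (t' - t)) ->
  (qh_length (~` [set 0%R]) a b g <= (k * (b - a))%:E)%E.
Proof.
move=> k0 hh; rewrite (qh_length_qh_len n_gt0 ab rect cg g_neq0) lee_fin.
apply: (qh_le_of_increments ab cg g_neq0 _ _ _ k0 hh).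
- exact: qh_len_a ab rect.
- exact: (qh_len_continuous ab rect cg g_neq0).
- exact: (qh_len_increment ab rect cg g_neq0).
Qed.

End QhBounds.

(** * Logarithmic polar coordinates *)

Section Angle.
Context {R : realType} {n : nat}.
Implicit Types (x y z p q : 'rV[R]_n).

Definition angle x y : R := acos (dot x y / (enorm x * enorm y)).

Lemma cos_ratio_bound x y : -1 <= dot x y / (enorm x * enorm y) <= 1.
Proof.
have [->|x0] := eqVneq x 0; first by rewrite enorm0 mul0r invr0 mulr0; lra.
have [->|y0] := eqVneq y 0; first by rewrite enorm0 mulr0 invr0 mulr0; lra.
have p : 0 < enorm x * enorm y by rewrite mulr_gt0 ?enorm_gt0.
have h2 := cauchy_schwarz x y; have h1 := cauchy_schwarz (- x) y.
by rewrite ler_pdivrMr // mul1r h2 ler_pdivlMr // mulN1r lerNl -dotNl -(enormN x) h1.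
Qed.

Lemma angle_ge0 x y : 0 <= angle x y.
Proof. by apply: acos_ge0; exact: cos_ratio_bound. Qed.

Lemma angle_le_pi x y : angle x y <= pi.
Proof. by apply: acos_lepi; exact: cos_ratio_bound. Qed.

Lemma cos_angle x y : x != 0 -> y != 0 -> enorm x * enorm y * cos (angle x y) = dot x y.
Proof.
move=> x0 y0; rewrite /angle acosK; last by rewrite in_itv /=; exact: cos_ratio_bound.
by rewrite mulrC divfK // mulf_neq0 ?enorm_eq0.
Qed.

Lemma sin_angle_ge0 x y : 0 <= sin (angle x y).
Proof. by apply: sin_ge0_pi; rewrite angle_ge0 angle_le_pi. Qed.

Lemma angle_unique x y t : x != 0 -> y != 0 -> 0 <= t -> t <= pi ->
  dot x y = enorm x * enorm y * cos t -> angle x y = t.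
Proof.
move=> x0 y0 t0 t1 e; rewrite /angle e mulrC mulKf ?mulf_neq0 ?enorm_eq0 //.
by rewrite cosK // in_itv /= t0 t1.
Qed.


(** The spherical triangle inequality, in the form in which it follows from the
Cauchy-Schwarz inequality for the components orthogonal to y. *)
Lemma dot_le_cos_angleB y p q : y != 0 -> p != 0 -> q != 0 ->
  dot p q <= enorm p * enorm q * cos (angle y q - angle y p).
Proof.
move=> y0 p0 q0.
have N0 : 0 < enorm y by rewrite enorm_gt0.
have hp := cos_angle y0 p0; have hq := cos_angle y0 q0.
pose orth x := x - (dot x y / enorm y ^+ 2) *: y.
have orthE u v : dot (orth u) (orth v) = dot u v - dot u y * dot v y / enorm y ^+ 2.
  rewrite /orth !(dotDl, dotDr, dotNl, dotNr, dotZl, dotZr) -!sqr_enorm (dotC y v).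
  by field; rewrite gt_eqF.
have norm_orth x : x != 0 -> enorm (orth x) = enorm x * sin (angle y x).
  move=> x0; have hx := cos_angle y0 x0.
  apply/eqP; rewrite -(@eqrXn2 _ 2) ?enorm_ge0 ?mulr_ge0 ?enorm_ge0 ?sin_angle_ge0 //.
  rewrite sqr_enorm orthE -sqr_enorm (dotC x y) -hx exprMn sin2cos2; apply/eqP.
  by field; rewrite gt_eqF.
have := cauchy_schwarz (orth p) (orth q); rewrite !norm_orth // orthE.
rewrite (dotC p y) (dotC q y) -hp -hq cosB => h.
have e : enorm y * enorm p * cos (angle y p) * (enorm y * enorm q * cos (angle y q)) / enorm y ^+ 2
    = enorm p * enorm q * (cos (angle y p) * cos (angle y q)) by field; rewrite gt_eqF.
by rewrite e in h; lra.
Qed.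

End Angle.


Section LogPolar.
Context {R : realType} {n : nat}.
Implicit Types (x y z p q : 'rV[R]_n) (e m : R).

Lemma ln_increment_le (u v m : R) : 0 < m -> m <= u -> m <= v -> m * `|ln v - ln u| <= `|v - u|.
Proof.
move=> m0; wlog uv : u v / u <= v => [H|] mu mv.
  have [uv|/ltW vu] := leP u v; first exact: H.
  by rewrite distrC [leRHS]distrC; exact: H.
have u0 : 0 < u by exact: lt_le_trans mu.
have v0 : 0 < v by exact: lt_le_trans mv.
rewrite !ger0_norm ?subr_ge0 ?ler_ln ?posrE //.
rewrite -ln_div ?posrE //.
have -> : v / u = 1 + (v - u) / u by field; rewrite gt_eqF.
apply: (@le_trans _ _ (u * ((v - u) / u))); last by rewrite mulrC divfK // gt_eqF.
have h0 : 0 <= (v - u) / u by rewrite divr_ge0 ?subr_ge0 // ltW.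
apply: ler_pM => //; first exact: ltW.
  by apply: ln_ge0; lra.
by apply: le_ln1Dx; lra.
Qed.

Lemma cos_upper (x : R) : cos x <= 1 - x ^+ 2 / 2 + x ^+ 4 / 24.
Proof.
wlog x0 : x / 0 <= x => [H|].
  have [/H//|/ltW x0] := leP 0 x.
  by have := H (- x); rewrite cosN oppr_ge0 x0 sqrrN (_ : (- x) ^+ 4 = x ^+ 4); [apply|ring].
have [h _] := @taylor_bounds R 2 x x0.
by move: h; rewrite /cos_poly /taylor_coeff /double /= !expr0; lra.
Qed.

(** In the coordinates (log |z|, angle with y) the Euclidean metric divided by
the distance to the origin is to first order at least the flat metric. *)
Lemma log_polar_estimate y p q m : y != 0 -> 0 < m -> m <= enorm p -> m <= enorm q ->
  m ^+ 2 * ((ln (enorm q) - ln (enorm p)) ^+ 2 +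
    (angle y q - angle y p) ^+ 2 * (1 - (angle y q - angle y p) ^+ 2 / 12)) <= enorm (q - p) ^+ 2.
Proof.
move=> y0 m0 mp mq.
have p0 : p != 0 by rewrite -enorm_gt0 (lt_le_trans m0).
have q0 : q != 0 by rewrite -enorm_gt0 (lt_le_trans m0).
have h1 := dot_le_cos_angleB y0 p0 q0.
have h2 := ln_increment_le m0 mp mq.
have h3 := cos_upper (angle y q - angle y p).
have -> : enorm (q - p) ^+ 2 = (enorm q - enorm p) ^+ 2 + 2 * (enorm p * enorm q - dot p q).
  rewrite sqr_enorm !(dotDl, dotDr, dotNl, dotNr) -!sqr_enorm (dotC q p); ring.
move: h1 h2 h3 mp mq; move: (angle y q - angle y p) (ln _ - ln _) => t l.
move: (enorm p) (enorm q) (dot p q) => P Q D; clear -m0.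
move=> h1 h2 h3 mp mq; have c1 : cos t <= 1 by exact: cos_le1.
have h4 : (m * l) ^+ 2 <= (Q - P) ^+ 2.
  by rewrite -(real_normK (num_real (m * l))) -(real_normK (num_real (Q - P))) normrM (gtr0_norm m0) lerXn2r ?nnegrE ?mulr_ge0 // ltW.
have h5 : m ^+ 2 * (1 - cos t) <= P * Q * (1 - cos t).
  by rewrite ler_wpM2r ?subr_ge0 // expr2 ler_pM // ltW.
have h6 : m ^+ 2 * (t ^+ 2 * (1 - t ^+ 2 / 12)) <= m ^+ 2 * (2 * (1 - cos t)).
  rewrite ler_pM2l ?exprn_gt0 //.
  have -> : t ^+ 2 * (1 - t ^+ 2 / 12) = t ^+ 2 - t ^+ 4 / 12 by field.
  by lra.
by move: h4 h5 h6; rewrite exprMn; lra.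
Qed.

(* By cos_upper, 1 - cos t is then at least a positive multiple of t^2 for all t
   in [-pi, pi], which covers all differences of angles. *)
Lemma sqr_pi_lt12 : pi ^+ 2 < 12 :> R.
Proof.
have h := @pihalf_lt_sqrt3 R; have p0 := pi_gt0 R.
have s2 : Num.sqrt 3 ^+ 2 = 3 :> R by rewrite sqr_sqrtr.
have s0 := sqrtr_ge0 (3 : R).
by nra.
Qed.

(** The linear functions of the coordinates (log |z|, angle with y). For unit
vectors (al, be) they have slope at most 1 in the quasihyperbolic metric, and the
right choice of (al, be) attains the distance between two given points. *)
Definition calibration (y : 'rV[R]_n) (al be : R) z : R := al * ln (enorm z) + be * angle y z.

Lemma calibration_local y p al be e : y != 0 -> p != 0 -> al ^+ 2 + be ^+ 2 <= 1 -> 0 < e ->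
  exists2 d, 0 < d & forall q, enorm (q - p) < d ->
    (calibration y al be q - calibration y al be p) * enorm p <= (1 + e) * enorm (q - p).
Proof.
move=> y0 p0 ab e0.
have N0 : 0 < enorm p by rewrite enorm_gt0.
pose s := Num.sqrt (1 + e).
have s0 : 0 < s by rewrite sqrtr_gt0; lra.
have s2 : s ^+ 2 = 1 + e by rewrite sqr_sqrtr //; lra.
have s1 : 1 < s by nra.
pose m := enorm p / s.
have m0 : 0 < m by rewrite divr_gt0.
have ms : m * s = enorm p by rewrite divfK ?gt_eqF.
have mN : m < enorm p by rewrite -ms ltr_pMr.
pose c := 1 - pi ^+ 2 / 12 : R.
have c0 : 0 < c by have := sqr_pi_lt12; rewrite /c; lra.
pose eta := e / (1 + e).
have eta0 : 0 < eta by rewrite divr_gt0 //; lra.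
pose r := Num.sqrt (12 * eta * (m ^+ 2 * c)).
have mc0 : 0 < m ^+ 2 * c := mulr_gt0 (exprn_gt0 2 m0) c0.
have emc0 : 0 < 12 * eta * (m ^+ 2 * c) by apply: mulr_gt0 mc0; lra.
have r0 : 0 < r by rewrite sqrtr_gt0.
have r2 : r ^+ 2 = 12 * eta * (m ^+ 2 * c) by rewrite sqr_sqrtr // ltW.
exists (Num.min (enorm p - m) r); first by rewrite lt_min subr_gt0 mN r0.
move=> q; rewrite lt_min => /andP[d1 d2].
have mq : m <= enorm q.
  by have := enorm_lipschitz p q; rewrite (enormB p q) ler_norml => /andP[]; lra.
have key := log_polar_estimate y0 m0 (ltW mN) mq.
have dth : (angle y q - angle y p) ^+ 2 <= pi ^+ 2.
  have := angle_ge0 y q; have := angle_ge0 y p; have := angle_le_pi y q; have := angle_le_pi y p.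
  by nra.
rewrite /calibration.
have -> : al * ln (enorm q) + be * angle y q - (al * ln (enorm p) + be * angle y p) =
  al * (ln (enorm q) - ln (enorm p)) + be * (angle y q - angle y p) by ring.
move: key dth d2; move: (angle y q - angle y p) (ln _ - ln _) (enorm_ge0 (q - p)) => t l.
rewrite -ms; move: (enorm (q - p)) => E E0 key dth d2.
have E2 : E ^+ 2 <= r ^+ 2 by apply: lerXn2r; rewrite ?nnegrE //; exact: ltW.
have hc : c <= 1 - t ^+ 2 / 12 by rewrite /c; lra.
have t12 : t ^+ 2 <= 12 * eta.
  rewrite -(ler_pM2r mc0).
  rewrite -r2; apply: le_trans E2; apply: le_trans key.
  have -> : t ^+ 2 * (m ^+ 2 * c) = m ^+ 2 * (0 + t ^+ 2 * c) by ring.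
  rewrite ler_pM2l ?exprn_gt0 // lerD ?sqr_ge0 //.
  by rewrite ler_wpM2l ?sqr_ge0.
have he : (1 + e)^-1 <= 1 - t ^+ 2 / 12.
  have -> : (1 + e)^-1 = 1 - eta by rewrite /eta; field; lra.
  by lra.
have f1 : m ^+ 2 * (l ^+ 2 + t ^+ 2) <= (1 + e) * E ^+ 2.
  rewrite -ler_pdivrMl; last by lra.
  apply: le_trans key; rewrite mulrCA ler_pM2l ?exprn_gt0 // mulrDr lerD //.
    by rewrite ler_piMl ?sqr_ge0 // invf_le1; lra.
  by rewrite mulrC ler_wpM2l ?sqr_ge0.
have f2 : (al * l + be * t) ^+ 2 <= l ^+ 2 + t ^+ 2.
  have := sqr_ge0 (al * t - be * l).
  have : (al ^+ 2 + be ^+ 2) * (l ^+ 2 + t ^+ 2) <= l ^+ 2 + t ^+ 2.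
    by rewrite ler_piMl // addr_ge0 ?sqr_ge0.
  by nra.
apply: le_trans (ler_norm _) _.
have es : 0 <= (1 + e) * E by rewrite mulr_ge0 //; lra.
rewrite -(@ler_pXn2r _ 2) ?nnegrE ?normr_ge0 // real_normK ?num_real //.
have -> : ((al * l + be * t) * (m * s)) ^+ 2 = m ^+ 2 * (al * l + be * t) ^+ 2 * s ^+ 2 by ring.
have -> : ((1 + e) * E) ^+ 2 = (1 + e) * E ^+ 2 * (1 + e) by ring.
rewrite s2 ler_pM2r; last by lra.
by apply: le_trans f1; rewrite ler_pM2l ?exprn_gt0.
Qed.

Lemma calibration_continuous y p al be e : y != 0 -> p != 0 -> al ^+ 2 + be ^+ 2 <= 1 -> 0 < e ->
  exists2 d, 0 < d & forall q, enorm (q - p) < d -> `|calibration y al be q - calibration y al be p| < e.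
Proof.
move=> y0 p0 ab e0.
have N0 : 0 < enorm p by rewrite enorm_gt0.
have [d1 d10 h1] := calibration_local y0 p0 ab ltr01.
have [|d2 d20 h2] := @calibration_local y p (- al) (- be) 1 y0 p0 _ ltr01; first by rewrite !sqrrN.
exists (Num.min (Num.min d1 d2) (e * enorm p / 2)).
  by rewrite !lt_min d10 d20 divr_gt0 // mulr_gt0.
move=> q; rewrite !lt_min => /andP[/andP[/h1 q1 /h2 q2] q3].
have e2 : calibration y (- al) (- be) q - calibration y (- al) (- be) p =
   - (calibration y al be q - calibration y al be p) by rewrite /calibration; ring.
rewrite e2 in q2; move: q1 q2 q3; move: (_ - _ : R) (enorm (q - p)) => D E q1 q2 q3.
rewrite -(ltr_pM2r N0) -[in ltLHS](gtr0_norm N0) -normrM ltr_norml; apply/andP; split; nra.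
Qed.

End LogPolar.


Section Formula.
Context {R : realType} {n : nat}.
Implicit Types (x y z u v p q : 'rV[R]_n) (e t : R).

Definition log_polar_dist y z : R :=
  Num.sqrt ((ln (enorm z) - ln (enorm y)) ^+ 2 + angle y z ^+ 2).

Lemma log_polar_dist_ge0 y z : 0 <= log_polar_dist y z.
Proof. exact: sqrtr_ge0. Qed.

Lemma sqr_log_polar_dist y z :
  log_polar_dist y z ^+ 2 = (ln (enorm z) - ln (enorm y)) ^+ 2 + angle y z ^+ 2.
Proof. by rewrite sqr_sqrtr // addr_ge0 ?sqr_ge0. Qed.

Lemma anglexx y : y != 0 -> angle y y = 0.
Proof.
move=> y0; apply: angle_unique => //; first exact: pi_ge0.
by rewrite cos0 mulr1 -sqr_enorm expr2.
Qed.

(** Every curve from y to z is at least as long as the increment of the calibration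
in the direction of z - y in logarithmic polar coordinates. *)
Lemma qh_metric_ge y z : (0 < n)%N -> y != 0 ->
  ((log_polar_dist y z)%:E <= qh_metric (~` [set 0%R]) y z)%E.
Proof.
move=> n0 y0; apply: le_ereal_inf_tmp => _ [a [b [g [[ab cg gG] rect ga gb ->]]]].
have g0 t : a <= t -> t <= b -> g t != 0.
  move=> at_ tb; apply/eqP => gt0; apply: (gG (g t)) => //.
  by exists t => //=; rewrite in_itv /= at_ tb.
set k := log_polar_dist y z.
set l := ln (enorm z) - ln (enorm y).
have [al [be [abe abk]]] : exists al be : R, al ^+ 2 + be ^+ 2 <= 1 /\ al * l + be * angle y z = k.
  have [k0|k0] := eqVneq k 0.
    exists 0, 0; rewrite k0 !mul0r addr0; split=> //.
    by rewrite expr0n addr0 ler01.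
  exists (l / k), (angle y z / k).
  have k2 : k ^+ 2 = l ^+ 2 + angle y z ^+ 2 by rewrite /k sqr_log_polar_dist.
  split.
    by rewrite !exprMn -mulrDl -k2 exprVn divff // expf_neq0.
  have -> : l / k * l + angle y z / k * angle y z = k ^+ 2 / k by rewrite k2; field.
  by rewrite expr2 mulfK.
have cgt t d : a <= t -> t <= b -> 0 < d -> exists2 d', 0 < d' &
    forall t', a <= t' -> t' <= b -> `|t' - t| < d' -> enorm (g t' - g t) < d.
  move=> at_ tb d0.
  have cgt : g @ within [set` `[a, b]] (nbhs t) --> g t.
    by move/subspace_continuousP : cg; apply; rewrite /= in_itv /= at_ tb.
  have : nbhs (g t) [set w | enorm (g t - w) < d] by apply/nbhs_enormP; exists d.
  move=> /cgt; rewrite /within /= => -[d' /= d'0 hd].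
  exists d' => // t' h1 h2 h3; rewrite enormB.
  by apply: hd => //=; [rewrite distrC|rewrite in_itv /= h1 h2].
have -> : k = calibration y al be (g b) - calibration y al be (g a).
  by rewrite -abk ga gb /calibration anglexx // /l; ring.
apply: (@qh_length_ge R n g a b n0 ab rect cg g0 (fun t => calibration y al be (g t))).
  move=> t e at_ tb e0; have [d d0 hd] := calibration_continuous y0 (g0 t at_ tb) abe e0.
  have [d' d'0 hd'] := cgt t d at_ tb d0.
  by exists d' => // t' at' tb' /(hd' t' at' tb') /hd.
move=> t e at_ tb e0; have [d d0 hd] := calibration_local y0 (g0 t at_ (ltW tb)) abe e0.
have [d' d'0 hd'] := cgt t d at_ (ltW tb) d0.
exists d' => // t' tt' tb' h; apply: hd; apply: hd' => //; first by apply: le_trans at_ (ltW tt').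
by rewrite gtr0_norm ?subr_gt0.
Qed.

Lemma exists_orthogonal u : (2 <= n)%N -> exists2 v, enorm v = 1 & dot u v = 0.
Proof.
move=> n2; pose i0 : 'I_n := Ordinal (ltnW n2); pose i1 : 'I_n := Ordinal n2.
have [v v0 uv] : exists2 v, v != 0 & dot u v = 0.
  have dotd i : dot u (delta_mx 0 i) = u 0 i.
    rewrite /dot (bigD1 i) //= mxE !eqxx mulr1 big1 ?addr0 // => j ji.
    by rewrite mxE (negPf ji) andbF mulr0.
  have [e|e] := eqVneq (u 0 i1) 0.
    exists (delta_mx 0 i1); last by rewrite dotd.
    apply/eqP => /matrixP/(_ 0 i1); rewrite !mxE !eqxx => /eqP; by rewrite oner_eq0.
  exists (u 0 i1 *: delta_mx 0 i0 - u 0 i0 *: delta_mx 0 i1).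
    apply/eqP => /matrixP/(_ 0 i0); rewrite !mxE !eqxx /= mulr1 mulr0 subr0 => /eqP.
    by rewrite (negPf e).
  by rewrite dotDr dotNr !dotZr !dotd mulrC subrr.
exists ((enorm v)^-1 *: v); last by rewrite dotZr uv mulr0.
rewrite enormZ ger0_norm ?invr_ge0 ?enorm_ge0 // mulVf //.
by rewrite enorm_eq0.
Qed.

Lemma polar_decomposition u z : (2 <= n)%N -> enorm u = 1 -> z != 0 ->
  exists v, [/\ enorm v = 1, dot u v = 0 &
    z = enorm z *: (cos (angle u z) *: u + sin (angle u z) *: v)].
Proof.
move=> n2 u1 z0.
have u0 : u != 0 by rewrite -enorm_gt0 u1.
have hz := cos_angle u0 z0; rewrite u1 mul1r in hz.
pose w := z - dot u z *: u.
have uu : dot u u = 1 by rewrite -sqr_enorm u1 expr1n.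
have uw : dot u w = 0 by rewrite /w dotDr dotNr dotZr uu mulr1 subrr.
have wn : enorm w = enorm z * sin (angle u z).
  apply/eqP; rewrite -(@eqrXn2 _ 2) ?enorm_ge0 ?mulr_ge0 ?enorm_ge0 ?sin_angle_ge0 //.
  rewrite sqr_enorm /w !(dotDl, dotDr, dotNl, dotNr, dotZl, dotZr) uu -sqr_enorm (dotC z u) -hz.
  by rewrite exprMn sin2cos2; apply/eqP; ring.
have zw : z = dot u z *: u + w by rewrite addrC subrK.
have [w0|w0] := eqVneq w 0.
  have [v v1 uv] := exists_orthogonal u n2; exists v; split=> //.
  have s0 : sin (angle u z) = 0.
    move/eqP: wn; rewrite w0 enorm0 eq_sym mulf_eq0 enorm_eq0 (negPf z0) /= => /eqP //.
  by rewrite s0 scale0r addr0 scalerA hz {1}zw w0 addr0.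
exists ((enorm w)^-1 *: w); split.
- rewrite enormZ ger0_norm ?invr_ge0 ?enorm_ge0 // mulVf //.
  by rewrite enorm_eq0.
- by rewrite dotZr uw mulr0.
rewrite scalerDr !scalerA hz -wn mulfV ?scale1r //.
by rewrite enorm_eq0.
Qed.

Lemma within_lipschitz (g : R -> 'rV[R]_n) (a b c : R) :
  (forall t t', a <= t -> t <= t' -> t' <= b -> enorm (g t' - g t) <= c * (t' - t)) ->
  {within `[a, b], continuous g}.
Proof.
move=> h; apply/subspace_continuousP => t /=; rewrite in_itv /= => /andP[at_ tb].
move=> A /nbhs_enormP[e e0 he].
have c0 : 0 < `|c| + 1 by have := normr_ge0 c; lra.
rewrite /within /=; exists (e / (`|c| + 1)); first exact: divr_gt0.
move=> t' /= tt'; rewrite in_itv /= => /andP[at' tb']; apply: he.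
rewrite ltr_pdivlMr // in tt'.
apply: le_lt_trans tt'; apply: (@le_trans _ _ (c * `|t - t'|)).
  have [tt|/ltW tt] := leP t t'.
    by rewrite enormB distrC ger0_norm ?subr_ge0 //; exact: h.
  by rewrite ger0_norm ?subr_ge0 //; exact: h.
by rewrite mulrC ler_wpM2l //; have := ler_norm c; lra.
Qed.

End Formula.


Section Spiral.
Context {R : realType} {n : nat}.
Variables (u v : 'rV[R]_n) (r0 l th : R).
Hypothesis u1 : enorm u = 1.
Hypothesis v1 : enorm v = 1.
Hypothesis uv : dot u v = 0.
Hypothesis r0_gt0 : 0 < r0.
Implicit Types (t s M : R).

Definition spiral_radius t : R := r0 * expR (l * t).

(** In logarithmic polar coordinates with respect to the plane of u and v this is a
line traversed at constant speed, the candidate for a geodesic. *)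
Definition spiral t : 'rV[R]_n :=
  spiral_radius t *: (cos (th * t) *: u + sin (th * t) *: v).

Let speed := Num.sqrt (l ^+ 2 + th ^+ 2).

Lemma spiral_radius_gt0 t : 0 < spiral_radius t.
Proof. by rewrite mulr_gt0 ?expR_gt0. Qed.

Lemma dot_spiral t t' :
  dot (spiral t) (spiral t') = spiral_radius t * spiral_radius t' * cos (th * (t' - t)).
Proof.
rewrite /spiral !(dotZl, dotZr, dotDl, dotDr) -!sqr_enorm u1 v1 (dotC v u) uv.
by rewrite mulrBr cosB; ring.
Qed.

Lemma enorm_spiral t : enorm (spiral t) = spiral_radius t.
Proof.
apply/eqP; rewrite -(@eqrXn2 _ 2) ?enorm_ge0 ?(ltW (spiral_radius_gt0 _)) //.
by rewrite sqr_enorm dot_spiral subrr mulr0 cos0 mulr1 expr2.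
Qed.

Lemma cos_lower x : 1 - x ^+ 2 / 2 <= cos x :> R.
Proof.
wlog x0 : x / 0 <= x => [H|].
  have [/H//|/ltW x0] := leP 0 x.
  by have := H (- x); rewrite cosN oppr_ge0 x0 sqrrN; apply.
have [h _] := @taylor_bounds R 1 x x0.
by move: h; rewrite /cos_poly /taylor_coeff /double /= !expr0; lra.
Qed.

Lemma expR_increment_le (x y M : R) : expR x <= M -> expR y <= M ->
  `|expR x - expR y| <= M * `|x - y|.
Proof.
wlog yx : x y / y <= x => [H|] hx hy.
  have [yx|/ltW xy] := leP y x; first exact: H.
  by rewrite distrC [X in _ <= _ * X]distrC; exact: H.
rewrite !ger0_norm ?subr_ge0 ?ler_expR //.
have h := expR_ge1Dx (y - x); have e0 := expR_gt0 x.
have e : expR y = expR x * expR (y - x) by rewrite -expRD addrC subrK.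
apply: (@le_trans _ _ (expR x * (x - y))); last by rewrite ler_wpM2r ?subr_ge0.
by rewrite e; nra.
Qed.

Lemma spiral_chord t t' M : t <= t' -> spiral_radius t <= M -> spiral_radius t' <= M ->
  enorm (spiral t' - spiral t) <= M * speed * (t' - t).
Proof.
move=> tt' h1 h2.
have p1 := spiral_radius_gt0 t; have p2 := spiral_radius_gt0 t'.
have M0 : 0 < M by exact: lt_le_trans h1.
have d0 : 0 <= t' - t by rewrite subr_ge0.
have s0 : 0 <= speed by exact: sqrtr_ge0.
rewrite -(@ler_pXn2r _ 2) ?nnegrE ?enorm_ge0 //; last first.
  by apply: mulr_ge0 d0; apply: mulr_ge0 s0; exact: ltW.
have s2 : speed ^+ 2 = l ^+ 2 + th ^+ 2 by rewrite sqr_sqrtr // addr_ge0 ?sqr_ge0.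
rewrite !exprMn s2.
rewrite sqr_enorm !(dotDl, dotDr, dotNl, dotNr) (dotC (spiral t')) -!sqr_enorm !enorm_spiral dot_spiral.
have h3 : (spiral_radius t' - spiral_radius t) ^+ 2 <= (M * (l * (t' - t))) ^+ 2.
  rewrite -(real_normK (num_real (_ - _))) -(real_normK (num_real (M * _))).
  rewrite ler_pXn2r ?nnegrE //.
  rewrite /spiral_radius -mulrBr !normrM (gtr0_norm r0_gt0) (gtr0_norm M0) -normrM mulrBr.
  apply: (@le_trans _ _ (r0 * (M / r0 * `|l * t' - l * t|))).
    rewrite ler_pM2l //; apply: expR_increment_le; rewrite ler_pdivlMr // mulrC //.
  by rewrite mulrA mulrCA mulfV ?gt_eqF // mulr1.
have h4 : spiral_radius t * spiral_radius t' * (1 - cos (th * (t' - t))) <=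
    M ^+ 2 * ((th * (t' - t)) ^+ 2 / 2).
  apply: ler_pM; [by rewrite mulr_ge0 // ltW|by rewrite subr_ge0 cos_le1| |].
    by rewrite expr2; apply: ler_pM => //; exact: ltW.
  by have := cos_lower (th * (t' - t)); lra.
move: h3 h4; move: (spiral_radius t) (spiral_radius t') => P P'; rewrite !exprMn; lra.
Qed.

Lemma spiral_radius_near t t' : t <= t' -> spiral_radius t' <= spiral_radius t * expR (`|l| * (t' - t)).
Proof.
move=> tt'; rewrite /spiral_radius -mulrA ler_pM2l // -expRD ler_expR.
have := ler_norm l; have : 0 <= t' - t by rewrite subr_ge0.
nra.
Qed.

Lemma spiral_chord_near t t' a b : a <= t -> t <= t' -> t' <= b ->
  enorm (spiral t' - spiral t) <= spiral_radius a * expR (`|l| * (b - a)) * speed * (t' - t).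
Proof.
move=> at_ tt' tb; apply: spiral_chord => //.
  apply: le_trans (spiral_radius_near at_) _; rewrite ler_pM2l ?spiral_radius_gt0 // ler_expR.
  by rewrite ler_wpM2l //; lra.
apply: le_trans (spiral_radius_near (le_trans at_ tt')) _; rewrite ler_pM2l ?spiral_radius_gt0 // ler_expR.
by rewrite ler_wpM2l //; lra.
Qed.

Lemma spiral_rectifiable : rectifiable 0 1 spiral.
Proof.
apply: le_lt_trans (ltry (spiral_radius 0 * expR (`|l| * (1 - 0)) * speed * (1 - 0))).
by apply: arc_length_lipschitz => // t t' h1 h2 h3; exact: spiral_chord_near.
Qed.

Lemma spiral_continuous : {within `[0, 1], continuous spiral}.
Proof.
apply: (@within_lipschitz _ _ _ _ _ (spiral_radius 0 * expR (`|l| * (1 - 0)) * speed)) => t t' h1 h2 h3.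
exact: spiral_chord_near.
Qed.

Lemma qh_length_spiral : (0 < n)%N -> (qh_length (~` [set 0%R]) 0 1 spiral <= speed%:E)%E.
Proof.
move=> n0; rewrite -[speed]mulr1 -[X in _ * X](subr0 1).
apply: qh_length_le => //.
- exact: spiral_rectifiable.
- exact: spiral_continuous.
- by move=> t _ _; rewrite -enorm_gt0 enorm_spiral spiral_radius_gt0.
- exact: sqrtr_ge0.
move=> t e t0 t1 e0.
have l0 : 0 < `|l| + 1 by have := normr_ge0 l; lra.
have L0 : 0 < ln (1 + e) by apply: ln_gt0; lra.
exists (ln (1 + e) / (`|l| + 1)); first exact: divr_gt0.
move=> t' tt' t'1; rewrite ltr_pdivlMr // => hd.
have E : expR (`|l| * (t' - t)) <= 1 + e.
  have e1 : 0 < 1 + e by lra.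
  by rewrite -[leRHS](lnK (e1 : 1 + e \in Num.pos)) ler_expR; nra.
have : arc_len spiral t t' <= spiral_radius t * expR (`|l| * (t' - t)) * speed * (t' - t).
  apply: (arc_len_leP spiral_rectifiable) => //; first exact: ltW.
  move=> s ps ls; rewrite -lee_fin; apply: le_trans (@chain_length_le_arc _ _ spiral _ _ _ ps ls) _.
  apply: arc_length_lipschitz; first exact: ltW.
  by move=> ? ? h1 h2 h3; exact: spiral_chord_near.
move=> /le_trans; apply; rewrite enorm_spiral.
have d0 : 0 <= t' - t by lra.
rewrite ler_wpM2r // [leRHS]mulrAC ler_wpM2r ?sqrtr_ge0 // mulrC ler_wpM2r //.
exact: ltW (spiral_radius_gt0 t).
Qed.

End Spiral.

Section QhFormula.
Context {R : realType} {n : nat}.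
Implicit Types (y z : 'rV[R]_n).

(** The quasihyperbolic metric of the punctured space is the Euclidean metric in
logarithmic polar coordinates, and logarithmic spirals are its geodesics. *)
Theorem qh_metric_punctured y z : (2 <= n)%N -> y != 0 -> z != 0 ->
  qh_metric (~` [set 0%R]) y z = (log_polar_dist y z)%:E.
Proof.
move=> n2 y0 z0; have n0 : (0 < n)%N := ltnW n2.
apply/eqP; rewrite eq_le qh_metric_ge // andbT.
have N0 : 0 < enorm y by rewrite enorm_gt0.
have M0 : 0 < enorm z by rewrite enorm_gt0.
pose u := (enorm y)^-1 *: y.
have u1 : enorm u = 1.
  by rewrite enormZ ger0_norm ?invr_ge0 ?enorm_ge0 // mulVf // gt_eqF.
have au : angle u z = angle y z.
  by rewrite /angle u1 mul1r /u dotZl; congr acos; field; rewrite !gt_eqF.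
have [v [v1 uv ez]] := polar_decomposition n2 u1 z0.
pose l := ln (enorm z) - ln (enorm y); pose th := angle y z.
apply: ereal_inf_le; exists (qh_length (~` [set 0%R]) 0 1 (spiral u v (enorm y) l th)).
  exists 0, 1, (spiral u v (enorm y) l th); split=> //.
  - split => //; first exact: spiral_continuous.
    move=> _ [t _ <-] /= e.
    by have := spiral_radius_gt0 l N0 t; rewrite -(enorm_spiral l th u1 v1 uv N0) e enorm0 ltxx.
  - exact: spiral_rectifiable.
  - rewrite /spiral /spiral_radius !mulr0 cos0 sin0 expR0 mulr1 scale0r addr0 scale1r.
    by rewrite /u scalerA mulfV ?gt_eqF // scale1r.
  - rewrite /spiral /spiral_radius !mulr1 /th -au [RHS]ez; congr (_ *: _).
    rewrite /l expRB !lnK ?posrE //; field; by rewrite gt_eqF.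
exact: qh_length_spiral.
Qed.

Lemma qh_ball_punctured y z r : (2 <= n)%N -> y != 0 -> 0 < r ->
  qh_ball (~` [set 0]) y r z <->
  z != 0 /\ (ln (enorm z) - ln (enorm y)) ^+ 2 + angle y z ^+ 2 < r ^+ 2.
Proof.
move=> n2 y0 r0; rewrite -sqr_log_polar_dist; split.
  move=> [/= /eqP z0]; rewrite qh_metric_punctured // lte_fin => h; split => //.
  by rewrite ltr_pXn2r // nnegrE ?log_polar_dist_ge0 // ltW.
move=> [z0 h]; split; first by apply/eqP.
rewrite qh_metric_punctured // lte_fin; move: h.
by rewrite ltr_pXn2r // nnegrE ?log_polar_dist_ge0 // ltW.
Qed.

End QhFormula.


(** * Quasihyperbolic balls in the punctured space *)

Section CalculusOnALine.
Context {R : realType}.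
Implicit Types (x t l q r : R).

(** This is where lambda comes from: the line through the origin with slope
-1/lambda and the graph of the cosine on [pi/2, pi] touch, the point of contact
being q = sqrt (lambda^2 - 1). *)
Lemma lambda_tangent l t : is_lambda l -> pi / 2 <= t -> t <= pi -> - (l * cos t) <= t.
Proof.
move=> /is_lambdaP[l0 [q [q1 q2 lq _ f0]]] t1 t2.
have p0 := pi_gt0 R; have q0 : 0 < q by lra.
have sq0 : 0 < sin q by apply: sin_gt0_pi; rewrite q0 q2.
have cq : cos q = - (q * sin q) by move: f0; rewrite /lambda_fun; lra.
have lsq : l * sin q = 1.
  have : (l * sin q) ^+ 2 = 1 ^+ 2.
    by rewrite exprMn lq expr1n; have := cos2Dsin2 q; rewrite cq; lra.
  move/eqP; rewrite eqrXn2 // ?mulr_ge0 ?(ltW sq0) // => /eqP //.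
have lpos : 0 < l by rewrite lt_neqAle l0 andbT; apply: contra_eq_neq lsq => <-; rewrite mul0r eq_sym oner_neq0.
have base : q + l * cos q = 0 by rewrite cq; have : l * sin q * q = q; [rewrite lsq mul1r|]; lra.
have sin_decr (a b : R) : pi / 2 <= a -> a <= b -> b <= pi -> sin b <= sin a.
  move=> ha ab hb; have := @derivative_ge0_le R (\- sin) (fun x => - cos x) a b ab.
  rewrite lerN2; apply=> x /andP[ax xb].
  rewrite oppr_ge0; have : pi / 2 <= x by lra.
  rewrite le_eqVlt => /orP[/eqP <-|h]; first by rewrite cos_pihalf.
  by apply/ltW/cos_lt0_pihalf => //; lra.
have dphi x : is_derive x 1 (fun x => x + l * cos x) (1 - l * sin x).
  have -> : (fun x => x + l * cos x) = id + l \*: cos by apply/funext.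
  by apply: is_derive_eq; rewrite /GRing.scale /= mulrN.
suff : q + l * cos q <= t + l * cos t by rewrite base; lra.
have [tq|/ltW qt] := leP t q.
  have := @derivative_ge0_le R (\- (fun x => x + l * cos x)) (fun x => - (1 - l * sin x)) t q tq.
  rewrite lerN2; apply=> x /andP[h1 h2].
  have := sin_decr x q (le_trans t1 h1) h2 (ltW q2).
  by rewrite -(ler_pM2l lpos) lsq; lra.
have := @derivative_ge0_le R _ _ q t qt (fun x _ => dphi x); apply=> x /andP[h1 h2].
have := sin_decr q x (ltW q1) h1 (le_trans h2 t2).
by rewrite -(ler_pM2l lpos) lsq; lra.
Qed.

(* The points at distance h from the axis through 0 and y, on a line parallel to
   it, are parametrized by their position x along the axis; c is log |y|. *)
Variables (c h : R).
Hypothesis h0 : 0 < h.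

Definition line_radius x : R := Num.sqrt (x ^+ 2 + h ^+ 2).
Definition line_log x : R := 2^-1 * ln (x ^+ 2 + h ^+ 2) - c.
Definition line_angle x : R := pi / 2 - atan (x / h).
Definition line_dist2 x : R := line_log x ^+ 2 + line_angle x ^+ 2.
(** Half the derivative of line_dist2, times the square of the radius. *)
Definition line_slope x : R := x * line_log x - h * line_angle x.

Let r2_gt0 x : 0 < x ^+ 2 + h ^+ 2.
Proof. by rewrite ltr_wpDl ?sqr_ge0 // exprn_gt0. Qed.

Lemma line_radius_gt0 x : 0 < line_radius x.
Proof. by rewrite sqrtr_gt0. Qed.

Lemma line_radius_cos x : line_radius x * cos (line_angle x) = x.
Proof.
have s1 : 0 < 1 + (x / h) ^+ 2 by rewrite ltr_wpDr // sqr_ge0.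
have e : line_radius x = h * Num.sqrt (1 + (x / h) ^+ 2).
  rewrite -{1}(gtr0_norm h0) -sqrtr_sqr -sqrtrM ?sqr_ge0 //; congr Num.sqrt.
  by field; rewrite gt_eqF.
have cn : cos (atan (x / h)) != 0 by rewrite cos_atan invr_eq0 gt_eqF ?sqrtr_gt0.
rewrite /line_angle cosB cos_pihalf sin_pihalf mul0r add0r mul1r.
have -> : sin (atan (x / h)) = x / h * cos (atan (x / h)).
  by rewrite -{2}(atanK (x / h)) /tan divfK.
rewrite cos_atan e; field; by rewrite !gt_eqF ?sqrtr_gt0.
Qed.

Lemma line_radius_sin x : line_radius x * sin (line_angle x) = h.
Proof.
have s1 : 0 < 1 + (x / h) ^+ 2 by rewrite ltr_wpDr // sqr_ge0.
have e : line_radius x = h * Num.sqrt (1 + (x / h) ^+ 2).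
  rewrite -{1}(gtr0_norm h0) -sqrtr_sqr -sqrtrM ?sqr_ge0 //; congr Num.sqrt.
  by field; rewrite gt_eqF.
rewrite /line_angle sinB cos_pihalf sin_pihalf mul0r subr0 mul1r cos_atan e.
by rewrite mulfK // gt_eqF // sqrtr_gt0.
Qed.

Lemma line_angle_gt0 x : 0 < line_angle x.
Proof. by rewrite subr_gt0 atan_ltpi2. Qed.

Lemma line_angle_lt_pi x : line_angle x < pi.
Proof. by have := atan_gtNpi2 (x / h); rewrite /line_angle; lra. Qed.

Lemma is_derive_line_log x : is_derive x 1 line_log (x / (x ^+ 2 + h ^+ 2)).
Proof.
have r2 := r2_gt0 x.
have d1 : is_derive (x ^+ 2 + h ^+ 2) 1 (@ln R) (x ^+ 2 + h ^+ 2)^-1 by exact: is_derive1_ln.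
have d2 : is_derive x 1 (fun x => x ^+ 2 + h ^+ 2) (2 * x).
  have -> : (fun x => x ^+ 2 + h ^+ 2) = id ^+ 2 + cst (h ^+ 2) by apply/funext => z; rewrite !fctE.
  by apply: is_derive_eq; rewrite /GRing.scale /= expr1 mulr1 addr0; ring.
have -> : line_log = 2^-1 \*: (@ln R \o (fun x => x ^+ 2 + h ^+ 2)) - cst c.
  by apply/funext => z.
have d3 := @is_derive1_comp R (@ln R) (fun x => x ^+ 2 + h ^+ 2) x _ _ d1 d2.
by apply: is_derive_eq; rewrite /GRing.scale /=; field; rewrite gt_eqF.
Qed.

Lemma is_derive_line_angle x : is_derive x 1 line_angle (- (h / (x ^+ 2 + h ^+ 2))).
Proof.
have r2 := r2_gt0 x.
have d2 : is_derive x 1 (fun x => x / h) h^-1.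
  have -> : (fun x => x / h) = h^-1 \*: id by apply/funext => z; rewrite /= /GRing.scale /= mulrC.
  by apply: is_derive_eq; rewrite /GRing.scale /= mulr1.
have d3 := @is_derive1_comp R (@atan R) (fun x => x / h) x _ _ (is_derive1_atan (x / h)) d2.
have -> : line_angle = cst (pi / 2) - (@atan R \o (fun x => x / h)) by apply/funext.
apply: is_derive_eq; rewrite sub0r; congr (- _); field.
by rewrite !gt_eqF //=; have -> : h * h + x * x = x ^+ 2 + h ^+ 2 by ring.
Qed.

Lemma is_derive_line_dist2 x :
  is_derive x 1 line_dist2 (2 * line_slope x / (x ^+ 2 + h ^+ 2)).
Proof.
have d1 := is_derive_line_log x; have d2 := is_derive_line_angle x.
have -> : line_dist2 = line_log ^+ 2 + line_angle ^+ 2 by apply/funext => z; rewrite !fctE.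
apply: (is_derive_eq (is_deriveD (is_deriveX 2 d1) (is_deriveX 2 d2))).
rewrite /GRing.scale /= !expr1 /line_slope; field.
by rewrite gt_eqF.
Qed.

Lemma is_derive_line_slope x : is_derive x 1 line_slope (line_log x + 1).
Proof.
have d1 := is_derive_line_log x; have d2 := is_derive_line_angle x.
have -> : line_slope = id * line_log - h \*: line_angle by apply/funext => z; rewrite !fctE.
apply: is_derive_eq; rewrite /GRing.scale /=; field.
by rewrite gt_eqF.
Qed.

(** At a point behind the origin where the squared distance does not decrease,
x * log r >= h * angle. With x = r cos angle and h = r sin angle this makes the
squared distance at least (angle / cos angle)^2, and lambda_tangent applies. *)
Lemma line_dist2_ge l x : is_lambda l -> x < 0 -> 0 <= line_slope x -> l ^+ 2 <= line_dist2 x.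
Proof.
move=> hl x0 sl.
have t0 := line_angle_gt0 x; have t1 := line_angle_lt_pi x.
have r0 := line_radius_gt0 x; have ec := line_radius_cos x; have es := line_radius_sin x.
have r2 : line_radius x ^+ 2 = x ^+ 2 + h ^+ 2 by rewrite sqr_sqrtr // ltW.
have tp : pi / 2 <= line_angle x.
  rewrite /line_angle lerDl oppr_ge0 -(atan0 R); apply: le_atan.
  by rewrite pmulr_lle0 ?invr_gt0 // ltW.
have key := lambda_tangent hl tp (ltW t1).
have l0 : 0 <= l by case/is_lambdaP: hl.
have k1 : (l * x) ^+ 2 <= (x ^+ 2 + h ^+ 2) * line_angle x ^+ 2.
  rewrite -r2 -exprMn -(sqrrN (l * x)) ler_pXn2r ?nnegrE //.
  - by rewrite -{1}ec mulrCA -mulrN ler_pM2l.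
  - by rewrite -mulrN mulr_ge0 // oppr_ge0 ltW.
  - by rewrite mulr_ge0 // ltW.
have k2 : (h * line_angle x) ^+ 2 <= (x * line_log x) ^+ 2.
  have a0 : 0 <= h * line_angle x by rewrite mulr_ge0 // ltW.
  move: sl; rewrite /line_slope subr_ge0 => sl.
  by rewrite ler_pXn2r ?nnegrE // (le_trans a0).
have x2 : 0 < x ^+ 2 by rewrite exprn_even_gt0 //= lt_eqF.
rewrite -(ler_pM2l x2) /line_dist2; move: k1 k2; rewrite !exprMn; lra.
Qed.

Lemma continuous_line_dist2 : continuous line_dist2.
Proof.
move=> x; apply: differentiable_continuous; apply/derivable1_diffP.
exact: (@ex_derive _ _ _ _ _ _ _ (is_derive_line_dist2 x)).
Qed.

(** For x < 0, line_dist2 decreases at every point of a ball of radius at most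
lambda, by line_dist2_ge. Hence its minimum over an interval that starts in the
ball is attained at the right end. *)
Lemma line_ball_negative l r2 x1 x : is_lambda l -> r2 <= l ^+ 2 -> x1 <= x -> x <= 0 ->
  line_dist2 x1 < r2 -> line_dist2 x < r2.
Proof.
move=> hl rl x1x x0 hx1; rewrite ltNge; apply/negP => hx.
have [m mx hm] := @EVT_min R line_dist2 x1 x x1x (continuous_subspaceT continuous_line_dist2).
move: mx; rewrite in_itv /= => /andP[m1 m2].
have hmr : line_dist2 m < r2.
  by apply: le_lt_trans hx1; apply: hm; rewrite in_itv /= lexx.
have mx : m < x by rewrite lt_neqAle m2 andbT; apply: contraTneq hmr => ->; rewrite -leNgt.
have m0 : m < 0 by exact: lt_le_trans x0.
have sm : line_slope m < 0.
  by rewrite ltNge; apply/negP => /(line_dist2_ge hl m0); rewrite leNgt (lt_le_trans hmr).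
have cs : {for m, continuous line_slope}.
  apply: differentiable_continuous; apply/derivable1_diffP.
  exact: (@ex_derive _ _ _ _ _ _ _ (is_derive_line_slope m)).
have [d /= d0 hd] : \forall z \near m, line_slope z < 0.
  exact: (cvgr_lt _ cs _ sm).
pose b := m + Num.min (d / 2) (x - m).
have mb : m < b by rewrite ltrDl lt_min subr_gt0 mx divr_gt0.
have bd : b - m <= d / 2 by rewrite addrC addKr ge_min lexx.
have bx : b <= x by rewrite -lerBrDl ge_min lexx orbT.
have : line_dist2 b < line_dist2 m.
  have := @derivative_gt0_lt R (\- line_dist2) (fun x => - (2 * line_slope x / (x ^+ 2 + h ^+ 2))) m b mb.
  rewrite ltrN2; apply=> [z _|z /andP[mz zb]].
    by have := is_derive_line_dist2 z => ?; exact: is_derive_eq.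
  rewrite oppr_gt0 pmulr_llt0 ?invr_gt0 // pmulr_rlt0 //; apply: hd => /=.
  by rewrite ltr0_norm; lra.
by rewrite ltNge hm // in_itv /= (le_trans m1 (ltW mb)) bx.
Qed.

Lemma line_slope0 : line_slope 0 < 0.
Proof.
rewrite /line_slope /line_angle !mul0r atan0 subr0 sub0r oppr_lt0 mulr_gt0 //.
by have := pi_gt0 R; lra.
Qed.

(** On x >= 0 the slope has at most one change of sign, from minus to plus. *)
Lemma line_ball_nonnegative r2 x1 x x2 : 0 <= x1 -> x1 <= x -> x <= x2 ->
  line_dist2 x1 < r2 -> line_dist2 x2 < r2 -> line_dist2 x < r2.
Proof.
move=> x10 x1x xx2 h1 h2; rewrite ltNge; apply/negP => hx.
have lt1 : x1 < x by rewrite lt_neqAle x1x andbT; apply: contraTneq h1 => ->; rewrite -leNgt.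
have lt2 : x < x2 by rewrite lt_neqAle xx2 andbT; apply: contraTneq h2 => <-; rewrite -leNgt.
have mvt (f df : R -> R) (a b : R) : a < b -> (forall x, is_derive x 1 f (df x)) ->
    exists z, [/\ a < z, z < b & f b - f a = df z * (b - a)].
  move=> ab hf; have [|z + e] := @MVT R f df a b ab.
    exact: is_derive_within (fun z _ => hf z).
  by rewrite in_itv /= => /andP[az zb]; exists z.
have [p [p1 p2 ep]] := mvt _ _ _ _ lt1 is_derive_line_dist2.
have [q [q1 q2 eq]] := mvt _ _ _ _ lt2 is_derive_line_dist2.
have sp : 0 < line_slope p.
  have : 0 < 2 * line_slope p / (p ^+ 2 + h ^+ 2).
    by rewrite -(@pmulr_lgt0 _ (x - x1)) ?subr_gt0 // -ep; lra.
  by rewrite pmulr_lgt0 ?invr_gt0 // pmulr_rgt0.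
have sq : line_slope q < 0.
  have : 2 * line_slope q / (q ^+ 2 + h ^+ 2) < 0.
    by rewrite -(@pmulr_llt0 _ (x2 - x)) ?subr_gt0 // -eq; lra.
  by rewrite pmulr_llt0 ?invr_gt0 // pmulr_rlt0.
have p0 : 0 < p by lra.
have pq : p < q by lra.
have [u [u1 u2 eu]] := mvt _ _ _ _ p0 is_derive_line_slope.
have [v [v1 v2 ev]] := mvt _ _ _ _ pq is_derive_line_slope.
have lu : 0 < line_log u + 1.
  by rewrite -(@pmulr_lgt0 _ (p - 0)) ?subr_gt0 // -eu; have := line_slope0; lra.
have lv : line_log v + 1 < 0.
  by rewrite -(@pmulr_llt0 _ (q - p)) ?subr_gt0 // -ev; lra.
have : line_log u <= line_log v.
  rewrite /line_log lerD2r ler_pM2l ?invr_gt0 // ler_ln ?posrE // lerD2r.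
  by rewrite ler_pXn2r ?nnegrE //; lra.
lra.
Qed.

Lemma line_ball_convex l r2 x1 x x2 : is_lambda l -> r2 <= l ^+ 2 -> x1 <= x -> x <= x2 ->
  line_dist2 x1 < r2 -> line_dist2 x2 < r2 -> line_dist2 x < r2.
Proof.
move=> hl rl x1x xx2 h1 h2.
have [x10|/ltW x10] := leP 0 x1; first exact: line_ball_nonnegative h1 h2.
have [x0|/ltW x0] := leP x 0; first exact: line_ball_negative hl rl x1x x0 h1.
apply: (@line_ball_nonnegative r2 0 x x2) => //.
exact: line_ball_negative hl rl x10 (lexx 0) h1.
Qed.

End CalculusOnALine.


Section DirectionalConvexity.
Context {R : realType} {n : nat}.
Implicit Types (x y z u w : 'rV[R]_n) (D : set 'rV[R]_n) (r s t : R).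

(** If every line in direction y meets D in an interval, the complement is
covered by the half-lines that point along y away from D. *)
Lemma directionally_convex_close_to_convex D y : D != setT -> y != 0 ->
  (forall z s t, 0 <= s -> 0 <= t -> D (z - s *: y) -> D (z + t *: y) -> D z) ->
  close_to_convex D.
Proof.
move=> DT y0 conv.
pose meets z := exists t, D (z + t *: y).
pose ahead z := exists2 t, 0 < t & D (z + t *: y).
pose w z := if `[< meets z >] then (if `[< ahead z >] then - y else y)
  else if 0 <= dot z y then y else - y.
have yN : - y <> y.
  move=> /eqP; rewrite -subr_eq0 -opprD oppr_eq0 -mulr2n -scaler_nat scaler_eq0 (negPf y0) orbF.
  by rewrite pnatr_eq0.
have w_ahead z : ahead z -> w z = - y.
  move=> az; rewrite /w (asboolT az) asboolT //.
  by have [t _ Dt] := az; exists t.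
have w_behind z : meets z -> ~ ahead z -> w z = y.
  by rewrite /w => /asboolT -> /asboolF ->.
have w_else z : ~ meets z -> w z = if 0 <= dot z y then y else - y.
  by rewrite /w => /asboolF ->.
have yy : 0 < dot y y by rewrite dot_gt0.
have shift z s t : z + s *: y + t *: y = z + (s + t) *: y by rewrite -addrA scalerDl.
have meets_shift z s : meets (z + s *: y) <-> meets z.
  split=> [[t]|[t Dt]]; first by rewrite shift => ?; exists (s + t).
  by exists (t - s); rewrite shift [s + _]addrC subrK.
have ahead_shift z s : 0 <= s -> ahead (z + s *: y) -> ahead z.
  by move=> s0 [t t0 Dt]; exists (s + t); [rewrite ltr_wpDl|rewrite -shift].
have ahead_back z s : 0 <= s -> ahead z -> ahead (z + (- s) *: y).
  move=> s0 [t t0 Dt]; exists (s + t); first by rewrite ltr_wpDl.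
  by rewrite shift addKr.
have oppE z t : z + t *: (- y) = z + (- t) *: y by rewrite scalerN scaleNr.
have oppE' z t : z - t *: (- y) = z + t *: y by rewrite scalerN opprK.
have oppE2 z t : z - t *: y = z + (- t) *: y by rewrite scaleNr.
apply: (@field_close_to_convex _ _ D w) => //.
- move=> z _; rewrite /w; do !case: ifP => _; by rewrite ?oppr_eq0.
- move=> z t nD tge0.
  have [mz|nmz] := pselect (meets z); last first.
    have nm s : ~ meets (z + s *: y) by rewrite meets_shift.
    have nDs s : ~ D (z + s *: y) by move=> Ds; apply: nmz; exists s.
    rewrite (w_else z nmz); case: ifP => d; rewrite ?oppE; split=> //; rewrite w_else //.
      by rewrite dotDl dotZl addr_ge0 // mulr_ge0 // ltW.
    rewrite dotDl dotZl; case: ifP => // h; exfalso.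
    have : 0 <= t * dot y y by rewrite mulr_ge0 // ltW.
    have : dot z y < 0 by rewrite ltNge d.
    by move: h; rewrite mulNr; lra.
  have [az|naz] := pselect (ahead z).
    rewrite (w_ahead z az) oppE; split; last by apply: w_ahead; exact: ahead_back.
    move=> Dz; have [s s0 Ds] := az; apply: nD; apply: (conv z t s) Ds => //; first exact: ltW.
    by rewrite oppE2.
  rewrite (w_behind z mz naz); split.
    move=> Dz; apply: naz; exists t => //; rewrite lt_neqAle tge0 andbT.
    by apply: contra_notN nD => /eqP t0; move: Dz; rewrite -t0 scale0r addr0.
  by apply: w_behind; [rewrite meets_shift|move/(ahead_shift _ _ tge0)].
move=> z nD.
have [mz|nmz] := pselect (meets z); last first.
  have nm s : ~ meets (z + s *: y) by rewrite meets_shift.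
  rewrite (w_else z nmz); case: ifP => d.
    exists ((dot z y + 1) / dot y y); first by rewrite divr_gt0 // ltr_wpDl.
    rewrite oppE2 w_else // dotDl dotZl mulNr divfK ?gt_eqF // => -[_].
    by rewrite leNgt (_ : _ < 0) //; lra.
  have zy : dot z y < 0 by rewrite ltNge d.
  exists (- dot z y / dot y y); first by rewrite divr_gt0 // oppr_gt0.
  rewrite oppE' w_else // dotDl dotZl divfK ?gt_eqF // subrr lexx => -[_] /esym.
  exact: yN.
have [az|naz] := pselect (ahead z).
  by rewrite (w_ahead z az); have [s s0 Ds] := az; exists s => //; rewrite oppE' => -[].
rewrite (w_behind z mz naz); have [s Ds] := mz; exists (- s); last by rewrite scaleNr opprK => -[].
rewrite oppr_gt0 lt_neqAle; apply/andP; split.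
  by apply: contra_notN nD => /eqP s0; move: Ds; rewrite s0 scale0r addr0.
by rewrite leNgt; apply/negP => s0; apply: naz; exists s.
Qed.

End DirectionalConvexity.


Section QhBallConvexity.
Context {R : realType} {n : nat}.
Implicit Types (x y z u w : 'rV[R]_n) (r s t : R).

Lemma ln_enorm z : z != 0 -> ln (enorm z) = 2^-1 * ln (dot z z).
Proof.
by rewrite -enorm_gt0 => z0; rewrite -sqr_enorm lnXn //; lra.
Qed.

Lemma log_polar_line y z (x : R) w : y != 0 -> w != 0 -> dot y w = 0 ->
  z = (x / enorm y) *: y + w ->
  z != 0 /\ (ln (enorm z) - ln (enorm y)) ^+ 2 + angle y z ^+ 2 = line_dist2 (ln (enorm y)) (enorm w) x.
Proof.
move=> y0 w0 yw ez.
have N0 : 0 < enorm y by rewrite enorm_gt0.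
have h0 : 0 < enorm w by rewrite enorm_gt0.
have zz : dot z z = x ^+ 2 + enorm w ^+ 2.
  rewrite ez !(dotDl, dotDr, dotZl, dotZr) (dotC w y) yw -!sqr_enorm; field.
  by rewrite gt_eqF.
have zr : enorm z = line_radius (enorm w) x by rewrite enormE zz.
have z0 : z != 0 by rewrite -enorm_gt0 zr line_radius_gt0.
split=> //; rewrite /line_dist2 /line_log -zz -ln_enorm //; congr (_ + _ ^+ 2).
apply: angle_unique => //.
- exact/ltW/line_angle_gt0.
- exact/ltW/line_angle_lt_pi.
rewrite zr -mulrA line_radius_cos // ez dotDr dotZr yw addr0 -sqr_enorm; field.
by rewrite gt_eqF.
Qed.

(* The angle is 0 on the half-axis of y and pi on the opposite one, which a ball
   of radius less than pi does not reach. *)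
Lemma log_polar_axis y (x : R) : y != 0 -> x != 0 ->
  (ln (enorm (x *: y)) - ln (enorm y)) ^+ 2 + angle y (x *: y) ^+ 2 =
  ln `|x| ^+ 2 + (if 0 < x then 0 else pi) ^+ 2.
Proof.
move=> y0 x0; have N0 : 0 < enorm y by rewrite enorm_gt0.
have a0 : 0 < `|x| by rewrite normr_gt0.
have xy : x *: y != 0 by rewrite scaler_eq0 negb_or x0.
rewrite enormZ lnM ?posrE // addrK; congr (_ + _ ^+ 2).
case: ifP => xs; apply: angle_unique => //; rewrite ?pi_ge0 //.
  by rewrite cos0 mulr1 dotZr -sqr_enorm enormZ gtr0_norm // expr2; ring.
rewrite cospi dotZr -sqr_enorm enormZ ler0_norm; first by rewrite expr2; ring.
by rewrite leNgt xs.
Qed.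

(** Such a ball need not be convex, but it meets every line parallel to y in an
interval. *)
Lemma qh_ball_close_to_convex y r l : (2 <= n)%N -> is_lambda l -> y != 0 -> 0 < r -> r <= l ->
  close_to_convex (qh_ball (~` [set 0]) y r).
Proof.
move=> n2 hl y0 r0 rl.
have N0 : 0 < enorm y by rewrite enorm_gt0.
have rl2 : r ^+ 2 <= l ^+ 2 by rewrite ler_pXn2r // nnegrE ltW // (lt_le_trans r0).
apply: (directionally_convex_close_to_convex _ y0).
  apply/eqP => e; have [h _] : qh_ball (~` [set 0]) y r 0 by rewrite e.
  exact: h.
move=> z s t s0 t0; rewrite !qh_ball_punctured //.
pose x := dot y z / enorm y; pose w := z - (x / enorm y) *: y.
have yw : dot y w = 0.
  rewrite /w dotDr dotNr dotZr -sqr_enorm /x; field; by rewrite gt_eqF.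
have ez : z = (x / enorm y) *: y + w by rewrite addrC subrK.
have ea a : z + a *: y = ((x + a * enorm y) / enorm y) *: y + w.
  rewrite {1}ez addrAC -scalerDl; congr (_ *: _ + _); field; by rewrite gt_eqF.
have [w0|w0] := eqVneq w 0; last first.
  have [z0 ->] := log_polar_line y0 w0 yw ez.
  have e1 : z - s *: y = ((x - s * enorm y) / enorm y) *: y + w by rewrite -scaleNr ea mulNr.
  have [z1 ->] := log_polar_line y0 w0 yw e1.
  have [z2 ->] := log_polar_line y0 w0 yw (ea t).
  move=> [_ h1] [_ h2]; split=> //.
  have w1 : 0 < enorm w by rewrite enorm_gt0.
  apply: (line_ball_convex w1 hl rl2 _ _ h1 h2).
    by rewrite gerBl mulr_ge0 // ltW.
  by rewrite lerDl mulr_ge0 // ltW.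
have l0 : 0 <= l by case/is_lambdaP: hl.
have rpi : r ^+ 2 < pi ^+ 2.
  by rewrite ltr_pXn2r ?nnegrE ?pi_ge0 ?(ltW r0) //; case: hl => _ lp _; exact: le_lt_trans lp.
have ez' : z = (x / enorm y) *: y by rewrite {1}ez w0 addr0.
rewrite ez' -scalerBl -scalerDl; move: (x / enorm y) => k.
have on_axis a : a *: y != 0 -> (ln (enorm (a *: y)) - ln (enorm y)) ^+ 2 + angle y (a *: y) ^+ 2 < r ^+ 2 ->
    0 < a /\ ln a ^+ 2 < r ^+ 2.
  move=> ay; have a0 : a != 0 by move: ay; rewrite scaler_eq0 negb_or => /andP[].
  rewrite log_polar_axis //; case: ifP => ha.
    by rewrite expr0n addr0 gtr0_norm.
  by have := sqr_ge0 (ln `|a|); lra.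
move=> [k1 /(on_axis _ k1)[p1 q1]] [k2 /(on_axis _ k2)[p2 q2]].
have k0 : 0 < k by lra.
rewrite scaler_eq0 negb_or y0 andbT gt_eqF //; split=> //.
rewrite log_polar_axis ?gt_eqF // k0 expr0n addr0 gtr0_norm //.
have m1 : ln (k - s) <= ln k by rewrite ler_ln ?posrE //; lra.
have m2 : ln k <= ln (k + t) by rewrite ler_ln ?posrE //; lra.
have [p|p] := leP 0 (ln k).
  apply: le_lt_trans q2; rewrite ler_pXn2r ?nnegrE //; lra.
apply: le_lt_trans q1; rewrite -(sqrrN (ln k)) -(sqrrN (ln (k - s))) ler_pXn2r ?nnegrE //; lra.
Qed.

End QhBallConvexity.


(** * Sharpness for the quasihyperbolic metric *)

Section Sharpness.
Context {R : realType}.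
Implicit Types (z u v : 'rV[R]_2) (r t l m : R).

Lemma line_dist2_left (c h p : R) : 0 < h -> 0 < line_slope c h p ->
  exists2 a, a < p & line_dist2 c h a < line_dist2 c h p.
Proof.
move=> h0 sp.
have cs : {for p, continuous (line_slope c h)}.
  apply: differentiable_continuous; apply/derivable1_diffP.
  exact: (@ex_derive _ _ _ _ _ _ _ (is_derive_line_slope c h0 p)).
have [d /= d0 hd] : \forall z \near p, 0 < line_slope c h z.
  exact: (cvgr_gt _ cs _ sp).
have ap : p - d / 2 < p by rewrite ltrBlDr ltrDl divr_gt0.
exists (p - d / 2) => //.
have := @derivative_gt0_lt R (line_dist2 c h) _ _ _ ap (fun x _ => is_derive_line_dist2 c h0 x).
apply=> x /andP[ax xp]; rewrite divr_gt0 ?ltr_wpDl ?sqr_ge0 ?exprn_gt0 // mulr_gt0 //; apply: hd => /=.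
by rewrite gtr0_norm; lra.
Qed.

Local Notation e1 := (vec2 1 0 : 'rV[R]_2).

Let enorm_e1 : enorm e1 = 1.
Proof. by rewrite enormE dot2 !vec2E mulr0 addr0 mulr1 sqrtr1. Qed.

Let e1_neq0 : e1 != 0.
Proof. by rewrite -enorm_gt0 enorm_e1. Qed.

Variables (l r q : R).
Hypothesis lambda_l : is_lambda l.
Hypotheses (q_pi : pi / 2 < q) (lq : l ^+ 2 = q ^+ 2 + 1) (f0 : lambda_fun q = 0).
Hypotheses (lr : l < r) (r_pi : r < pi).

Local Notation D := (qh_ball (~` [set 0]) e1 r).

Let l0 : 0 <= l. Proof. by case/is_lambdaP: lambda_l. Qed.
Let q0 : 0 < q. Proof. by have := pi_gt0 R; have := q_pi; lra. Qed.
Let ql : q < l. Proof. by rewrite -(@ltr_pXn2r _ 2) ?nnegrE ?(ltW q0) // lq ltrDl. Qed.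
Let r0 : 0 < r. Proof. by have := ql; have := q0; have := lr; lra. Qed.

Let DE z : D z <-> z != 0 /\ ln (enorm z) ^+ 2 + angle e1 z ^+ 2 < r ^+ 2.
Proof. by rewrite qh_ball_punctured // enorm_e1 ln1 subr0. Qed.

Let dot_e1 z : dot e1 z = z 0 0.
Proof. by rewrite dot2 !vec2E mul1r mul0r addr0. Qed.

Let cos_angle_e1 z : z != 0 -> enorm z * cos (angle e1 z) = z 0 0.
Proof. by move=> z0; have := cos_angle e1_neq0 z0; rewrite enorm_e1 mul1r dot_e1. Qed.

Let flip z : 'rV[R]_2 := vec2 (z 0 0) (- z 0 1).

Let D_flip z : D (flip z) <-> D z.
Proof.
have d : dot (flip z) (flip z) = dot z z by rewrite !dot2 !vec2E mulrNN.
have e : enorm (flip z) = enorm z by rewrite !enormE d.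
have a : angle e1 (flip z) = angle e1 z by rewrite /angle e !dot_e1 vec2E.
by rewrite !DE a e -!enorm_gt0 e.
Qed.

Let D_unit z : dot z z = 1 -> cos r < z 0 0 -> D z.
Proof.
move=> zz cr; have nz : enorm z = 1 by rewrite enormE zz sqrtr1.
have z0 : z != 0 by rewrite -enorm_gt0 nz.
apply/DE; split=> //; rewrite nz ln1 expr0n add0r ltr_pXn2r ?nnegrE ?angle_ge0 ?(ltW r0) //.
have := cos_angle_e1 z0; rewrite nz mul1r => e; move: cr; rewrite -e ltr_cos //;
  by rewrite in_itv /= ?angle_ge0 ?angle_le_pi ?(ltW r0) ?(ltW r_pi).
Qed.

Let m := Num.sqrt (r ^+ 2 - q ^+ 2).
Let m2 : m ^+ 2 = r ^+ 2 - q ^+ 2.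
Proof.
rewrite sqr_sqrtr // subr_ge0 ler_pXn2r ?nnegrE ?(ltW q0) ?(ltW r0) //.
by have := ql; have := lr; lra.
Qed.
Let m1 : 1 < m.
Proof.
have m0 : 0 <= m by exact: sqrtr_ge0.
have : 1 < m ^+ 2.
  rewrite m2; have : l ^+ 2 < r ^+ 2 by rewrite ltr_pXn2r // nnegrE ltW.
  by rewrite lq; lra.
by nra.
Qed.

(* P has angle q and logarithm of the radius -m, so it lies on the sphere of
   radius r. At this angle the boundary of the complement has a horizontal
   tangent when r is lambda. *)
Let rho := expR (- m).
Let rho0 : 0 < rho. Proof. exact: expR_gt0. Qed.
Let rho1 : rho < 1. Proof. by rewrite expR_lt1; have := m1; lra. Qed.
Let p := rho * cos q.
Let h := rho * sin q.
Let q_lt_pi : q < pi. Proof. by have := ql; have := lr; have := r_pi; lra. Qed.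
Let cq0 : cos q < 0. Proof. by apply: cos_lt0_pihalf => //; exact: ltW. Qed.
Let p0 : p < 0. Proof. by rewrite pmulr_rlt0. Qed.
Let h0 : 0 < h. Proof. by rewrite mulr_gt0 // sin_gt0_pi // q0 q_lt_pi. Qed.
Let ph : p ^+ 2 + h ^+ 2 = rho ^+ 2.
Proof. by rewrite !exprMn -mulrDr cos2Dsin2 mulr1. Qed.
Let P := vec2 p h.

Let line_log_p : line_log 0 h p = - m.
Proof. by rewrite /line_log ph lnXn // /rho expRK; lra. Qed.

Let line_angle_p : line_angle h p = q.
Proof.
have := line_radius_cos h0 p; rewrite /line_radius ph sqrtr_sqr gtr0_norm // {2}/p.
move=> /mulfI; rewrite gt_eqF // => /(_ isT); apply: cos_inj.
  by rewrite in_itv /= (ltW (line_angle_gt0 _ _)) (ltW (line_angle_lt_pi _ _)).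
by rewrite in_itv /= (ltW q0) (ltW q_lt_pi).
Qed.

Let D_line a : D (vec2 a h) <-> line_dist2 0 h a < r ^+ 2.
Proof.
have w0 : vec2 0 h != 0 :> 'rV[R]_2.
  by apply/eqP => /(congr1 (fun x : 'rV[R]_2 => x 0 1)); rewrite vec2E mxE; apply/eqP; rewrite gt_eqF.
have e : vec2 a h = (a / enorm e1) *: e1 + vec2 0 h.
  by rewrite enorm_e1 divr1; apply: eq_row2; rewrite !mxE /=; ring.
have dw : dot e1 (vec2 0 h) = 0 by rewrite dot_e1 vec2E.
have nw : enorm (vec2 0 h) = h by rewrite enormE dot2 !vec2E mulr0 add0r -expr2 sqrtr_sqr gtr0_norm.
have [a0 ea] := log_polar_line e1_neq0 w0 dw e.
rewrite DE; move: ea; rewrite enorm_e1 ln1 subr0 nw => ->; split=> [[]//|H]; split=> //.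
Qed.

Let line_dist2_p : line_dist2 0 h p = r ^+ 2.
Proof. by rewrite /line_dist2 line_log_p line_angle_p sqrrN m2 subrK. Qed.

Let nDP : ~ D P.
Proof. by rewrite /P D_line line_dist2_p ltxx. Qed.

(** The slope at P is positive because r exceeds lambda: this is where the
equation of lambda enters. *)
Let slope_p : 0 < line_slope 0 h p.
Proof.
rewrite /line_slope line_log_p line_angle_p.
have e : q * sin q = - cos q by move: f0; rewrite /lambda_fun; lra.
have -> : p * - m - h * q = rho * (- cos q * m - q * sin q) by rewrite /p /h; ring.
rewrite e; have -> : - cos q * m - - cos q = - cos q * (m - 1) by ring.
by rewrite !mulr_gt0 // ?oppr_gt0 // subr_gt0.
Qed.

Let dotP : dot P P < 1.
Proof.
rewrite dot2 !vec2E -!expr2 ph; have := rho0; have := rho1; nra.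
Qed.

Let exit_unit_disc u : u != 0 -> exists2 t, 0 < t & dot (P + t *: u) (P + t *: u) = 1.
Proof.
move=> u0; have uu : 0 < enorm u by rewrite enorm_gt0.
pose f t := dot (P + t *: u) (P + t *: u).
have fE : f = fun t => dot P P + 2 * dot P u * t + dot u u * (t * t).
  by apply/funext => t; rewrite /f !dotE (dotC u P); ring.
have df t : is_derive t 1 f (2 * dot P u + dot u u * (t + t)).
  have -> : f = cst (dot P P) + (2 * dot P u) \*: id + dot u u \*: (id * id).
    by apply/funext => s; rewrite fE !fctE.
  by apply: is_derive_eq; rewrite /GRing.scale /=; ring.
pose T := 2 / enorm u.
have T0 : 0 < T by rewrite divr_gt0.
have Pn : enorm P < 1.
  by rewrite -(@ltr_pXn2r _ 2) ?nnegrE ?enorm_ge0 // sqr_enorm expr1n dotP.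
have fT : 1 < f T.
  rewrite /f -sqr_enorm.
  have : enorm (T *: u) <= enorm (P + T *: u) + enorm P.
    by have := enormD (P + T *: u) (- P); rewrite enormN addrAC subrr add0r.
  rewrite enormZ gtr0_norm // divfK ?gt_eqF // => H; have := enorm_ge0 P; nra.
have f0' : f 0 < 1 by rewrite /f scale0r addr0 dotP.
have [|t] := @IVT R f 0 T 1 (ltW T0) (is_derive_within (fun t _ => df t)).
  by rewrite min_l ?max_r ?(ltW f0') ?(ltW fT) //; exact: ltW (lt_trans f0' fT).
rewrite in_itv /= => /andP[t0 _] ft; exists t => //.
rewrite lt_neqAle t0 andbT; apply: contraTneq f0' => ->.
by rewrite ft ltxx.
Qed.

(** A ray from P that does not descend leaves the unit disc through the ball, or
else crosses before that the radius through a point of the ball on its left. *)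
Let upward_hits u : u != 0 -> 0 <= u 0 1 -> exists2 t, 0 <= t & D (P + t *: u).
Proof.
move=> u0 u1; have [t t0 ut] := exit_unit_disc u0.
have [a ap fa] := line_dist2_left h0 slope_p.
pose A : 'rV[R]_2 := vec2 a h.
have DA : D A.
  by apply/D_line; rewrite -line_dist2_p.
have /DE[A0 FA] := DA.
have a0 : a < 0 by exact: lt_trans p0.
have nA : 0 < enorm A by rewrite enorm_gt0.
have aA : angle e1 A < r.
  rewrite -(@ltr_pXn2r _ 2) ?nnegrE ?angle_ge0 ?(ltW r0) //.
  by apply: le_lt_trans FA; rewrite lerDr sqr_ge0.
have cA : cos r < cos (angle e1 A).
  rewrite ltr_cos ?in_itv /= ?angle_ge0 ?angle_le_pi //.
  by rewrite (ltW r0) (ltW r_pi).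
have eA := cos_angle_e1 A0; rewrite vec2E in eA.
have nA2 : enorm A ^+ 2 = a ^+ 2 + h ^+ 2 by rewrite sqr_enorm dot2 !vec2E -!expr2.
pose X := P + t *: u.
have X0 : X 0 0 = p + t * u 0 0 by rewrite !mxE.
have X1 : X 0 1 = h + t * u 0 1 by rewrite !mxE.
have tu1 : 0 <= t * u 0 1 by rewrite mulr_ge0 // ltW.
have XX : X 0 0 ^+ 2 + X 0 1 ^+ 2 = 1 by rewrite -ut dot2 -!expr2.
have [side|side] := leP (a * X 0 1) (h * X 0 0).
  exists t; first exact: ltW.
  apply: D_unit => //; rewrite -/X; apply: lt_le_trans cA _.
  rewrite -(ler_pM2l nA) eA leNgt; apply/negP => H.
  have n0 : enorm A * X 0 0 < 0 by lra.
  have k1 : a ^+ 2 < enorm A ^+ 2 * X 0 0 ^+ 2 by rewrite -exprMn; nra.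
  have k2 : enorm A ^+ 2 * X 0 1 ^+ 2 < h ^+ 2.
    have : enorm A ^+ 2 * (X 0 0 ^+ 2 + X 0 1 ^+ 2) = a ^+ 2 + h ^+ 2 by rewrite XX mulr1 nA2.
    by lra.
  have k3 : enorm A * X 0 1 < h.
    rewrite -exprMn in k2; rewrite ltNge; apply/negP => H'.
    have := h0; move: (enorm A * X 0 1) k2 H' => B k2 H' hh.
    by have : h * h <= B * B; [apply: ler_pM => //; exact: ltW|rewrite -!expr2; lra].
  have k4 : h * (enorm A * X 0 0) < h * a by rewrite ltr_pM2l.
  have k5 : a * h < a * (enorm A * X 0 1) by rewrite ltr_nM2l.
  have k6 : enorm A * (a * X 0 1) <= enorm A * (h * X 0 0) by rewrite ler_pM2l.
  lra.
pose sP := h * (p - a); pose sX := a * X 0 1 - h * X 0 0.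
have sP0 : 0 < sP by rewrite mulr_gt0 // subr_gt0.
have sX0 : 0 < sX by rewrite subr_gt0.
pose k := sP / (sP + sX).
have k0 : 0 < k by exact: divr_gt0 sP0 (addr_gt0 sP0 sX0).
have sPX : 0 < sP + sX by exact: addr_gt0.
have k1 : k < 1 by rewrite /k ltr_pdivrMr // mul1r ltrDl.
have ke : k * (sP + sX) = sP by rewrite divfK // gt_eqF.
exists (k * t); first by rewrite mulr_ge0 // ltW.
pose Z := P + (k * t) *: u.
have Z0 : Z 0 0 = p + k * (X 0 0 - p) by rewrite X0 !mxE /=; ring.
have Z1 : Z 0 1 = h + k * (X 0 1 - h) by rewrite X1 !mxE /=; ring.
have col : a * Z 0 1 = h * Z 0 0.
  by rewrite Z0 Z1; move: ke; rewrite /sP /sX; lra.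
pose j := Z 0 1 / h.
have jh : j * h = Z 0 1 by rewrite divfK // gt_eqF.
have j1 : 1 <= j.
  by rewrite ler_pdivlMr // mul1r Z1 lerDl; apply: mulr_ge0; [exact: ltW|rewrite X1; lra].
have j0 : 0 < j by lra.
have ZA : Z = j *: A.
  apply: eq_row2; rewrite [RHS]mxE !vec2E //.
  by apply: (mulfI (_ : h != 0)); [rewrite gt_eqF|rewrite -col -jh; ring].
have ZZ : dot Z Z <= 1.
  have : dot Z Z = Z 0 0 ^+ 2 + Z 0 1 ^+ 2 by rewrite dot2 -!expr2.
  have : (1 - k) * (p ^+ 2 + h ^+ 2) <= 1 - k.
    by rewrite ler_piMr ?subr_ge0 ?(ltW k1) // ph; have := rho0; have := rho1; nra.
  have : 0 <= k * (1 - k) * ((X 0 0 - p) ^+ 2 + (X 0 1 - h) ^+ 2).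
    by rewrite mulr_ge0 ?addr_ge0 ?sqr_ge0 // mulr_ge0 ?subr_ge0 // ltW.
  rewrite Z0 Z1 => h1 h2 ->.
  have : k * (X 0 0 ^+ 2 + X 0 1 ^+ 2) = k by rewrite XX mulr1.
  by lra.
apply/DE; rewrite -/Z; split; first by rewrite ZA scaler_eq0 negb_or gt_eqF.
apply: le_lt_trans FA.
have -> : angle e1 Z = angle e1 A.
  by rewrite ZA /angle dotZr enormZ gtr0_norm //; congr acos; field; rewrite enorm_e1 !gt_eqF.
rewrite lerD2r -sqrrN -[leRHS]sqrrN ler_pXn2r ?nnegrE ?oppr_ge0.
- rewrite lerN2 ler_ln ?posrE //; first by rewrite ZA enormZ gtr0_norm // ler_peMl // ltW.
  by rewrite ZA enormZ mulr_gt0 ?normr_gt0 ?gt_eqF.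
- done.
- by apply: ln_le0; rewrite -(@ler_pXn2r _ 2) ?nnegrE ?enorm_ge0 // sqr_enorm expr1n.
- apply: ln_le0; rewrite -(@ler_pXn2r _ 2) ?nnegrE ?enorm_ge0 // sqr_enorm expr1n.
  apply: le_trans ZZ; rewrite ZA dotZl dotZr mulrA ler_peMl ?dot_ge0 //; nra.
Qed.

(** A ray from P that does not lead to the left leaves the unit disc to the right
of the narrow gap around -e1 that the ball leaves open on the unit circle. *)
Let downward_hits u : u != 0 -> 0 <= u 0 0 -> exists2 t, 0 <= t & D (P + t *: u).
Proof.
move=> u0 ux; have [t t0 ut] := exit_unit_disc u0.
exists t; first exact: ltW.
apply: D_unit => //; rewrite !mxE /=.
have : cos r < cos q.
  have qr : q < r by have := ql; have := lr; lra.
  by rewrite ltr_cos //; rewrite in_itv /= ?(ltW r0) ?(ltW r_pi) ?(ltW q0) ?(ltW q_lt_pi).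
have : cos q <= p by rewrite /p; have := rho0; have := rho1; have := cq0; nra.
have : 0 <= t * u 0 0 by rewrite mulr_ge0 // ltW.
lra.
Qed.

(** The rays from P that avoid the ball all descend to the left, those from its
mirror image all ascend to the left. *)
Lemma qh_ball_not_close_to_convex : ~ close_to_convex (qh_ball (~` [set 0]) (vec2 1 0 : 'rV[R]_2) r).
Proof.
have top u : u != 0 -> (forall t, 0 <= t -> ~ D (P + t *: u)) -> 0 < -1 * u 0 0 /\ u 0 1 < 0.
  move=> u0 hu; split.
    rewrite mulN1r oppr_gt0 ltNge; apply/negP => /(downward_hits u0)[t t0]; exact: hu.
  by rewrite ltNge; apply/negP => /(upward_hits u0)[t t0]; exact: hu.
have flipP : flip P = vec2 p (- h) by rewrite /flip !vec2E.
apply: (@mirror_not_close_to_convex R D p h (- h) (-1)) => //.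
- by have := h0; lra.
- by rewrite -flipP D_flip; exact: nDP.
move=> u u0 hu.
have fu0 : flip u != 0.
  apply: contraNneq u0 => e; apply/eqP/eq_row2; rewrite mxE.
    by have := congr1 (fun x : 'rV[R]_2 => x 0 0) e; rewrite vec2E mxE.
  have := congr1 (fun x : 'rV[R]_2 => x 0 1) e; rewrite vec2E mxE => /eqP.
  by rewrite oppr_eq0 => /eqP.
have [|h1 h2] := top _ fu0.
  move=> t t0; rewrite -D_flip.
  have -> : flip (P + t *: flip u) = vec2 p (- h) + t *: u.
    by apply: eq_row2; rewrite /flip !mxE /=; ring.
  exact: hu.
by move: h1 h2; rewrite !vec2E oppr_lt0.
Qed.

End Sharpness.

(** * The theorem *)

Theorem theorem1p2 (R : realType) (n : nat) (hn : (2 <= n)%N) :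
  (* (1), and its sharpness in the plane *)
  [/\ forall (G : set 'rV[R]_n) (x : 'rV[R]_n) (r : R),
        domain G -> G != setT -> G x ->
        0 < r -> r <= ln (1 + Num.sqrt 3) ->
        close_to_convex (j_ball G x r)
    & n = 2%N ->
      forall c : R, ln (1 + Num.sqrt 3) < c ->
        ~ (forall (G : set 'rV[R]_n) (x : 'rV[R]_n) (r : R),
             domain G -> G != setT -> G x ->
             0 < r -> r <= c ->
             close_to_convex (j_ball G x r))]
  /\
  (exists! lambda : R, is_lambda lambda)
  /\
  (* (2), and its sharpness in the plane *)
  forall lambda : R, is_lambda lambda ->
  [/\ (* lambda = 2.97169 to the printed digits *)
      `|lambda - (297 / 10 ^+ 2 + 169 / 10 ^+ 5)| <= 5 / 10 ^+ 6,
      forall (y : 'rV[R]_n) (r : R),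
        y != 0 -> 0 < r -> r <= lambda ->
        close_to_convex (qh_ball (~` [set 0]) y r)
    & n = 2%N ->
      forall c : R, lambda < c ->
        ~ (forall (y : 'rV[R]_n) (r : R),
             y != 0 -> 0 < r -> r <= c ->
             close_to_convex (qh_ball (~` [set 0]) y r))].
Proof.
split; [split|split].
- by move=> G x r [oG _ _]; exact: j_ball_close_to_convex.
- move=> n2; subst n => c hc H; apply: (j_ball_not_close_to_convex hc).
  apply: H => //.
  + exact: domain_punctured.
  + exact: punctured_neqT.
  + move=> /(congr1 (fun x : 'rV[R]_2 => x 0 0)); rewrite vec2E mxE => /eqP.
    by rewrite oppr_eq0 oner_eq0.
  + by apply: lt_trans hc; apply: ln_gt0; rewrite ltrDl sqrtr_gt0.
- exact: lambda_exists_unique.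
move=> l hl; split.
- exact: lambda_bounds.
- by move=> y r y0 r0 rl; exact: qh_ball_close_to_convex hl y0 r0 rl.
move=> n2; subst n => c lc H.
have [l0 [q [q1 q2 lq lpi f0]]] : 0 <= l /\ exists q, [/\ pi / 2 < q, q < pi,
    l ^+ 2 = q ^+ 2 + 1, l < pi & lambda_fun q = 0] by apply/is_lambdaP.
have [r [lr rc rpi]] : exists r, [/\ l < r, r <= c & r < pi].
  have [cpi|cpi] := ltP c pi; first by exists c.
  by exists ((l + pi) / 2); split; lra.
apply: (qh_ball_not_close_to_convex hl q1 lq f0 lr rpi); apply: H rc; last by lra.
apply/eqP => /(congr1 (fun x : 'rV[R]_2 => x 0 0)); rewrite vec2E mxE => /eqP.
by rewrite oner_eq0.
Qed.
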